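(* The assignment $$X\mapsto \operatorname{RMaps}_{\operatorname{PGL}_n}(X,\operatorname{M}_n),\qquad (f\colon X\dashrightarrow Y)\mapsto \bigl(f^\star\colon \operatorname{RMaps}_{\operatorname{PGL}_n}(Y,\operatorname{M}_n)\hookrightarrow\operatorname{RMaps}_{\operatorname{PGL}_n}(X,\operatorname{M}_n)\bigr),\quad f^\star(g)=g\circ f,$$ defines a full and faithful contravariant functor from the category $\mathcal E_n$ to the category $\mathit{CS}_n$.
   Context: $k$ is an algebraically closed field of arbitrary characteristic and $n\ge 1$ is a fixed integer. All rings and algebras are associative with $1$; homomorphisms respect $1$. $\operatorname{M}_n$ is the algebra of $n\times n$ matrices over $k$; $\operatorname{PGL}_n$ acts on $\operatorname{M}_n$ by conjugation and on $(\operatorname{M}_n)^m$ by simultaneous conjugation. $U_{m,n}\subseteq(\operatorname{M}_n)^m$ is the $\operatorname{PGL}_n$-stable Zariski open set of $m$-tuples that generate $\operatorname{M}_n$ as a $k$-algebra. An $n$-variety is a $\operatorname{PGL}_n$-stable subset $X$ of some $U_{m,n}$ that is Zariski closed in $U_{m,n}$. A $\operatorname{PGL}_n$-variety is an algebraic variety over $k$ with an algebraic action of $\operatorname{PGL}_n$. For an irreducible $\operatorname{PGL}_n$-variety $X$, $\operatorname{RMaps}_{\operatorname{PGL}_n}(X,\operatorname{M}_n)$ denotes the $k$-algebra (under pointwise operations) of $\operatorname{PGL}_n$-equivariant rational maps $X\dashrightarrow\operatorname{M}_n$. $\mathcal E_n$: objects are the irreducible $\operatorname{PGL}_n$-varieties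 that are $\operatorname{PGL}_n$-equivariantly birationally isomorphic to some $n$-variety; morphisms are the $\operatorname{PGL}_n$-equivariant dominant rational maps. $\mathit{CS}_n$: objects are the central simple algebras of degree $n$ (dimension $n^2$ over the center) whose center is a finitely generated field extension of $k$; morphisms are $k$-algebra homomorphisms (necessarily injective). *)

(* Defs.v *)
From HB Require Import structures.
From mathcomp Require Import all_boot all_order all_algebra.
From mathcomp Require Import mathcomp_extra boolp classical_sets functions.
From mathcomp Require Import topology.
From mathcomp Require Import mpoly.

Set Implicit Arguments.
Unset Strict Implicit.
Unset Printing Implicit Defensive.

Import GRing.Theory.

Local Open Scope classical_set_scope.
Local Open Scope ring_scope.
Local Open Scope quotient_scope.

(* Spaces with functions: a topological space with a sheaf O of k-valued
   functions, given by its germs: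
     O(U) = {f | f is regular at every point of U}   (U open).
   Gluing and restriction then hold by construction.  Functions are total;
   by regular_eq only their values near the point matter. *)
HB.mixin Record Topological_isFunSpace (k : fieldType) T & Topological T := {
  regular_at : T -> (T -> k) -> Prop;
  regular_near : forall (x : T) f,
    regular_at x f -> \forall y \near x, regular_at y f;
  regular_eq : forall (x : T) f g,
    (\forall y \near x, f y = g y) -> regular_at x f -> regular_at x g;
  regular_cst : forall x c, regular_at x (fun=> c);
  regularD : forall x f g,
    regular_at x f -> regular_at x g -> regular_at x (fun y => f y + g y);
  regularM : forall x f g,
    regular_at x f -> regular_at x g -> regular_at x (fun y => f y * g y);
  regular_neq0 : forall (x : T) f,
    regular_at x f -> f x != 0 -> \forall y \near x, f y != 0;
  regularV : forall (x : T) f,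
    regular_at x f -> f x != 0 -> regular_at x (fun y => (f y)^-1)
}.

#[short(type="funSpaceType")]
HB.structure Definition FunSpace (k : fieldType) :=
  {T of Topological T & Topological_isFunSpace k T}.

Arguments regular_near {k s x f}.
Arguments regular_eq {k s x f g}.
Arguments regularD {k s x f g}.
Arguments regularM {k s x f g}.
Arguments regular_neq0 {k s x f}.
Arguments regularV {k s x f}.

Definition morphism_at (k : fieldType) (X Y : funSpaceType k) (f : X -> Y)
    (x : X) : Prop :=
  {for x, continuous f} /\
  forall g : Y -> k, regular_at (f x) g -> regular_at x (g \o f).

Definition is_morphism (k : fieldType) (X Y : funSpaceType k) (f : X -> Y) :=
  forall x, morphism_at f x.

Definition isomorphic (k : fieldType) (X Y : funSpaceType k) : Prop :=
  exists (f : X -> Y) (g : Y -> X),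
    [/\ is_morphism f, is_morphism g, cancel f g & cancel g f].

Section Regular.
Context {k : fieldType} {X : funSpaceType k}.
Implicit Types (x : X) (f : X -> k).

Lemma regular_sum x (I : Type) (r : seq I) (F : I -> X -> k) :
  (forall i, regular_at x (F i)) -> regular_at x (fun y => \sum_(i <- r) F i y).
Proof.
move=> rF; elim: r => [|i r IHr].
  apply: regular_eq _ (regular_cst x 0).
  by apply: nearW => y; rewrite big_nil.
apply: regular_eq _ (regularD (rF i) IHr).
by apply: nearW => y; rewrite big_cons.
Qed.

Lemma regularZ x c f : regular_at x f -> regular_at x (fun y => c * f y).
Proof. by move=> rf; exact: regularM (regular_cst x c) rf. Qed.

Lemma regular_meval x d (F : 'I_d -> X -> k) (p : {mpoly k[d]}) :
  (forall i, regular_at x (F i)) -> regular_at x (fun y => p.@[fun i => F i y]).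
Proof.
move=> rF.
have rX f e : regular_at x f -> regular_at x (fun y => f y ^+ e).
  move=> rf; elim: e => [|e IHe].
    by apply: regular_eq _ (regular_cst x 1); apply: nearW => y; rewrite expr0.
  by apply: regular_eq _ (regularM rf IHe); apply: nearW => y; rewrite exprS.
have rprod (r : seq 'I_d) (G : 'I_d -> X -> k) :
    (forall i, regular_at x (G i)) ->
    regular_at x (fun y => \prod_(i <- r) G i y).
  move=> rG; elim: r => [|i r IHr].
    by apply: regular_eq _ (regular_cst x 1); apply: nearW => y; rewrite big_nil.
  apply: regular_eq _ (regularM (rG i) IHr).
  by apply: nearW => y; rewrite big_cons.
apply: (@regular_eq _ _ _ (fun y =>
    \sum_(m <- msupp p) p@_m * \prod_i F i y ^+ m i)).
  by apply: nearW => y; rewrite mevalE.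
apply: regular_sum => m; apply/regularZ/rprod => i; exact: rX.
Qed.

End Regular.

Section SubSpace.
Context {k : fieldType} {X : funSpaceType k} (S : set X).

Definition sub_regular_at (x : S) (f : S -> k) : Prop :=
  exists2 g : X -> k, regular_at (\val x) g &
    \forall y \near x, f y = g (\val y).

Let near_val (x : S) (P : set X) :
  (\forall y \near \val x, P y) -> \forall y \near x, P (\val y).
Proof. exact: (@initial_continuous S X set_val x). Qed.

Let sub_regular_near x f :
  sub_regular_at x f -> \forall y \near x, sub_regular_at y f.
Proof.
case=> g /regular_near/near_val rg /near_join efg.
by apply: filterS2 rg efg => y rg efg; exists g.
Qed.

Let sub_regular_eq x f g : (\forall y \near x, f y = g y) ->
  sub_regular_at x f -> sub_regular_at x g.
Proof.
move=> efg [h rh efh]; exists h => //.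
by apply: filterS2 efg efh => y <- ->.
Qed.

Let sub_regular_cst x c : sub_regular_at x (fun=> c).
Proof.
by exists (fun=> c); [exact: regular_cst|exact: (nearW (F := nbhs x))].
Qed.

Let sub_regularD x f g : sub_regular_at x f -> sub_regular_at x g ->
  sub_regular_at x (fun y => f y + g y).
Proof.
move=> [f' rf ef] [g' rg eg]; eexists; first exact: regularD rf rg.
by apply: filterS2 ef eg => y -> ->.
Qed.

Let sub_regularM x f g : sub_regular_at x f -> sub_regular_at x g ->
  sub_regular_at x (fun y => f y * g y).
Proof.
move=> [f' rf ef] [g' rg eg]; eexists; first exact: regularM rf rg.
by apply: filterS2 ef eg => y -> ->.
Qed.

Let sub_regular_neq0 x f : sub_regular_at x f -> f x != 0 ->
  \forall y \near x, f y != 0.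
Proof.
move=> [g rg efg] fx.
have gx : g (\val x) != 0 by rewrite -(nbhs_singleton efg).
by apply: filterS2 efg (near_val (regular_neq0 rg gx)) => y ->.
Qed.

Let sub_regularV x f : sub_regular_at x f -> f x != 0 ->
  sub_regular_at x (fun y => (f y)^-1).
Proof.
move=> [g rg efg] fx.
have gx : g (\val x) != 0 by rewrite -(nbhs_singleton efg).
by eexists; [exact: regularV rg gx|apply: filterS efg => y ->].
Qed.

HB.instance Definition _ := Topological_isFunSpace.Build k S
  sub_regular_near sub_regular_eq sub_regular_cst sub_regularD sub_regularM
  sub_regular_neq0 sub_regularV.

End SubSpace.

(* The affine space of a finite-dimensional vector space V, with the Zariski
   topology.  The coordinates used do not affect the result. *)
Definition affine (k : fieldType) (V : vectType k) : Type := V.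

Section AffineSpace.
Context {k : fieldType} {V : vectType k}.

Definition polyval (p : {mpoly k[\dim {: V}]}) (v : V) : k :=
  p.@[fun i => coord (vbasis {: V}) i v].

Definition zero_locus (P : set {mpoly k[\dim {: V}]}) : set V :=
  [set v | forall p, P p -> polyval p v = 0].

Local Notation A := (affine V).

HB.instance Definition _ := Choice.on A.

Definition zariski_open (U : set A) : Prop := exists P, U = ~` zero_locus P.

Let zariski_openP (U : set A) : zariski_open U <->
  forall v, U v -> exists2 p, polyval p v != 0 &
    forall w, polyval p w != 0 -> U w.
Proof.
split=> [[P ->] v /existsNP[p /not_implyP[Pp /eqP pv]]|UP].
  by exists p => // w /eqP pw; apply/existsNP; exists p => /(_ Pp).
exists [set p | forall w, polyval p w != 0 -> U w].
apply/seteqP; split=> v.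
  by move=> /UP[p pv pU] /(_ p pU) /eqP; rewrite (negPf pv).
by move=> /existsNP[p /not_implyP[Pp /eqP pv]]; exact: Pp.
Qed.

Let zariski_openT : zariski_open setT.
Proof.
by apply/zariski_openP=> v _; exists 1 => //; rewrite /polyval meval1 oner_eq0.
Qed.

Let zariski_openI : setI_closed zariski_open.
Proof.
move=> U W /zariski_openP oU /zariski_openP oW; apply/zariski_openP.
move=> v [/oU[p pv pU] /oW[q qv qW]].
exists (p * q); first by rewrite /polyval mevalM mulf_neq0.
move=> w; rewrite /polyval mevalM mulf_eq0 negb_or => /andP[pw qw].
by split; [exact: pU|exact: qW].
Qed.

Let zariski_open_bigU (I : Type) (f : I -> set A) :
  (forall i, zariski_open (f i)) -> zariski_open (\bigcup_i f i).
Proof.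
move=> oU; apply/zariski_openP => v [i _ fiv].
have /zariski_openP/(_ v fiv)[p pv pf] := oU i.
by exists p => // w /pf fiw; exists i.
Qed.

HB.instance Definition _ := isOpenTopological.Build A
  zariski_openT zariski_openI zariski_open_bigU.

Lemma near_polyval (v : A) p : polyval p v != 0 ->
  \forall w \near v, polyval p w != 0.
Proof.
move=> pv; exists [set w | polyval p w != 0]; split=> //.
by apply/zariski_openP => w pw; exists p.
Qed.

Definition affine_regular_at (v : A) (f : A -> k) : Prop :=
  exists p q, polyval q v != 0 /\
    \forall w \near v, f w = polyval p w / polyval q w.

Let affine_regular_near (v : A) (f : A -> k) :
  affine_regular_at v f -> \forall w \near v, affine_regular_at w f.
Proof.
case=> p [q [/near_polyval qv /near_join ef]].
by apply: filterS2 qv ef => w qw efw; exists p, q.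
Qed.

Let affine_regular_eq (v : A) (f g : A -> k) : (\forall w \near v, f w = g w) ->
  affine_regular_at v f -> affine_regular_at v g.
Proof.
move=> efg [p [q [qv ef]]]; exists p, q; split=> //.
by apply: filterS2 efg ef => w <- ->.
Qed.

Let affine_regular_cst (v : A) c : affine_regular_at v (fun=> c).
Proof.
exists c%:MP, 1; rewrite /polyval meval1 oner_eq0; split=> //.
by apply: (nearW (F := nbhs v)) => w; rewrite mevalC meval1 divr1.
Qed.

Let affine_regularD (v : A) (f g : A -> k) : affine_regular_at v f -> affine_regular_at v g ->
  affine_regular_at v (fun w => f w + g w).
Proof.
move=> [p [q [qv ef]]] [r [s [sv eg]]]; exists (p * s + r * q), (q * s).
rewrite /polyval mevalM mulf_neq0//; split=> //.
have [qw sw] := (near_polyval qv, near_polyval sv).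
apply: filterS2 (filterI qw sw) (filterI ef eg) => w [qw0 sw0] [-> ->].
by rewrite mevalD !mevalM addf_div.
Qed.

Let affine_regularM (v : A) (f g : A -> k) : affine_regular_at v f -> affine_regular_at v g ->
  affine_regular_at v (fun w => f w * g w).
Proof.
move=> [p [q [qv ef]]] [r [s [sv eg]]]; exists (p * r), (q * s).
rewrite /polyval mevalM mulf_neq0//; split=> //.
by apply: filterS2 ef eg => w -> ->; rewrite !mevalM mulf_div.
Qed.

Let affine_neq0P (v : A) (f : A -> k) p q : f v != 0 ->
  (\forall w \near v, f w = polyval p w / polyval q w) -> polyval p v != 0.
Proof.
by move=> + /nbhs_singleton ef; rewrite ef; apply: contraNneq => ->; rewrite mul0r.
Qed.

Let affine_regular_neq0 (v : A) (f : A -> k) : affine_regular_at v f -> f v != 0 ->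
  \forall w \near v, f w != 0.
Proof.
move=> [p [q [qv ef]]] fv; have /near_polyval pv := affine_neq0P fv ef.
apply: filterS3 pv (near_polyval qv) ef => w pw qw ->.
by rewrite mulf_neq0 ?invr_eq0.
Qed.

Let affine_regularV (v : A) (f : A -> k) : affine_regular_at v f -> f v != 0 ->
  affine_regular_at v (fun w => (f w)^-1).
Proof.
move=> [p [q [qv ef]]] fv; exists q, p; split; first exact: affine_neq0P fv ef.
by apply: filterS ef => w ->; rewrite invf_div.
Qed.

HB.instance Definition _ := Topological_isFunSpace.Build k A
  affine_regular_near affine_regular_eq affine_regular_cst affine_regularD
  affine_regularM affine_regular_neq0 affine_regularV.

Lemma regular_linear (v : A) (l : V -> k) :
  (forall a u w, l (a *: u + w) = a * l u + l w) ->
  regular_at v (l : A -> k).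
Proof.
move=> ll.
have l0 : l 0 = 0.
  by apply: (addrI (l 0)); have := ll 1 0 0; rewrite scale1r mul1r !addr0.
have lsum (r : seq 'I_(\dim {: V})) (c : 'I_(\dim {: V}) -> k) e :
    l (\sum_(i <- r) c i *: e i) = \sum_(i <- r) c i * l (e i).
  by elim: r => [|i r IHr]; rewrite ?big_nil// !big_cons ll IHr.
exists (\sum_(i < \dim {: V}) (l (vbasis {: V})`_i) *: 'X_i), 1.
rewrite /polyval meval1 oner_eq0; split=> //.
apply: (nearW (F := nbhs v)) => w.
rewrite meval1 divr1 {1}(coord_vbasis (memvf w)) lsum raddf_sum /=.
by apply: eq_bigr => i _; rewrite mevalZ mevalXU mulrC.
Qed.

Lemma morphism_at_affine (X : funSpaceType k) (f : X -> A) (x : X) :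
  (forall i, regular_at x (fun y => coord (vbasis {: V}) i (f y))) ->
  morphism_at f x.
Proof.
move=> rf.
have rp p : regular_at x (fun y => polyval p (f y)) by exact: regular_meval.
have cf : {for x, continuous f}.
  move=> U [B [/zariski_openP oB /oB[r rfx rB] BU]].
  by apply: filterS (regular_neq0 (rp r) rfx) => y /rB/BU.
split; first exact: cf.
move=> g [p [q [qfx eg]]].
apply: (regular_eq _ (regularM (rp p) (regularV (rp q) qfx))).
have efg : \forall y \near x, g (f y) = polyval p (f y) / polyval q (f y).
  exact: cf _ eg.
by apply: filterS efg => y /= ->.
Qed.

End AffineSpace.

(* The product in the category of spaces with functions (Kempf, Algebraic
   Varieties).  For open U, V and h = sum_i f_i (x) g_i with f_i in O(U) and
   g_i in O(V), the sets {(x, y) in U x V | h(x, y) != 0} form a basis; regular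
   functions are locally quotients of such h. *)
Definition fprod (X Y : Type) : Type := (X * Y)%type.

Inductive tensor_at (k : fieldType) (X Y : funSpaceType k) (x : X) (y : Y) :
    (X * Y -> k) -> Prop :=
| tensor_pure f g : regular_at x f -> regular_at y g ->
    tensor_at x y (fun p => f p.1 * g p.2)
| tensor_add s t : tensor_at x y s -> tensor_at x y t ->
    tensor_at x y (fun p => s p + t p).

Section Product.
Context {k : fieldType} {X Y : funSpaceType k}.
Local Notation XY := (fprod X Y).
Implicit Types (p q : XY) (s t : X * Y -> k).

Let tensor_cst x y c : @tensor_at k X Y x y (fun=> c).
Proof.
rewrite (_ : (fun=> c) = (fun p : X * Y => (fun=> c) p.1 * (fun=> 1) p.2)).
  by apply: (@tensor_pure _ _ _ x y (fun=> c) (fun=> 1)); exact: regular_cst.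
by apply/funext => p /=; rewrite mulr1.
Qed.

Let tensorM x y s t : tensor_at x y s -> tensor_at x y t ->
  tensor_at x y (fun p => s p * t p).
Proof.
move=> ts; elim=> [f g rf rg|t1 t2 _ IH1 _ IH2]; last first.
  rewrite (_ : (fun p => _) = (fun p => s p * t1 p + s p * t2 p)).
    exact: tensor_add.
  by apply/funext => p; rewrite mulrDr.
elim: ts => [f' g' rf' rg'|s1 s2 _ IH1 _ IH2]; last first.
  rewrite (_ : (fun p => _) = (fun p => s1 p * (f p.1 * g p.2) +
    s2 p * (f p.1 * g p.2))); first exact: tensor_add.
  by apply/funext => p; rewrite mulrDl.
rewrite (_ : (fun p => _) = (fun p => (fun u => f' u * f u) p.1 *
    (fun v => g' v * g v) p.2)).
  apply: (@tensor_pure _ _ _ x y (fun u => f' u * f u) (fun v => g' v * g v));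
    exact: regularM.
by apply/funext => p /=; rewrite mulrACA.
Qed.

Let tensor_near x y s : tensor_at x y s -> exists U V,
  [/\ nbhs x U, nbhs y V & forall u v, U u -> V v -> tensor_at u v s].
Proof.
elim=> [f g /regular_near rf /regular_near rg|s1 s2 _ + _ +].
  by exists (regular_at^~ f), (regular_at^~ g); split=> // u v; exact: tensor_pure.
move=> [U1 [V1 [Ux1 Vy1 h1]]] [U2 [V2 [Ux2 Vy2 h2]]].
exists (U1 `&` U2), (V1 `&` V2); split; [exact: filterI..|].
by move=> u v [? ?] [? ?]; apply: tensor_add; [exact: h1|exact: h2].
Qed.

HB.instance Definition _ := Choice.on XY.

Definition fprod_nbhs (p : XY) (W : set XY) : Prop :=
  exists U V h, [/\ nbhs p.1 U, nbhs p.2 V, tensor_at p.1 p.2 h, h p != 0 &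
    forall q : X * Y, U q.1 -> V q.2 -> h q != 0 -> W q].

HB.instance Definition _ := hasNbhs.Build XY fprod_nbhs.

Let fprod_filter p : ProperFilter (nbhs p).
Proof.
apply: Build_ProperFilter_ex.
  move=> W [U [V [h [/nbhs_singleton Ux /nbhs_singleton Vy _ hp UVW]]]].
  by exists p; exact: UVW.
split.
- exists setT, setT, (fun=> 1); split=> //; try exact: filterT.
  exact: oner_neq0.
- move=> W1 W2 [U1 [V1 [h1 [nU1 nV1 th1 h1p W1P]]]].
  move=> [U2 [V2 [h2 [nU2 nV2 th2 h2p W2P]]]].
  exists (U1 `&` U2), (V1 `&` V2), (fun p => h1 p * h2 p).
  split; [exact: filterI|exact: filterI|exact: tensorM|exact: mulf_neq0|].
  move=> q [? ?] [? ?]; rewrite mulf_eq0 negb_or => /andP[? ?].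
  by split; [exact: W1P|exact: W2P].
- move=> W1 W2 W12 [U [V [h [nU nV th hp WP]]]].
  by exists U, V, h; split=> // q Uq Vq hq; apply/W12/WP.
Qed.

Let fprod_singleton p (W : set XY) : nbhs p W -> W p.
Proof.
move=> [U [V [h [/nbhs_singleton Ux /nbhs_singleton Vy _ hp UVW]]]].
exact: UVW.
Qed.

Let fprod_nbhs_nbhs p (W : set XY) : nbhs p W -> nbhs p (nbhs^~ W).
Proof.
move=> [U [V [h [nU nV th hp WP]]]].
have [U' [V' [nU' nV' th']]] := tensor_near th.
exists (U^° `&` U'), (V^° `&` V'), h; split=> //.
- by apply: filterI => //; exact: nbhs_interior.
- by apply: filterI => //; exact: nbhs_interior.
move=> q [Uq U'q] [Vq V'q] hq; exists U, V, h; split=> //.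
exact: th'.
Qed.

HB.instance Definition _ := Nbhs_isNbhsTopological.Build XY
  fprod_filter fprod_singleton fprod_nbhs_nbhs.

Let near_tensor p h : tensor_at p.1 p.2 h -> h p != 0 ->
  \forall q \near p, h q != 0.
Proof. by move=> th hp; exists setT, setT, h; split=> //; exact: filterT. Qed.

Definition fprod_regular_at p (F : XY -> k) : Prop :=
  exists a b, [/\ tensor_at p.1 p.2 a, tensor_at p.1 p.2 b, b p != 0 &
    \forall q \near p, F q = a q / b q].

Let fprod_regular_near p F :
  fprod_regular_at p F -> \forall q \near p, fprod_regular_at q F.
Proof.
move=> [a [b [ta tb bp /near_join eF]]].
have [U1 [V1 [nU1 nV1 ta']]] := tensor_near ta.
have [U2 [V2 [nU2 nV2 tb']]] := tensor_near tb.
have : \forall q \near p, b q != 0 /\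
    (tensor_at q.1 q.2 a /\ tensor_at q.1 q.2 b).
  exists (U1 `&` U2), (V1 `&` V2), b; split=> //; try exact: filterI.
  move=> q [? ?] [? ?] ?; split=> //.
  by split; [exact: ta'|exact: tb'].
apply: filterS2 eF => q eF [bq [taq tbq]].
by exists a, b.
Qed.

Let fprod_regular_eq p F G : (\forall q \near p, F q = G q) ->
  fprod_regular_at p F -> fprod_regular_at p G.
Proof.
move=> eFG [a [b [ta tb bp eF]]]; exists a, b; split=> //.
by apply: filterS2 eFG eF => w <- ->.
Qed.

Let fprod_regular_cst p c : fprod_regular_at p (fun=> c).
Proof.
exists (fun=> c), (fun=> 1); split; rewrite ?oner_eq0//.
by apply: (nearW (F := nbhs p)) => w; rewrite divr1.
Qed.

Let fprod_regularD p F G : fprod_regular_at p F -> fprod_regular_at p G ->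
  fprod_regular_at p (fun q => F q + G q).
Proof.
move=> [a [b [ta tb bp eF]]] [c [d [tc td dp eG]]].
exists (fun q => a q * d q + c q * b q), (fun q => b q * d q).
split; [by apply: tensor_add; exact: tensorM|exact: tensorM|exact: mulf_neq0|].
have [bq dq] := (near_tensor tb bp, near_tensor td dp).
apply: filterS2 (filterI bq dq) (filterI eF eG) => w [bq0 dq0] [-> ->].
by rewrite addf_div.
Qed.

Let fprod_regularM p F G : fprod_regular_at p F -> fprod_regular_at p G ->
  fprod_regular_at p (fun q => F q * G q).
Proof.
move=> [a [b [ta tb bp eF]]] [c [d [tc td dp eG]]].
exists (fun q => a q * c q), (fun q => b q * d q).
split; [exact: tensorM|exact: tensorM|exact: mulf_neq0|].
by apply: filterS2 eF eG => w -> ->; rewrite mulf_div.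
Qed.

Let fprod_neq0P p F (a b : XY -> k) : F p != 0 ->
  (\forall q \near p, F q = a q / b q) -> a p != 0.
Proof.
move=> Fp0 eF; have eFp : F p = a p / b p := nbhs_singleton eF.
by apply: contraNneq Fp0 => ap0; rewrite eFp ap0 mul0r.
Qed.

Let fprod_regular_neq0 p (F : XY -> k) : fprod_regular_at p F -> F p != 0 ->
  \forall q \near p, F q != 0.
Proof.
move=> [a [b [ta tb bp eF]]] Fp.
have aq := near_tensor ta (fprod_neq0P Fp eF).
apply: filterS3 aq (near_tensor tb bp) eF => w pw qw ->.
by rewrite mulf_neq0 ?invr_eq0.
Qed.

Let fprod_regularV p F : fprod_regular_at p F -> F p != 0 ->
  fprod_regular_at p (fun q => (F q)^-1).
Proof.
move=> [a [b [ta tb bp eF]]] Fp; exists b, a; split=> //.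
  exact: fprod_neq0P Fp eF.
by apply: filterS eF => w ->; rewrite invf_div.
Qed.

HB.instance Definition _ := Topological_isFunSpace.Build k XY
  fprod_regular_near fprod_regular_eq fprod_regular_cst fprod_regularD
  fprod_regularM fprod_regular_neq0 fprod_regularV.

End Product.

(* f is regular on an open set U of a quotient iff f \o \pi is regular on the
   preimage of U. *)
Section Quotient.
Context {k : fieldType} {X : funSpaceType k} {Q0 : quotType X}.
Local Notation Q := (quotient_topology Q0).

Definition quot_regular_at (z : Q) (f : Q -> k) : Prop :=
  \forall w \near z, forall x : X, \pi_Q x = w -> regular_at x (f \o \pi_Q).

Let near_pi (x : X) (P : set Q) :
  (\forall w \near \pi_Q x, P w) -> \forall y \near x, P (\pi_Q y).
Proof. exact: (@pi_continuous X Q0 x). Qed.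

Let quot_regular_near z f :
  quot_regular_at z f -> \forall w \near z, quot_regular_at w f.
Proof. exact: near_join. Qed.

Let quot_regular_eq (z : Q) (f g : Q -> k) : (\forall w \near z, f w = g w) ->
  quot_regular_at z f -> quot_regular_at z g.
Proof.
move=> /near_join efg; apply: filterS2 efg => w + rf x xw; rewrite -xw.
by move/near_pi => efg; exact: regular_eq efg (rf x xw).
Qed.

Let quot_regular_cst z c : quot_regular_at z (fun=> c).
Proof. by apply: (nearW (F := nbhs z)) => w x _; exact: regular_cst. Qed.

Let quot_regularD z f g : quot_regular_at z f -> quot_regular_at z g ->
  quot_regular_at z (fun w => f w + g w).
Proof.
move=> rf rg; apply: filterS2 rf rg => w rf rg x xw.
exact: regularD (rf x xw) (rg x xw).
Qed.

Let quot_regularM z f g : quot_regular_at z f -> quot_regular_at z g ->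
  quot_regular_at z (fun w => f w * g w).
Proof.
move=> rf rg; apply: filterS2 rf rg => w rf rg x xw.
exact: regularM (rf x xw) (rg x xw).
Qed.

Let quot_regular_neq0 z f : quot_regular_at z f -> f z != 0 ->
  \forall w \near z, f w != 0.
Proof.
rewrite /quot_regular_at /prop_near1 nbhsE => -[B [oB Bz] rf] fz.
exists (B `&` [set w | f w != 0]); last by move=> w [].
split; last by split.
rewrite /open/= /quotient_open preimage_setI openE => x [Bx fx].
apply: filterI; first by move: oB; rewrite /open/= /quotient_open openE; apply.
exact: (regular_neq0 (rf _ Bx x erefl)).
Qed.

Let quot_regularV z f : quot_regular_at z f -> f z != 0 ->
  quot_regular_at z (fun w => (f w)^-1).
Proof.
move=> rf fz; apply: filterS2 rf (quot_regular_neq0 rf fz) => w rf fw x xw.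
by apply: regularV (rf x xw) _ => /=; rewrite xw.
Qed.

HB.instance Definition _ := Topological_isFunSpace.Build k Q
  quot_regular_near quot_regular_eq quot_regular_cst quot_regularD
  quot_regularM quot_regular_neq0 quot_regularV.

End Quotient.

Definition is_affine (k : fieldType) (X : funSpaceType k) : Prop :=
  exists N (S : set (affine 'rV[k]_N)), closed S /\ isomorphic X S.

Definition is_variety (k : fieldType) (X : funSpaceType k) : Prop :=
  (exists r (U : 'I_r -> set X),
    [/\ forall i, open (U i), forall i, is_affine (U i)
      & \bigcup_i U i = setT]) /\
  closed [set p : fprod X X | p.1 = p.2].

Definition irreducible_space (X : topologicalType) : Prop :=
  [set: X] !=set0 /\
  forall U V : set X, open U -> open V -> U !=set0 -> V !=set0 ->
    U `&` V !=set0.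

(* PGL_n, as the quotient of the open subvariety GL_n of the affine space of
   matrices by the nonzero scalars. *)
Section PGL.
Variables (k : fieldType) (n : nat).

Definition GL : Type := set_type [set A : affine 'M[k]_n | A \in unitmx].
HB.instance Definition _ :=
  FunSpace.copy GL (set_type [set A : affine 'M[k]_n | A \in unitmx]).

Definition GLmx (A : GL) : 'M[k]_n := \val A.
Definition mkGL (A : 'M[k]_n) (uA : A \in unitmx) : GL :=
  exist _ A (mem_set uA).

Lemma GLmx_unit (A : GL) : GLmx A \in unitmx.
Proof. exact: set_mem (valP A). Qed.

Definition scalar_rel (A B : GL) : bool :=
  `[< exists2 c : k, c != 0 & GLmx A = c *: GLmx B >].

Let scalar_refl : reflexive scalar_rel.
Proof. by move=> A; apply/asboolP; exists 1; rewrite ?oner_eq0// scale1r. Qed.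

Let scalar_symW A B : scalar_rel A B -> scalar_rel B A.
Proof.
move=> /asboolP[c c0 AB]; apply/asboolP; exists c^-1; first by rewrite invr_eq0.
by rewrite AB scalerA mulVf// scale1r.
Qed.

Let scalar_sym : ssrbool.symmetric scalar_rel.
Proof. by move=> A B; apply/idP/idP; exact: scalar_symW. Qed.

Let scalar_trans : transitive scalar_rel.
Proof.
move=> B A C /asboolP[c c0 AB] /asboolP[d d0 BC]; apply/asboolP.
by exists (c * d); rewrite ?mulf_neq0// AB BC scalerA.
Qed.

Canonical scalar_equiv := EquivRel scalar_rel scalar_refl scalar_sym scalar_trans.

Definition PGL : Type := quotient_topology {eq_quot scalar_equiv}.
HB.instance Definition _ :=
  FunSpace.copy PGL (quotient_topology {eq_quot scalar_equiv}).

Definition toPGL (A : GL) : PGL := \pi_{eq_quot scalar_equiv} A.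
Definition PGLmx (g : PGL) : 'M[k]_n :=
  GLmx (repr (g : {eq_quot scalar_equiv})).

Lemma PGLmx_unit g : PGLmx g \in unitmx.
Proof. exact: GLmx_unit. Qed.

Lemma toPGLK g : toPGL (mkGL (PGLmx_unit g)) = g.
Proof.
rewrite -[RHS](reprK (g : {eq_quot scalar_equiv})); congr (\pi _).
exact: val_inj.
Qed.

Lemma toPGL_eq A B c : c != 0 -> GLmx A = c *: GLmx B -> toPGL A = toPGL B.
Proof.
move=> c0 AB; change (\pi_{eq_quot scalar_equiv} A = \pi_{eq_quot scalar_equiv} B).
by apply/eqmodP/asboolP; exists c.
Qed.

Lemma PGLmxP A : exists2 c, c != 0 & PGLmx (toPGL A) = c *: GLmx A.
Proof.
apply/(@asboolP (exists2 c, c != 0 & _)).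
change (scalar_equiv (repr (\pi_{eq_quot scalar_equiv} A)) A).
by apply/eqmodP; rewrite reprK.
Qed.

Let unitM (A B : 'M[k]_n) : A \in unitmx -> B \in unitmx -> A *m B \in unitmx.
Proof. by move=> uA uB; rewrite unitmx_mul uA. Qed.

Let unitV (A : 'M[k]_n) : A \in unitmx -> invmx A \in unitmx.
Proof. by rewrite unitmx_inv. Qed.

Definition PGL_one : PGL := toPGL (mkGL (unitmx1 k n)).
Definition PGL_mul (g h : PGL) : PGL :=
  toPGL (mkGL (unitM (PGLmx_unit g) (PGLmx_unit h))).
Definition PGL_inv (g : PGL) : PGL := toPGL (mkGL (unitV (PGLmx_unit g))).

Let PGL_eq g h c : c != 0 -> PGLmx g = c *: PGLmx h -> g = h.
Proof.
by move=> c0 gh; rewrite -(toPGLK g) -(toPGLK h); exact: (toPGL_eq c0).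
Qed.

Let PGL_oneE : exists2 c, c != 0 & PGLmx PGL_one = c *: 1%:M.
Proof. exact: PGLmxP. Qed.

Let PGL_mulE g h :
  exists2 c, c != 0 & PGLmx (PGL_mul g h) = c *: (PGLmx g *m PGLmx h).
Proof. exact: PGLmxP. Qed.

Let PGL_invE g : exists2 c, c != 0 & PGLmx (PGL_inv g) = c *: invmx (PGLmx g).
Proof. exact: PGLmxP. Qed.

Let PGL_mulA : associative PGL_mul.
Proof.
move=> f g h.
have [a a0 e1] := PGL_mulE f (PGL_mul g h); have [b b0 e2] := PGL_mulE g h.
have [c c0 e3] := PGL_mulE (PGL_mul f g) h; have [d d0 e4] := PGL_mulE f g.
apply: (@PGL_eq _ _ (a * b / (c * d))); first by rewrite !mulf_neq0 ?invr_eq0 ?mulf_neq0.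
rewrite e1 e2 e3 e4 -scalemxAr -scalemxAl !scalerA mulmxA; congr (_ *: _).
by rewrite -mulrA mulfVK// mulf_neq0.
Qed.

Let PGL_mul1g : left_id PGL_one PGL_mul.
Proof.
move=> g; have [a a0 e1] := PGL_mulE PGL_one g; have [b b0 e2] := PGL_oneE.
apply: (@PGL_eq _ _ (a * b)); first exact: mulf_neq0.
by rewrite e1 e2 -scalemxAl mul1mx scalerA.
Qed.

Let PGL_mulg1 : right_id PGL_one PGL_mul.
Proof.
move=> g; have [a a0 e1] := PGL_mulE g PGL_one; have [b b0 e2] := PGL_oneE.
apply: (@PGL_eq _ _ (a * b)); first exact: mulf_neq0.
by rewrite e1 e2 -scalemxAr mulmx1 scalerA.
Qed.

Let PGL_mulVg : left_inverse PGL_one PGL_inv PGL_mul.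
Proof.
move=> g; have [a a0 e1] := PGL_mulE (PGL_inv g) g.
have [b b0 e2] := PGL_oneE; have [c c0 e3] := PGL_invE g.
apply: (@PGL_eq _ _ (a * c / b)); first by rewrite !mulf_neq0 ?invr_eq0.
rewrite e1 e2 e3 -scalemxAl mulVmx ?PGLmx_unit// !scalerA.
by rewrite divfK.
Qed.

Let PGL_mulgV : right_inverse PGL_one PGL_inv PGL_mul.
Proof.
move=> g; have [a a0 e1] := PGL_mulE g (PGL_inv g).
have [b b0 e2] := PGL_oneE; have [c c0 e3] := PGL_invE g.
apply: (@PGL_eq _ _ (a * c / b)); first by rewrite !mulf_neq0 ?invr_eq0.
rewrite e1 e2 e3 -scalemxAr mulmxV ?PGLmx_unit// !scalerA.
by rewrite divfK.
Qed.

HB.instance Definition _ := isGroup.Build PGL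
  PGL_mulA PGL_mul1g PGL_mulg1 PGL_mulVg PGL_mulgV.

Definition PGLconj (g : PGL) (A : 'M[k]_n) : 'M[k]_n :=
  PGLmx g *m A *m invmx (PGLmx g).

Lemma PGLconj_scale g (B A : 'M[k]_n) c : c != 0 -> B \in unitmx ->
  PGLmx g = c *: B -> PGLconj g A = B *m A *m invmx B.
Proof.
move=> c0 uB gB; rewrite /PGLconj gB invmxZ ?unitmxZ ?unitfE// -!scalemxAl -scalemxAr scalerA.
by rewrite mulfV// scale1r.
Qed.

Lemma PGLconj1 A : PGLconj 1%g A = A.
Proof.
have [c c0 e] := PGL_oneE.
by rewrite (PGLconj_scale _ c0 (unitmx1 _ _) e) invmx1 mulmx1 mul1mx.
Qed.

Lemma PGLconjM g h A : PGLconj (g * h)%g A = PGLconj g (PGLconj h A).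
Proof.
have [c c0 e] := PGL_mulE g h; have [ug uh] := (PGLmx_unit g, PGLmx_unit h).
rewrite (PGLconj_scale _ c0 (unitM ug uh) e) /PGLconj !mulmxA.
suff -> : invmx (PGLmx g *m PGLmx h) = invmx (PGLmx h) *m invmx (PGLmx g).
  by rewrite !mulmxA.
rewrite -[RHS](mulKmx (unitM ug uh)) -[LHS]mulmx1; congr (_ *m _).
by rewrite -!mulmxA (mulmxA (PGLmx h)) mulmxV// mul1mx mulmxV.
Qed.

End PGL.

Record PGLspace (k : fieldType) (n : nat) := mkPGLspace {
  PGLspace_sort :> funSpaceType k;
  act : PGL k n -> PGLspace_sort -> PGLspace_sort;
  act1 : forall x, act 1%g x = x;
  actM : forall g h x, act (g * h)%g x = act g (act h x)
}.

Definition is_PGLvariety (k : fieldType) n (X : PGLspace k n) : Prop :=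
  is_variety X /\ is_morphism (fun p : fprod (PGL k n) X => act p.1 p.2 : X).

Definition mx_space (k : fieldType) n : PGLspace k n :=
  @mkPGLspace k n (affine 'M[k]_n) (@PGLconj k n) (@PGLconj1 k n)
    (@PGLconjM k n).

Section Tuples.
Variables (k : fieldType) (m n : nat).
Local Notation Mnm := (affine {ffun 'I_m -> 'M[k]_n}).

Definition tuple_act (g : PGL k n) (x : Mnm) : Mnm :=
  [ffun i => PGLconj g ((x : {ffun 'I_m -> 'M[k]_n}) i)].

Let tuple_act1 x : tuple_act 1%g x = x.
Proof. by apply/ffunP => i; rewrite ffunE PGLconj1. Qed.

Let tuple_actM g h x : tuple_act (g * h)%g x = tuple_act g (tuple_act h x).
Proof. by apply/ffunP => i; rewrite !ffunE PGLconjM. Qed.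

Definition tuple_space : PGLspace k n := mkPGLspace tuple_act1 tuple_actM.

Definition generating_tuples : set tuple_space :=
  [set x : {ffun 'I_m -> 'M[k]_n} | forall B : set 'M[k]_n,
    B 1%:M -> (forall c A A', B A -> B A' -> B (c *: A + A')) ->
    (forall A A', B A -> B A' -> B (A *m A')) -> (forall i, B (x i)) ->
    forall A, B A].

Record nvariety := NVariety {
  nv_set :> set tuple_space;
  nv_stable : forall g x, nv_set x -> nv_set (act g x);
  nv_closed : exists2 C : set tuple_space,
    closed C & nv_set = generating_tuples `&` C
}.

Variable S : nvariety.

Definition nv_act (g : PGL k n) (x : S) : S :=
  exist _ (act g (\val x)) (mem_set (nv_stable g (set_mem (valP x)))).

Let nv_act1 x : nv_act 1%g x = x.
Proof. by apply: val_inj; exact: act1. Qed.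

Let nv_actM g h x : nv_act (g * h)%g x = nv_act g (nv_act h x).
Proof. by apply: val_inj; exact: actM. Qed.

Definition nv_space : PGLspace k n := mkPGLspace nv_act1 nv_actM.

End Tuples.

Section Generic.
Context {X : topologicalType}.

Definition generic (P : set X) : Prop :=
  exists W, [/\ open W, dense W & W `<=` P].

Lemma genericS (P Q : set X) : P `<=` Q -> generic P -> generic Q.
Proof. by move=> PQ [W [oW dW WP]]; exists W; split=> // x /WP/PQ. Qed.

Lemma genericI (P Q : set X) : generic P -> generic Q -> generic (P `&` Q).
Proof.
move=> [W [oW dW WP]] [W' [oW' dW' WQ]]; exists (W `&` W').
by split; [exact: openI|exact: denseI|exact: setISS].
Qed.

Lemma genericT (P : set X) : (forall x, P x) -> generic P.
Proof.
move=> PT; exists setT; split=> //; first exact: openT.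
by move=> O O0 _; rewrite setIT.
Qed.

Lemma genericS2 (P Q R : set X) : (forall x, P x -> Q x -> R x) ->
  generic P -> generic Q -> generic R.
Proof. by move=> PQR gP gQ; apply: genericS (genericI gP gQ) => x [/PQR]; apply. Qed.

Lemma genericS3 (P Q R S : set X) : (forall x, P x -> Q x -> R x -> S x) ->
  generic P -> generic Q -> generic R -> generic S.
Proof.
by move=> PQRS gP gQ; apply: genericS2 (genericI gP gQ) => x [/PQRS]; apply.
Qed.

Lemma irreducible_generic (U : set X) : irreducible_space X -> open U ->
  U !=set0 -> generic U.
Proof. by move=> [_ iX] oU U0; exists U; split=> // O O0 oO; exact: iX. Qed.

Lemma generic_nonempty (P : set X) :
  irreducible_space X -> generic P -> P !=set0.
Proof.
move=> [X0 _] [W [_ dW WP]]; have [x [_ Wx]] := dW setT X0 openT.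
by exists x; exact: WP.
Qed.

End Generic.

(* A PGL_n-equivariant rational map X --> Y is a class, for agreement on a
   dense open set, of equivariant morphisms defined on dense open sets.  The
   function is total but meaningful on rdom only.  Equivariance is required
   wherever both sides are defined, since rdom need not be PGL_n-stable. *)
Record ratrep (k : fieldType) n (X Y : PGLspace k n) := RatRep {
  rdom : set X;
  rfun : X -> Y;
  rdom_open : open rdom;
  rdom_dense : dense rdom;
  rfun_morphism : forall x, rdom x -> morphism_at rfun x;
  rfun_equivariant : forall g x, rdom x -> rdom (act g x) ->
    rfun (act g x) = act g (rfun x)
}.

HB.instance Definition _ (k : fieldType) n (X Y : PGLspace k n) :=
  gen_eqMixin (ratrep X Y).
HB.instance Definition _ (k : fieldType) n (X Y : PGLspace k n) :=
  gen_choiceMixin (ratrep X Y).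

Section RationalMaps.
Context {k : fieldType} {n : nat} {X Y : PGLspace k n}.
Implicit Types r s t : ratrep X Y.

Lemma rdom_generic r : generic (rdom r).
Proof. by exists (rdom r); split; [exact: rdom_open|exact: rdom_dense|]. Qed.

Definition ratrep_rel r s : bool :=
  `[< generic [set x | [/\ rdom r x, rdom s x & rfun r x = rfun s x]] >].

Lemma ratrep_relP r s :
  ratrep_rel r s <-> generic [set x | rfun r x = rfun s x].
Proof.
split=> [/asboolP|rs]; first by apply: genericS => x [].
by apply/asboolP; apply: genericS3 (rdom_generic r) (rdom_generic s) rs => x.
Qed.

Let ratrep_refl : reflexive ratrep_rel.
Proof. by move=> r; apply/ratrep_relP/genericT. Qed.

Let ratrep_sym : ssrbool.symmetric ratrep_rel.
Proof.
by move=> r s; apply/idP/idP => /ratrep_relP rs; apply/ratrep_relP;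
  apply: genericS rs => x.
Qed.

Let ratrep_trans : transitive ratrep_rel.
Proof.
move=> s r t /ratrep_relP rs /ratrep_relP st; apply/ratrep_relP.
by apply: genericS2 rs st => x /= xrs xst; rewrite xrs.
Qed.

Canonical ratrep_equiv := EquivRel ratrep_rel ratrep_refl ratrep_sym ratrep_trans.

Definition ratmap : Type := {eq_quot ratrep_equiv}.
HB.instance Definition _ := Choice.copy ratmap {eq_quot ratrep_equiv}.

Definition to_ratmap r : ratmap := \pi_{eq_quot ratrep_equiv} r.
Definition of_ratmap (f : ratmap) : ratrep X Y :=
  repr (f : {eq_quot ratrep_equiv}).
Definition rdomain (f : ratmap) : set X := rdom (of_ratmap f).
Definition reval (f : ratmap) : X -> Y := rfun (of_ratmap f).

Lemma of_ratmapK f : to_ratmap (of_ratmap f) = f.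
Proof. exact: reprK. Qed.

Lemma to_ratmap_eq r s :
  to_ratmap r = to_ratmap s <-> generic [set x | rfun r x = rfun s x].
Proof.
split=> [rs|/ratrep_relP rs].
  apply/ratrep_relP.
  change (\pi_{eq_quot ratrep_equiv} r = \pi_{eq_quot ratrep_equiv} s) in rs.
  exact/(eqmodP ratrep_equiv).
change (\pi_{eq_quot ratrep_equiv} r = \pi_{eq_quot ratrep_equiv} s).
exact/eqmodP.
Qed.

Lemma ratmapP (f g : ratmap) : f = g <-> generic [set x | reval f x = reval g x].
Proof. by rewrite -to_ratmap_eq !of_ratmapK. Qed.

Lemma to_ratmapE r : generic [set x | reval (to_ratmap r) x = rfun r x].
Proof. by apply/to_ratmap_eq; rewrite of_ratmapK. Qed.

Definition dominant (f : ratmap) : Prop := dense (reval f @` rdomain f).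

Let dense_imageP r s : generic [set x | rfun r x = rfun s x] ->
  dense (rfun r @` rdom r) -> dense (rfun s @` rdom s).
Proof.
move=> rs dr O O0 oO; have [z [Oz [x rx xz]]] := dr O O0 oO; rewrite -xz in Oz.
have [W [oW dW Wrs]] := genericI rs (rdom_generic s).
pose V := rdom r `&` [set x | O (rfun r x)].
have oV : open V.
  rewrite openE => y [ry Oy]; apply: filterI.
    by have := rdom_open r; rewrite openE; apply.
  have [cr _] := rfun_morphism ry; apply: cr.
  by move: oO; rewrite openE; exact.
have [y [[ry Oy] /Wrs[/= ers sy]]] : V `&` W !=set0.
  by apply: dW => //; exists x.
by exists (rfun s y); split; [rewrite -ers|exists y].
Qed.

Lemma to_ratmap_dominant r :
  dominant (to_ratmap r) <-> dense (rfun r @` rdom r).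
Proof.
split; apply: dense_imageP; first exact: to_ratmapE.
by apply: genericS (to_ratmapE r) => x.
Qed.

Lemma dominant_generic f (P : set Y) : irreducible_space X ->
  dominant f -> generic P -> generic [set x | P (reval f x)].
Proof.
move=> iX df [W [oW dW WP]].
pose V := rdomain f `&` [set x | W (reval f x)].
apply: (@genericS _ V); first by move=> x [_ /WP].
apply: irreducible_generic => //.
  rewrite openE => y [ry Oy]; apply: filterI.
    by have := rdom_open (of_ratmap f); rewrite openE; apply.
  have [cr _] := rfun_morphism ry; apply: cr.
  by move: oW; rewrite openE; exact.
have [[x0 _] _] := iX.
have [y [_ Wy]] := dW setT (ex_intro _ (reval f x0) I) openT.
have [z [Wfx [x fx xz]]] := df W (ex_intro _ y Wy) oW; rewrite -xz in Wfx.
by exists x.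
Qed.

End RationalMaps.

Arguments ratmap {k n} X Y.

Section Composition.
Context {k : fieldType} {n : nat} {X Y Z : PGLspace k n}.
Hypothesis iX : irreducible_space X.
Variables (f : ratmap X Y) (g : ratmap Y Z).
Hypothesis df : dominant f.

Let cdom : set X := [set x | rdomain f x /\ rdomain g (reval f x)].
Let cfun : X -> Z := reval g \o reval f.

Let cdom_open : open cdom.
Proof.
rewrite openE => x [fx gfx]; apply: filterI.
  by have := rdom_open (of_ratmap f); rewrite openE; exact.
have [cf _] := rfun_morphism fx; apply: cf.
by have := rdom_open (of_ratmap g); rewrite openE; exact.
Qed.

Let cdom_dense : dense cdom.
Proof.
have gg : generic (rdomain g) by exact: rdom_generic.
have := genericI (rdom_generic (of_ratmap f)) (dominant_generic iX df gg).
move=> [W [oW dW Wc]] O O0 oO; have [x [Ox /Wc ?]] := dW O O0 oO.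
by exists x.
Qed.

Let cfun_morphism x : cdom x -> morphism_at cfun x.
Proof.
move=> [fx gfx]; have [cf rf] := rfun_morphism fx.
have [cg rg] := rfun_morphism gfx; split; first exact: continuous_comp.
by move=> h /rg/rf.
Qed.

Let cfun_equivariant a x : cdom x -> cdom (act a x) ->
  cfun (act a x) = act a (cfun x).
Proof.
move=> [fx gfx] [fax gfax]; rewrite /cfun /=.
have efa : reval f (act a x) = act a (reval f x) by exact: rfun_equivariant.
by rewrite efa; apply: rfun_equivariant => //; rewrite -efa.
Qed.

Definition ratcomp : ratmap X Z :=
  to_ratmap (RatRep cdom_open cdom_dense cfun_morphism cfun_equivariant).

Lemma ratcompE : generic [set x | reval ratcomp x = reval g (reval f x)].
Proof. exact: to_ratmapE. Qed.

Lemma ratcomp_dominant : dominant g -> dominant ratcomp.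
Proof.
move=> dg; apply/to_ratmap_dominant => O O0 oO /=.
have [z [Ogy [y gy yz]]] := dg O O0 oO; rewrite -yz in Ogy.
pose V := rdomain g `&` [set y | O (reval g y)].
have oV : open V.
  rewrite openE => u [gu Ou]; apply: filterI.
    by have := rdom_open (of_ratmap g); rewrite openE; apply.
  have [cr _] := rfun_morphism gu; apply: cr.
  by move: oO; rewrite openE; exact.
have [z' [[gz Oz] [x fx ex]]] := @df V (ex_intro _ y (conj gy Ogy)) oV.
exists (reval g (reval f x)); split; first by rewrite ex.
by exists x => //; split=> //; rewrite ex.
Qed.

End Composition.

Arguments ratcomp_dominant {k n X Y Z} iX {f g} df dg.

Section Identity.
Context {k : fieldType} {n : nat} (X : PGLspace k n).

Let id_morphism (x : X) : setT x -> morphism_at (@id X) x.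
Proof. by move=> _; split=> [|h]; [exact: cvg_id|]. Qed.

Let id_dense : dense [set: X].
Proof. by move=> O O0 _; rewrite setIT. Qed.

Definition ratid : ratmap X X :=
  to_ratmap (@RatRep k n X X setT id openT id_dense id_morphism
    (fun _ _ _ _ => erefl)).

Lemma ratidE : generic [set x | reval ratid x = x].
Proof. exact: to_ratmapE. Qed.

Lemma ratid_dominant : dominant ratid.
Proof. by apply/to_ratmap_dominant; rewrite /= image_id. Qed.

End Identity.

Arguments ratid_dominant {k n} X.
Arguments ratidE {k n} X.

Definition birational (k : fieldType) n (X Y : PGLspace k n) : Prop :=
  exists (f : ratmap X Y) (g : ratmap Y X),
    generic [set x | [/\ rdomain f x, rdomain g (reval f x)
                       & reval g (reval f x) = x]] /\
    generic [set y | [/\ rdomain g y, rdomain f (reval g y)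
                       & reval f (reval g y) = y]].

Record irrPGLvariety (k : fieldType) (n : nat) := IrrPGLvariety {
  irr_space :> PGLspace k n;
  irr_variety : is_PGLvariety irr_space;
  irr_irreducible : irreducible_space irr_space
}.

Definition rmaps (k : fieldType) n (X : irrPGLvariety k n) : Type :=
  ratmap X (mx_space k n).

Lemma morphism_at_mx (k : fieldType) n (X : funSpaceType k)
    (f : X -> affine 'M[k]_n) (x : X) :
  morphism_at f x <->
  forall i j, regular_at x (fun y => (f y : 'M[k]_n) i j).
Proof.
split=> [[_ rf] i j|rf].
  apply: (rf (fun A => (A : 'M[k]_n) i j)); apply: regular_linear => a u w.
  by rewrite !mxE.
apply: morphism_at_affine => l.
pose e (ij : 'I_n * 'I_n) := coord (vbasis fullv) l (delta_mx ij.1 ij.2 : 'M[k]_n).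
apply: (@regular_eq _ _ _ (fun y =>
    \sum_(ij : 'I_n * 'I_n) e ij * (f y : 'M[k]_n) ij.1 ij.2)).
  apply: nearW => y; rewrite [in RHS](matrix_sum_delta (f y : 'M[k]_n)).
  rewrite pair_big linear_sum /=; apply: eq_bigr => ij _.
  by rewrite linearZ mulrC.
by apply: regular_sum => ij; exact: regularZ.
Qed.

Section Pointwise.
Context {k : fieldType} {n : nat} {X : PGLspace k n}.
Local Notation M := (mx_space k n).

Section Binary.
Variable op : 'M[k]_n -> 'M[k]_n -> 'M[k]_n.
Hypothesis op_regular : forall (x : X) (f g : X -> 'M[k]_n),
  (forall i j, regular_at x (fun y => f y i j)) ->
  (forall i j, regular_at x (fun y => g y i j)) ->
  forall i j, regular_at x (fun y => op (f y) (g y) i j).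
Hypothesis op_conj : forall g A B,
  op (PGLconj g A) (PGLconj g B) = PGLconj g (op A B).
Variables f g : ratmap X M.

Let bdom : set X := rdomain f `&` rdomain g.
Let bfun (x : X) : M := op (reval f x) (reval g x).

Let bdom_open : open bdom.
Proof. by apply: openI; exact: rdom_open. Qed.

Let bdom_dense : dense bdom.
Proof. by apply: denseI; [exact: rdom_open|exact: rdom_dense..]. Qed.

Let bfun_morphism x : bdom x -> morphism_at bfun x.
Proof.
move=> [/rfun_morphism/morphism_at_mx rf /rfun_morphism/morphism_at_mx rg].
by apply/morphism_at_mx; exact: op_regular.
Qed.

Let bfun_equivariant a x : bdom x -> bdom (act a x) ->
  bfun (act a x) = act a (bfun x).
Proof.
move=> [fx gx] [fax gax]; rewrite /bfun.
have -> : reval f (act a x) = act a (reval f x) by exact: rfun_equivariant.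
have -> : reval g (act a x) = act a (reval g x) by exact: rfun_equivariant.
exact: op_conj.
Qed.

Definition pointwise : ratmap X M :=
  to_ratmap (RatRep bdom_open bdom_dense bfun_morphism bfun_equivariant).

Lemma pointwiseE :
  generic [set x | reval pointwise x = op (reval f x) (reval g x)].
Proof. exact: to_ratmapE. Qed.

End Binary.

Let add_regular (x : X) (f g : X -> 'M[k]_n) :
  (forall i j, regular_at x (fun y => f y i j)) ->
  (forall i j, regular_at x (fun y => g y i j)) ->
  forall i j, regular_at x (fun y => (f y + g y) i j).
Proof.
move=> rf rg i j; apply: regular_eq _ (regularD (rf i j) (rg i j)).
by apply: nearW => y; rewrite mxE.
Qed.

Let add_conj g (A B : 'M[k]_n) :
  PGLconj g A + PGLconj g B = PGLconj g (A + B).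
Proof. by rewrite /PGLconj mulmxDr mulmxDl. Qed.

Definition radd := pointwise add_regular add_conj.

Let mul_regular (x : X) (f g : X -> 'M[k]_n) :
  (forall i j, regular_at x (fun y => f y i j)) ->
  (forall i j, regular_at x (fun y => g y i j)) ->
  forall i j, regular_at x (fun y => (f y *m g y) i j).
Proof.
move=> rf rg i j.
apply: (@regular_eq _ _ _ (fun y => \sum_l f y i l * g y l j)).
  by apply: nearW => y; rewrite mxE.
by apply: regular_sum => l; exact: regularM.
Qed.

Let mul_conj g (A B : 'M[k]_n) :
  PGLconj g A *m PGLconj g B = PGLconj g (A *m B).
Proof. by rewrite /PGLconj !mulmxA mulmxKV ?PGLmx_unit. Qed.

Definition rmul := pointwise mul_regular mul_conj.

Section Scalar.
Variable c : k.

Let cst_morphism (x : X) : setT x -> morphism_at (fun=> c%:M : M) x.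
Proof. by move=> _; apply/morphism_at_mx => i j; exact: regular_cst. Qed.

Let cst_equivariant g (x : X) : setT x -> setT (act g x) ->
  c%:M = act g (c%:M : M).
Proof.
move=> _ _; rewrite /= /PGLconj scalar_mxC -mulmxA mulmxV ?mulmx1//.
exact: PGLmx_unit.
Qed.

Let setT_dense : dense [set: X].
Proof. by move=> O O0 _; rewrite setIT. Qed.

Definition rscalar : ratmap X M :=
  to_ratmap (RatRep openT setT_dense cst_morphism cst_equivariant).

Lemma rscalarE : generic [set x | reval rscalar x = c%:M].
Proof. exact: to_ratmapE. Qed.

End Scalar.

Definition rscale c f := rmul (rscalar c) f.

Lemma raddE f g : generic [set x |
  reval (radd f g) x = (reval f x : 'M[k]_n) + (reval g x : 'M[k]_n)].
Proof. exact: pointwiseE. Qed.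

Lemma rmulE f g :
  generic [set x | reval (rmul f g) x = reval f x *m reval g x].
Proof. exact: pointwiseE. Qed.

Lemma rscaleE c f :
  generic [set x | reval (rscale c f) x = c *: (reval f x : 'M[k]_n)].
Proof.
apply: genericS2 (rmulE (rscalar c) f) (rscalarE c) => x /= -> ->.
exact: mul_scalar_mx.
Qed.

End Pointwise.

(* The size is n.+1 because an algType is nontrivial, while 'M_0 = 0. *)
Section RMaps.
Context {k : fieldType} {n : nat} (X : irrPGLvariety k n.+1).
Local Notation R := (rmaps X).
Implicit Types f g h : R.

HB.instance Definition _ := Choice.on R.

Let addA : associative (@radd k n.+1 X).
Proof.
move=> f g h; apply/ratmapP.
apply: genericS2 (genericI (raddE f (radd g h)) (raddE g h))
  (genericI (raddE (radd f g) h) (raddE f g)) => x /= [e1 e2] [e3 e4].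
by rewrite e1 e2 e3 e4 addrA.
Qed.

Let addC : commutative (@radd k n.+1 X).
Proof.
move=> f g; apply/ratmapP.
by apply: genericS2 (raddE f g) (raddE g f) => x /= -> ->; rewrite addrC.
Qed.

Let add0 : left_id (rscalar 0) (@radd k n.+1 X).
Proof.
move=> f; apply/ratmapP; apply: genericS2 (raddE (rscalar 0) f) (rscalarE 0).
by move=> x /= -> ->; rewrite raddf0 add0r.
Qed.

Let addN : left_inverse (rscalar 0) (rscale (-1)) (@radd k n.+1 X).
Proof.
move=> f; apply/ratmapP.
apply: genericS3 (raddE (rscale (-1) f) f) (rscaleE (-1) f) (rscalarE 0).
by move=> x /= -> -> ->; rewrite scaleN1r addNr raddf0.
Qed.

HB.instance Definition _ := GRing.isZmodule.Build R addA addC add0 addN.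

Let mulA : associative (@rmul k n.+1 X).
Proof.
move=> f g h; apply/ratmapP.
apply: genericS2 (genericI (rmulE f (rmul g h)) (rmulE g h))
  (genericI (rmulE (rmul f g) h) (rmulE f g)) => x /= [e1 e2] [e3 e4].
by rewrite e1 e2 e3 e4 mulmxA.
Qed.

Let mul1 : left_id (rscalar 1) (@rmul k n.+1 X).
Proof.
move=> f; apply/ratmapP; apply: genericS2 (rmulE (rscalar 1) f) (rscalarE 1).
by move=> x /= -> ->; rewrite mul1mx.
Qed.

Let mulr1 : right_id (rscalar 1) (@rmul k n.+1 X).
Proof.
move=> f; apply/ratmapP; apply: genericS2 (rmulE f (rscalar 1)) (rscalarE 1).
by move=> x /= -> ->; rewrite mulmx1.
Qed.

Let mulDl : left_distributive (@rmul k n.+1 X) (@radd k n.+1 X).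
Proof.
move=> f g h; apply/ratmapP.
apply: genericS3 (genericI (rmulE (radd f g) h) (raddE f g))
  (raddE (rmul f h) (rmul g h)) (genericI (rmulE f h) (rmulE g h)).
by move=> x /= [e1 e2] e3 [e4 e5]; rewrite e1 e2 e3 e4 e5 mulmxDl.
Qed.

Let mulDr : right_distributive (@rmul k n.+1 X) (@radd k n.+1 X).
Proof.
move=> f g h; apply/ratmapP.
apply: genericS3 (genericI (rmulE f (radd g h)) (raddE g h))
  (raddE (rmul f g) (rmul f h)) (genericI (rmulE f g) (rmulE f h)).
by move=> x /= [e1 e2] e3 [e4 e5]; rewrite e1 e2 e3 e4 e5 mulmxDr.
Qed.

Let one_neq0 : rscalar 1 != 0 :> R.
Proof.
apply/eqP => /ratmapP e.
have [x [/= e1 [e2 e3]]] := generic_nonempty (irr_irreducible X)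
  (genericI e (genericI (rscalarE (1 : k)) (rscalarE (0 : k)))).
move: e1; rewrite e2 (e3 : reval (0 : R) x = _) => /matrixP/(_ 0 0)/eqP.
by rewrite !mxE eqxx oner_eq0.
Qed.

HB.instance Definition _ := GRing.Zmodule_isNzRing.Build R
  mulA mul1 mulr1 mulDl mulDr one_neq0.

Let scaleA (a b : k) f : rscale a (rscale b f) = rscale (a * b) f.
Proof.
apply/ratmapP; apply: genericS3 (rscaleE a (rscale b f)) (rscaleE b f)
  (rscaleE (a * b) f) => x /= -> -> ->.
exact: scalerA.
Qed.

Let scale1 : left_id 1 (@rscale k n.+1 X).
Proof. exact: mul1. Qed.

Let scaleDr : right_distributive (@rscale k n.+1 X : k -> R -> R) +%R.
Proof. by move=> a f g; exact: mulDr. Qed.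

Let scaleDl f : {morph (@rscale k n.+1 X : k -> R -> R)^~ f : a b / a + b >-> a + b}.
Proof.
move=> a b; apply/ratmapP.
apply: genericS2 (genericI (rscaleE (a + b) f) (raddE (rscale a f) (rscale b f)))
  (genericI (rscaleE a f) (rscaleE b f)) => x /= [e1 e2] [e3 e4].
by rewrite e1 (e2 : reval ((rscale a f : R) + (rscale b f : R)) x = _) e3 e4 scalerDl.
Qed.

HB.instance Definition _ := GRing.Zmodule_isLmodule.Build k R
  scaleA scale1 scaleDr scaleDl.

Let scaleAl (a : k) f g : a *: (f * g) = (a *: f) * g.
Proof. exact: mulA. Qed.

HB.instance Definition _ := GRing.Lmodule_isLalgebra.Build k R scaleAl.

Let scaleAr (a : k) f g : a *: (f * g) = f * (a *: g).
Proof.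
apply/ratmapP.
apply: genericS2 (genericI (rscaleE a (rmul f g)) (rmulE f g))
  (genericI (rmulE f (rscale a g)) (rscaleE a g)) => x /= [e1 e2] [e3 e4].
rewrite (e1 : reval (a *: (f * g)) x = _) (e3 : reval (f * (a *: g)) x = _).
by rewrite e2 e4 -scalemxAr.
Qed.

HB.instance Definition _ := GRing.Lalgebra_isAlgebra.Build k R scaleAr.

End RMaps.

Section CentralSimple.
Context {k : fieldType} (A : algType k).

Definition centre : set A := [set z | forall x, z * x = x * z].

Definition simple_algebra : Prop :=
  forall I : set A, I 0 -> (forall x y, I x -> I y -> I (x + y)) ->
    (forall a x, I x -> I (a * x) /\ I (x * a)) ->
    (forall x, I x -> x = 0) \/ (forall x, I x).

(* A has a basis of d ^ 2 elements over its centre. *)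
Definition has_degree (d : nat) : Prop :=
  exists b : 'I_(d ^ 2) -> A, forall a : A,
    exists! c : {ffun 'I_(d ^ 2) -> A},
      (forall i, centre (c i)) /\ a = \sum_i c i * b i.

Definition central_subfield (K : set A) : Prop :=
  [/\ K `<=` centre, forall c : k, K c%:A,
      forall x y, K x -> K y -> K (x - y) /\ K (x * y)
    & forall x, K x -> x != 0 -> exists2 y, K y & x * y = 1].

Definition fg_centre : Prop :=
  central_subfield centre /\
  exists s : seq A, (forall x, x \in s -> centre x) /\
    forall K, central_subfield K -> (forall x, x \in s -> K x) ->
      centre `<=` K.

Definition is_CS (d : nat) : Prop :=
  [/\ simple_algebra, has_degree d & fg_centre].

End CentralSimple.

Record category := Category {
  obj :> Type;
  hom : obj -> obj -> Type;
  idc : forall X, hom X X;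
  compc : forall X Y Z, hom Y Z -> hom X Y -> hom X Z;
  comp1c : forall X Y (f : hom X Y), compc (idc Y) f = f;
  compc1 : forall X Y (f : hom X Y), compc f (idc X) = f;
  compcA : forall W X Y Z (h : hom Y Z) (g : hom X Y) (f : hom W X),
    compc h (compc g f) = compc (compc h g) f
}.

Section Functors.
Variables (C D : category) (F : C -> D).
Variable Fhom : forall X Y : C, hom X Y -> hom (F Y) (F X).

Definition contravariant_functor : Prop :=
  (forall X : C, Fhom (idc X) = idc (F X)) /\
  (forall (X Y Z : C) (g : hom Y Z) (f : hom X Y),
    Fhom (compc g f) = compc (Fhom f) (Fhom g)).

Definition full : Prop :=
  forall (X Y : C) (a : hom (F Y) (F X)), exists f : hom X Y, Fhom f = a.

Definition faithful : Prop := forall X Y : C, injective (@Fhom X Y).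

End Functors.

Section E.
Variables (k : fieldType) (n : nat).

Record E_obj := EObj {
  E_var :> irrPGLvariety k n;
  E_birational : exists m (S : nvariety k m n), birational E_var (nv_space S)
}.

Definition E_hom (X Y : E_obj) : Type := {f : ratmap X Y | dominant f}.

Definition E_id (X : E_obj) : E_hom X X := exist _ _ (ratid_dominant X).

Definition E_comp (X Y Z : E_obj) (g : E_hom Y Z) (f : E_hom X Y) : E_hom X Z :=
  exist _ _ (ratcomp_dominant (irr_irreducible X) (proj2_sig f) (proj2_sig g)).

Lemma E_homP (X Y : E_obj) (f g : E_hom X Y) :
  generic [set x | reval (proj1_sig f) x = reval (proj1_sig g) x] -> f = g.
Proof.
case: f g => f df [g dg] /= /ratmapP fg; case: _ / fg dg => dg.
by congr exist; exact: Prop_irrelevance.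
Qed.

Let E_comp1 (X Y : E_obj) (f : E_hom X Y) : E_comp (E_id Y) f = f.
Proof.
apply: E_homP.
apply: genericS2 (ratcompE (irr_irreducible X) (ratid Y) (proj2_sig f))
  (dominant_generic (irr_irreducible X) (proj2_sig f) (ratidE Y)) => x /= -> ->.
by [].
Qed.

Let E_compr1 (X Y : E_obj) (f : E_hom X Y) : E_comp f (E_id X) = f.
Proof.
apply: E_homP.
apply: genericS2 (ratcompE (irr_irreducible X) (proj1_sig f) (ratid_dominant X)) (ratidE X).
by move=> x /= -> ->.
Qed.

Let E_compA (W X Y Z : E_obj) (h : E_hom Y Z) (g : E_hom X Y) (f : E_hom W X) :
  E_comp h (E_comp g f) = E_comp (E_comp h g) f.
Proof.
apply: E_homP.
have e1 := ratcompE (irr_irreducible W) (proj1_sig h) (proj2_sig (E_comp g f)).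
have e2 := ratcompE (irr_irreducible W) (proj1_sig g) (proj2_sig f).
have e3 := ratcompE (irr_irreducible W) (proj1_sig (E_comp h g)) (proj2_sig f).
have e4 := dominant_generic (irr_irreducible W) (proj2_sig f)
  (ratcompE (irr_irreducible X) (proj1_sig h) (proj2_sig g)).
apply: genericS2 (genericI e1 e2) (genericI e3 e4) => x /= [-> ->] [-> ->].
by [].
Qed.

Definition E_cat : category := Category E_comp1 E_compr1 E_compA.

End E.

Section CS.
Variables (k : fieldType) (n : nat).

Record CS_obj := CSObj { CS_alg :> algType k; CS_prop : is_CS CS_alg n }.

Definition CS_hom (A B : CS_obj) : Type := {lrmorphism A -> B}.
Definition CS_id (A : CS_obj) : CS_hom A A := (idfun : {lrmorphism A -> A}).
Definition CS_comp (A B C : CS_obj) (g : CS_hom B C) (f : CS_hom A B) :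
    CS_hom A C :=
  let g : {lrmorphism B -> C} := g in let f : {lrmorphism A -> B} := f in
  (g \o f : {lrmorphism A -> C}).

Lemma lrmorphism_eq (A B : algType k) (f g : {lrmorphism A -> B}) :
  (f : A -> B) =1 g -> f = g.
Proof.
case: f g => f [[f1] [f2] [f3]] [g [[g1] [g2] [g3]]] /= /funext fg.
case: _ / fg g1 g2 g3 => g1 g2 g3.
by rewrite (Prop_irrelevance g1 f1) (Prop_irrelevance g2 f2)
  (Prop_irrelevance g3 f3).
Qed.

Let CS_comp1 (A B : CS_obj) (f : CS_hom A B) : CS_comp (CS_id B) f = f.
Proof. exact: lrmorphism_eq. Qed.

Let CS_compr1 (A B : CS_obj) (f : CS_hom A B) : CS_comp f (CS_id A) = f.
Proof. exact: lrmorphism_eq. Qed.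

Let CS_compA (A B C D : CS_obj) (h : CS_hom C D) (g : CS_hom B C)
  (f : CS_hom A B) : CS_comp h (CS_comp g f) = CS_comp (CS_comp h g) f.
Proof. exact: lrmorphism_eq. Qed.

Definition CS_cat : category := Category CS_comp1 CS_compr1 CS_compA.

End CS.

Definition precomp (k : fieldType) n (X Y : E_obj k n) (f : E_hom X Y)
    (g : rmaps Y) : rmaps X :=
  ratcomp (irr_irreducible X) g (proj2_sig f).

(* Main.v *)
From HB Require Import structures.
From mathcomp Require Import all_boot all_order all_algebra closed_field.
From mathcomp Require Import boolp classical_sets functions topology mpoly.
Require Import Defs.

Set Implicit Arguments.
Unset Strict Implicit.
Unset Printing Implicit Defensive.

Import GRing.Theory.

Local Open Scope classical_set_scope.
Local Open Scope ring_scope.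

(** Write [A_X] for the algebra of equivariant rational maps from [X] to the
    square matrices of size [d = n.+1], and [K_X] for its centre.

    If [X] is birational to a [d]-variety with components [phi_i], some words in
    the [phi_i] form a frame: their values are a basis of the matrix algebra at a
    generic point. Coordinates in a frame are given by Cramer's rule and are
    invariant, so [A_X] has dimension [d^2] over [K_X], which consists of the maps
    with scalar values. A nonzero two-sided ideal contains an element whose value at some
    point is the identity, hence a unit. The field [K_X] is
    finitely generated over [k] because it lies between [k] and the field of
    rational functions on a variety with coordinates [x]: it is generated by the
    coefficients of a Groebner basis of the ideal of polynomials over [K_X]
    that vanish at [x] ([fg_centre_groebner]).

    A pullback is injective since [A_Y] is simple, and it determines the map
    since it determines the coordinates of the map in a model of [Y]
    ([pullback_faithful]).

    The main point is fullness. Let [alpha : A_Y -> A_X] be a homomorphism, and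
    [theta] the tuple of the [alpha phi_i], where the [phi_i] are the components of a
    birational map from [Y] to a [d]-variety [S]. By density of the
    multiplication operators of a simple algebra, [alpha] sends frames to
    frames ([hom_frame]) and [K_Y] into [K_X]. Hence [theta x] generates the
    matrix algebra for generic [x], and [alpha] carries the structure constants
    of a frame of [A_Y] to those of its image. By the theorem of Skolem and Noether, the
    structure constants of a frame at a point, together with the coordinates
    of the [phi_i], determine the tuple of values up to conjugation. For
    polynomials [p], [q] and [zeta] in [K_Y], the condition that [p = zeta q] on all
    conjugates of the tuple is therefore a first order condition on elements of
    [K_Y]. Over an algebraically closed field it is equivalent to a quantifier free
    one, and such a condition holds generically on [Y] if and only if its image
    under [alpha] holds generically on [X], because [alpha] is injective
    ([conj_transfer]).

    With [q = 0] and [p] vanishing on [S], this puts [theta x] in [S]; in the other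
    direction, with [p] vanishing on the conjugates of all [theta x], it shows that
    [theta] is dominant. Composing [theta] with the birational map from [S] to
    [Y] gives a dominant map [f]. The homomorphisms [f^*] and [alpha] agree on the
    [phi_i]. An element [zeta] of [K_Y] is a quotient [p / q] of polynomials in
    the entries of the [phi_i], which are not invariant, but the relation [p = zeta q]
    on all conjugates transfers to [X] and shows that [f^*] and [alpha] agree on
    [K_Y] as well ([fullness]). *)

(** * Density of the multiplication operators of a simple algebra *)

Section Bimodule.
Context {k : fieldType} {A : algType k}.
Implicit Types (T U : A -> A) (s : seq (A * A)).

Definition bimul s (x : A) : A := \sum_(p <- s) p.1 * x * p.2.

Definition bioperator T : Prop := exists s, forall x, T x = bimul s x.

Lemma bioperator_id : bioperator id.
Proof. by exists [:: (1, 1)] => x; rewrite /bimul big_seq1 mul1r mulr1. Qed.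

Lemma bioperatorM a T b :
  bioperator T -> bioperator (fun x => a * T x * b).
Proof.
move=> [s sT]; exists [seq (a * p.1, p.2 * b) | p <- s] => x.
rewrite sT /bimul big_map mulr_sumr mulr_suml.
by apply: eq_bigr => p _; rewrite !mulrA.
Qed.

Lemma bioperatorD T U :
  bioperator T -> bioperator U -> bioperator (fun x => T x + U x).
Proof.
by move=> [s sT] [t tU]; exists (s ++ t) => x; rewrite sT tU /bimul big_cat.
Qed.

Lemma bioperator_sum r (T : nat -> A -> A) :
  (forall i, (i < r)%N -> bioperator (T i)) ->
  bioperator (fun x => \sum_(i < r) T i x).
Proof.
elim: r => [|r IHr] hT.
  by exists [::] => x; rewrite /bimul big_ord0 big_nil.
have [s hs] := bioperatorD (IHr (fun i ir => hT i (ltnW ir))) (hT r (ltnSn r)).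
by exists s => x; rewrite big_ord_recr /= hs.
Qed.

Lemma bioperator_comp T U :
  bioperator T -> bioperator U -> bioperator (T \o U).
Proof.
move=> [s sT] [t tU].
exists [seq (p.1 * q.1, q.2 * p.2) | p <- s, q <- t] => x /=.
rewrite sT tU /bimul big_allpairs_dep; apply: eq_bigr => p _.
rewrite mulr_sumr mulr_suml; apply: eq_bigr => q _ /=.
by rewrite !mulrA.
Qed.

Lemma bioperator0 T : bioperator T -> T 0 = 0.
Proof.
move=> [s ->]; rewrite /bimul big1// => p _.
by rewrite mulr0 mul0r.
Qed.

(** The values at [a] of the operators form a two-sided ideal. *)
Lemma simple_bioperator a : simple_algebra A -> a != 0 ->
  exists2 T, bioperator T & T a = 1.
Proof.
move=> sA a0; pose I : set A := [set y | exists2 T, bioperator T & T a = y].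
have I0 : I 0.
  exists (fun x => 0 * x * 0); first exact: bioperatorM bioperator_id.
  by rewrite mulr0.
have [|y z [T oT <-] [U oU <-]|y z [T oT <-]|I1|I1] := sA I => //.
- by exists (fun x => T x + U x) => //; exact: bioperatorD.
- split; [exists (fun x => y * T x * 1)|exists (fun x => 1 * T x * y)];
    by [exact: bioperatorM|rewrite ?mulr1 ?mul1r].
- have /I1/eqP : I a by exists id => //; exact: bioperator_id.
  by rewrite (negPf a0).
- exact: I1.
Qed.

Definition centre_free r (a : nat -> A) : Prop :=
  forall c : nat -> A, (forall i, centre (c i)) ->
    \sum_(i < r) c i * a i = 0 -> forall i, (i < r)%N -> c i = 0.

(** Induction on [r]. Let [T l], for [l < r], be dual to the first [r] vectors. By
    simplicity it is enough to find an operator that kills those vectors, but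
    not [a r]. The operator [x - \sum_l T l x * a l] is one, unless [a r] is the
    combination of the [a l] with coefficients [T l (a r)]. Then one of these
    coefficients is not central, and its commutator with some [y] is the value at
    [a r] of an operator that kills the other vectors. *)
Lemma simple_density r (a : nat -> A) : simple_algebra A -> centre_free r a ->
  exists T : nat -> A -> A, (forall l, (l < r)%N -> bioperator (T l)) /\
    forall l i, (l < r)%N -> (i < r)%N -> T l (a i) = (i == l)%:R.
Proof.
move=> sA; elim: r => [|r IHr] fa; first by exists (fun=> id).
have [|T [oT Ta]] := IHr.
  move=> c cc ca i ir; pose c' j := if (j < r)%N then c j else 0.
  have cc' j : centre (c' j).
    by rewrite /c'; case: ifP => // _ x; rewrite mul0r mulr0.
  have := fa c' cc' _ i (ltnW ir); rewrite /c' ir; apply.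
  rewrite big_ord_recr /= ltnn mul0r addr0 -[RHS]ca.
  by apply: eq_bigr => j _; rewrite ltn_ord.
have delta (F : nat -> A) i : (i < r)%N -> \sum_(l < r) T l (a i) * F l = F i.
  move=> ir; rewrite (bigD1 (Ordinal ir))//= big1 => [|j ji].
    by rewrite Ta// eqxx mul1r addr0.
  by rewrite Ta// eq_sym (negPf (_ : (j : nat) != i)) ?mul0r.
have [S oS [Sa Sr]] : exists2 S, bioperator S &
    (forall i, (i < r)%N -> S (a i) = 0) /\ S (a r) != 0.
  pose U x := x + - 1 * (\sum_(l < r) 1 * T l x * a l) * 1.
  have oU : bioperator U.
    apply: bioperatorD bioperator_id _; apply: bioperatorM.
    apply: (bioperator_sum (T := fun l x => 1 * T l x * a l)) => i ir.
    exact: bioperatorM (oT i ir).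
  have UE x : U x = x - \sum_(l < r) T l x * a l.
    rewrite /U mulN1r mulr1; congr (_ - _).
    by apply: eq_bigr => l _; rewrite mul1r.
  have [Ur|Ur] := eqVneq (U (a r)) 0; last first.
    by exists U => //; split=> // i ir; rewrite UE delta// subrr.
  have nl : ~ forall l, (l < r)%N -> centre (T l (a r)).
    move=> cT; pose c j := if (j < r)%N then T j (a r) else - 1.
    have cc j : centre (c j).
      rewrite /c; case: ifP => [/cT//|_] x.
      by rewrite mulN1r mulrN1.
    have := fa c cc _ r (ltnSn r); rewrite /c ltnn big_ord_recr /= ltnn.
    rewrite mulN1r; under eq_bigr => j _ do rewrite ltn_ord.
    move: Ur; rewrite UE => /eqP; rewrite subr_eq0 => /eqP <-.
    by rewrite subrr => /(_ erefl)/eqP; rewrite oppr_eq0 oner_eq0.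
  apply: contrapT => nS; apply: nl => l lr y; apply: contrapT => yl; apply: nS.
  exists (fun x => 1 * T l x * y + - y * T l x * 1).
    by apply: bioperatorD; apply: bioperatorM; exact: oT.
  split=> [i ir|]; last by rewrite mul1r mulr1 mulNr subr_eq0; apply/eqP.
  rewrite mul1r mulr1 mulNr Ta//.
  by case: eqP; rewrite ?mul1r ?mulr1 ?mul0r ?mulr0 subrr.
have [R oR RS] := simple_bioperator sA Sr.
have oRS := bioperator_comp oR oS.
pose T' l x := if (l < r)%N then T l x + - T l (a r) * (R (S x)) * 1
  else R (S x).
exists T'; split=> [l|l i].
  rewrite ltnS leq_eqVlt => /orP[/eqP ->|lr]; rewrite /T'.
    by rewrite ltnn.
  by rewrite lr; apply: bioperatorD; [exact: oT|exact: bioperatorM].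
rewrite !ltnS /T' => lr; rewrite leq_eqVlt => /orP[/eqP ->|ir].
  rewrite RS !mulr1; case: ltnP => [lr'|rl]; last by rewrite eqn_leq rl lr.
  by rewrite subrr eq_sym (ltn_eqF lr').
rewrite (Sa _ ir) (bioperator0 oR) mulr0 mul0r addr0.
case: ltnP => [lr'|rl]; first exact: Ta.
by rewrite ltn_eqF// (leq_trans ir).
Qed.

End Bimodule.

(** * Groebner bases and generators of the centre *)

(** Induction on the number of coordinates that are not constant on [L]: if
    [m0] is in [L], any [m] in [L] that is not above [m0] lies in one of the
    finitely many slices where a free coordinate is a number below that of
    [m0]. *)
Lemma dickson d (L : set 'X_{1..d}) : exists l : seq 'X_{1..d},
  (forall m, m \in l -> L m) /\
  forall m, L m -> exists2 m', m' \in l & (m' <= m)%MM.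
Proof.
suff : forall r (D : {set 'I_d}) (M : set 'X_{1..d}), (#|~: D| <= r)%N ->
    (forall m m' i, M m -> M m' -> i \in D -> m i = m' i) ->
    exists l : seq 'X_{1..d}, (forall m, m \in l -> M m) /\
      forall m, M m -> exists2 m', m' \in l & (m' <= m)%MM.
  by move=> /(_ _ finset.set0 L (leqnn _)); apply=> m m' i; rewrite finset.in_set0.
move=> r D M; elim: r D M => [|r IHr] D M Dr cD.
  have DT i : i \in D.
    by move: Dr; rewrite leqn0 cards_eq0 => /eqP/setP/(_ i); rewrite !inE => /negbFE.
  have [[m0 Mm0]|M0] := pselect (exists m, M m); last first.
    by exists [::]; split=> // m Mm; case: M0; exists m.
  exists [:: m0]; split=> [m|m Mm]; first by rewrite inE => /eqP ->.
  exists m0; rewrite ?inE//.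
  by apply/mnm_lepP => i; rewrite (cD m0 m i).
have [[m0 Mm0]|M0] := pselect (exists m, M m); last first.
  by exists [::]; split=> // m Mm; case: M0; exists m.
pose slice (i : 'I_d) v : set 'X_{1..d} := [set m | M m /\ m i = v].
have /choice[f fP] : forall iv : 'I_d * nat, exists l : seq 'X_{1..d},
    iv.1 \notin D -> (forall m, m \in l -> slice iv.1 iv.2 m) /\
    forall m, slice iv.1 iv.2 m -> exists2 m', m' \in l & (m' <= m)%MM.
  move=> [i v] /=; have [iD|iD] := boolP (i \in D); first by exists [::].
  have [||l lP] := IHr (i |: D)%SET (slice i v); last by exists l.
    have -> : (~: (i |: D) = (~: D) :\ i)%SET.
      by apply/setP => j; rewrite !inE negb_or.
    by move: Dr; rewrite (cardsD1 i (~: D)%SET) !inE iD.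
  move=> m m' j [Mm mi] [Mm' m'i]; rewrite !inE => /orP[/eqP ->|].
    by rewrite mi m'i.
  exact: cD.
pose ivs := [seq (i, v) | i <- [seq i <- enum 'I_d | i \notin D],
                          v <- iota 0 (m0 i)].
exists (m0 :: flatten [seq f iv | iv <- ivs]); split=> [m|m Mm].
  rewrite inE => /orP[/eqP -> //|/flattenP[l' /mapP[[i v] + ->]]].
  move=> /allpairsPdep[i' [v' [+ _ [ei ev]]]]; rewrite mem_filter => /andP[iD _].
  rewrite {}ei {}ev => ml.
  by have [/(_ m ml)[]] := fP (i', v') iD.
have [/mnm_lepP m0m|nm0m] := pselect (forall i, (m0 i <= m i)%N).
  by exists m0; rewrite ?inE ?eqxx.
have [i im] : exists i, (m i < m0 i)%N.
  by apply: contrapT => n; apply: nm0m => i; rewrite leqNgt; apply/negP => ?; apply: n; exists i.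
have iD : i \notin D by apply/negP => /(cD _ _ i Mm Mm0) E; rewrite E ltnn in im.
have [_ /(_ m (conj Mm erefl))[m' m'l m'm]] := fP (i, m i) iD.
exists m' => //; rewrite inE; apply/orP; right; apply/flattenP.
exists (f (i, m i)) => //; apply/mapP; exists (i, m i) => //.
apply/allpairsPdep; exists i, (m i); split=> //.
  by rewrite mem_filter iD mem_enum.
by rewrite mem_iota.
Qed.

Section CentralSubfield.
Context {k : fieldType} {A : algType k} {K : set A}.
Hypothesis cK : central_subfield K.

Lemma central_subfield0 : K 0.
Proof. by have [_ /(_ 0)] := cK; rewrite scale0r. Qed.

Lemma central_subfieldB x y : K x -> K y -> K (x - y).
Proof. by move=> Kx Ky; have [_ _ /(_ x y Kx Ky)[]] := cK. Qed.

Lemma central_subfieldM x y : K x -> K y -> K (x * y).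
Proof. by move=> Kx Ky; have [_ _ /(_ x y Kx Ky)[]] := cK. Qed.

Lemma central_subfieldN x : K x -> K (- x).
Proof. by rewrite -sub0r => Kx; exact: central_subfieldB central_subfield0 Kx. Qed.

Lemma central_subfieldD x y : K x -> K y -> K (x + y).
Proof. by move=> Kx Ky; rewrite -[y]opprK; apply/central_subfieldB/central_subfieldN. Qed.

End CentralSubfield.

Section Groebner.
Context {k : fieldType} {A : algType k} {d : nat}.
Implicit Types (P Q R : {mpoly A[d]}) (K : set A).

Definition coefs_in K P : Prop := forall m, K P@_m.

Lemma mcoeffMX_le P m j : (P * 'X_[m])@_j = if (m <= j)%MM then P@_(j - m) else 0.
Proof.
case: ifP => [mj|mj]; first by rewrite -{1}(submK mj) addmC mcoeffMX.
apply/eqP; rewrite mcoeff_eq0 (perm_mem (msuppMX P m)).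
by apply/mapP => -[m' _ jm]; rewrite jm lem_addr in mj.
Qed.

Lemma coefs_inMX K P m : central_subfield K -> coefs_in K P ->
  coefs_in K (P * 'X_[m]).
Proof.
move=> cK KP j; rewrite mcoeffMX_le; case: ifP => // _.
exact: central_subfield0 cK.
Qed.

Lemma mlead_lt P m : P@_m = 0 -> (forall j, P@_j != 0 -> (j <= m)%O) ->
  P != 0 -> (mlead P < m)%O.
Proof.
move=> Pm Pj P0; have lP : P@_(mlead P) != 0 by rewrite mleadc_eq0.
rewrite Order.POrderTheory.lt_neqAle Pj// andbT.
by apply: contraNneq lP => ->; rewrite Pm.
Qed.

(** In the application, [J] consists of the polynomial relations between the
    coordinates of a generic point. *)
Variable J : set {mpoly A[d]}.
Hypothesis J0 : J 0.
Hypothesis JD : forall P Q c m, J P -> J Q -> centre c ->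
  J (P + c *: (Q * 'X_[m])).

Definition lead_monomials : set 'X_{1..d} :=
  [set m | exists P, [/\ J P, coefs_in (@centre k A) P, P != 0 & mlead P = m]].

(** Division by polynomials whose coefficients lie in [K] stays over [K]. *)
Lemma normal_form K (l : seq 'X_{1..d}) (B : 'X_{1..d} -> {mpoly A[d]}) Q :
  central_subfield (@centre k A) -> central_subfield K ->
  (forall m, m \in l -> [/\ J (B m), coefs_in K (B m), B m != 0 & mlead (B m) = m]) ->
  (forall m, lead_monomials m -> exists2 m', m' \in l & (m' <= m)%MM) ->
  coefs_in K Q -> exists R, [/\ coefs_in K R, J (Q - R) &
    forall m, lead_monomials m -> R@_m = 0].
Proof.
move=> cA cK BP lP; have [mu Qmu] : exists mu, mlead Q = mu by eexists.
elim/(@ltmwf d): mu Q Qmu => mu IH Q Qmu KQ.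
have trivial_form : Q = 0 -> exists R, [/\ coefs_in K R, J (Q - R) &
    forall m, lead_monomials m -> R@_m = 0].
  move=> ->; exists 0; split=> [m||m _]; rewrite ?subr0 ?mcoeff0//.
  exact: central_subfield0 cK.
have [/trivial_form//|Q0] := eqVneq Q 0.
have Qj j : Q@_j != 0 -> (j <= mu)%O.
  by rewrite -mcoeff_msupp -Qmu; exact: msupp_le_mlead.
set c := Q@_mu.
have reduce Q' : coefs_in K Q' -> Q'@_mu = 0 -> (forall j, Q'@_j != 0 -> (j <= mu)%O) ->
    exists R, [/\ coefs_in K R, J (Q' - R) &
      forall m, lead_monomials m -> R@_m = 0].
  move=> KQ' Q'mu Q'j; have [->|Q'0] := eqVneq Q' 0; last first.
    by apply: (IH _ _ Q' erefl) => //; exact: mlead_lt.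
  exists 0; split=> [m||m _]; rewrite ?subr0 ?mcoeff0//.
  exact: central_subfield0 cK.
have [lmu|lmu] := pselect (lead_monomials mu); last first.
  have coefX j : (c *: 'X_[mu] : {mpoly A[d]})@_j = if j == mu then c else 0.
    by rewrite mcoeffZ mcoeffX eq_sym; case: eqP; rewrite ?mulr1 ?mulr0.
  have [|||R [KR JR lR]] := reduce (Q - c *: 'X_[mu]).
  - move=> j; rewrite mcoeffB coefX; apply: central_subfieldB => //.
    by case: ifP => _; [exact: KQ|exact: central_subfield0 cK].
  - by rewrite mcoeffB coefX eqxx subrr.
  - move=> j; rewrite mcoeffB coefX; case: (j =P mu) => [->|_]; first by rewrite subrr eqxx.
    by rewrite subr0; exact: Qj.
  exists (R + c *: 'X_[mu]); split.
  - move=> j; rewrite mcoeffD coefX; apply: central_subfieldD => //.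
    by case: ifP => _; [exact: KQ|exact: central_subfield0 cK].
  - by rewrite opprD addrA addrAC.
  - move=> m lm; rewrite mcoeffD lR// add0r coefX.
    by case: eqP => // mmu; rewrite mmu in lm.
have [m ml mmu] := lP _ lmu; have [JB KB B0 lB] := BP _ ml.
have lc0 : (B m)@_m != 0 by rewrite -{1}lB mleadc_eq0.
have [_ _ _ /(_ _ (KB m) lc0)[y Ky y1]] := cK.
have cc z : K z -> centre z by have [/(_ z)] := cK.
set e := c * y; pose t := B m * 'X_[mu - m].
have Ke : K e by apply: central_subfieldM => //; exact: KQ.
have tmu : t@_mu = (B m)@_m.
  rewrite /t mcoeffMX_le lem_subr; congr (mcoeff _ _).
  by rewrite -[X in (X - _)%MM](submK mmu) addmC addmK.
have tj j : t@_j != 0 -> (j <= mu)%O.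
  rewrite /t -mcoeff_msupp (perm_mem (msuppMX _ _)) => /mapP[j' j'B ->].
  have -> : mu = (mu - m + m)%MM by rewrite submK.
  rewrite addmK; apply: lem_add => //.
  by have := msupp_le_mlead j'B; rewrite lB.
have [|||R [KR JR lR]] := reduce (Q - e *: t).
- move=> j; rewrite mcoeffB mcoeffZ; apply: central_subfieldB => //.
  by apply: central_subfieldM => //; exact: coefs_inMX.
- by rewrite mcoeffB mcoeffZ tmu /e -mulrA -(cc _ (KB m)) y1 mulr1 subrr.
- move=> j; have [tj0|/tj//] := eqVneq t@_j 0.
  by rewrite mcoeffB mcoeffZ tj0 mulr0 subr0; exact: Qj.
exists R; split=> //.
have -> : Q - R = (Q - e *: t - R) + e *: t by rewrite addrAC subrK.
by apply: JD => //; exact: cc.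
Qed.

(** The centre is generated by the coefficients of a Groebner basis of [J]. If
    [f] satisfies [P - f Q \in J] with [P], [Q] over [k], the normal forms of
    [P] and [Q] have coefficients in the field generated by that basis, and the
    normal form of [P - f Q] vanishes, so that [f] is a quotient of such
    coefficients. *)
Lemma fg_centre_groebner : central_subfield (@centre k A) ->
  (forall f, centre f -> exists P Q,
    [/\ coefs_in (range (fun c : k => c%:A)) P, coefs_in (range (fun c : k => c%:A)) Q,
        J (P - f *: Q) & ~ J Q]) ->
  fg_centre A.
Proof.
move=> cA fPQ; split=> //.
have [l [lL Ll]] := dickson lead_monomials.
have /choice[B BP] : forall m, exists P, m \in l ->
    [/\ J P, coefs_in (@centre k A) P, P != 0 & mlead P = m].
  move=> m; have [ml|] := boolP (m \in l); last by exists 0.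
  by have [P ?] := lL _ ml; exists P.
exists (flatten [seq [seq (B m)@_j | j <- msupp (B m)] | m <- l]); split.
  move=> x /flattenP[s /mapP[m ml ->] /mapP[j _ ->]].
  by have [_ cB _ _] := BP m ml.
move=> K cK sK f cf; have [P [Q [kP kQ JPQ nJQ]]] := fPQ f cf.
have kK R : coefs_in (range (fun c : k => c%:A)) R -> coefs_in K R.
  by move=> kR m; have [c _ <-] := kR m; have [_] := cK.
have KB m : m \in l -> coefs_in K (B m).
  move=> ml j; have [jB|] := boolP (j \in msupp (B m)); last first.
    by rewrite -mcoeff_eq0 => /eqP ->; exact: central_subfield0 cK.
  by apply: sK; apply/flattenP; eexists; [exact: (map_f _ ml)|exact: map_f].
have BP' m : m \in l ->
    [/\ J (B m), coefs_in K (B m), B m != 0 & mlead (B m) = m].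
  by move=> ml; have [? _ ? ?] := BP m ml; split=> //; exact: KB.
have [P' [KP' JP' lP']] := normal_form cA cK BP' Ll (kK _ kP).
have [Q' [KQ' JQ' lQ']] := normal_form cA cK BP' Ll (kK _ kQ).
have Jadd R S c : J R -> J S -> centre c -> J (R + c *: S).
  by move=> JR JS cc; rewrite -[S]mulr1 -mpolyX0; exact: JD.
have c1 : centre (- 1 : A) by move=> x; rewrite mulN1r mulrN1.
have Q'0 : Q' != 0.
  by apply/eqP => Q'0; apply: nJQ; rewrite Q'0 subr0 in JQ'.
have K_centre z : K z -> centre z by have [/(_ z)] := cK.
have JPQ' : J (P' - f *: Q').
  have -> : P' - f *: Q' = P - f *: Q + -1 *: (P - P') + f *: (Q - Q').
    by rewrite scaleN1r scalerBr opprB addrACA addrA subrK addrCA subrr addr0 addrC.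
  by apply: (Jadd) => //; exact: Jadd.
have PQ' : P' - f *: Q' = 0.
  apply: contrapT => /eqP n0.
  have : lead_monomials (mlead (P' - f *: Q')).
    exists (P' - f *: Q'); split=> // m; rewrite mcoeffB mcoeffZ.
    apply: (central_subfieldB cA); first exact: K_centre.
    by apply: (central_subfieldM cA) => //; exact: K_centre.
  move=> lm; have := n0; rewrite -mleadc_eq0 mcoeffB mcoeffZ lP'// lQ'//.
  by rewrite mulr0 subr0 eqxx.
have {}Q'0 : Q'@_(mlead Q') != 0 by rewrite mleadc_eq0.
have [_ _ _ /(_ _ (KQ' _) Q'0)[y Ky y1]] := cK.
move: PQ' => /(congr1 (mcoeff (mlead Q'))).
rewrite mcoeffB mcoeffZ mcoeff0 => /eqP; rewrite subr_eq0 => /eqP PQ'.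
have -> : f = P'@_(mlead Q') * y by rewrite PQ' -mulrA y1 mulr1.
exact: (central_subfieldM cK).
Qed.

End Groebner.

(** * Automorphisms of the matrix algebra *)

(** The images [f i j] of the matrix units multiply as matrix units. For a
    nonzero row [v] fixed by [f 0 0], the rows [v *m f 0 j] form a basis on which
    [f i j] acts as the matrix unit itself. *)
Lemma skolem_noether (k : fieldType) n (tau : 'M[k]_n.+1 -> 'M[k]_n.+1) :
  (forall c A B, tau (c *: A + B) = c *: tau A + tau B) ->
  (forall A B, tau (A *m B) = tau A *m tau B) -> tau 1%:M = 1%:M ->
  exists2 G, G \in unitmx & forall A, A *m G = G *m tau A.
Proof.
move=> tauL tauM tau1.
have tau0 : tau 0 = 0.
  by have := tauL (-1) 0 0; rewrite scaler0 addr0 scaleN1r addNr.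
have tauZ c A : tau (c *: A) = c *: tau A.
  by have := tauL c A 0; rewrite tau0 !addr0.
have tau_sum (I : Type) (r : seq I) (F : I -> 'M[k]_n.+1) :
    tau (\sum_(i <- r) F i) = \sum_(i <- r) tau (F i).
  elim: r => [|i r IHr]; first by rewrite !big_nil.
  by rewrite !big_cons -[F i]scale1r tauL IHr !scale1r.
pose f (i j : 'I_n.+1) := tau (delta_mx i j).
have fM i j l h : f i j *m f l h = (j == l)%:R *: f i h.
  by rewrite -tauM mul_delta_mx_cond mulrb; case: eqP => _; rewrite ?scale1r ?scale0r.
have f00 : f 0 0 != 0.
  apply/eqP => f0; have : tau 1%:M = 0 :> 'M_n.+1.
    rewrite mx1_sum_delta tau_sum big1// => i _.
    have := fM i 0 0 i; rewrite eqxx scale1r /f => <-.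
    have := fM i 0 0 0; rewrite eqxx scale1r /f => <-.
    by rewrite -/(f 0 0) f0 mulmx0 mul0mx.
  by rewrite tau1 => /matrixP/(_ 0 0)/eqP; rewrite !mxE eqxx oner_eq0.
have [i0 v0] : exists i, row i (f 0 0) != 0.
  apply: contrapT => n0; move/eqP: f00; apply; apply/row_matrixP => i.
  by rewrite row0; apply: contrapT => /eqP ni; apply: n0; exists i.
set v := row i0 (f 0 0) in v0.
have vf : v *m f 0 0 = v by rewrite /v -row_mul fM eqxx scale1r.
pose G := \matrix_(j < n.+1) (v *m f 0 j).
have unitG i j : delta_mx i j *m G = G *m f i j.
  apply/row_matrixP => a; rewrite !row_mul rowK -mulmxA fM -scalemxAr.
  rewrite rowE mul_delta_mx_cond; case: (a == i); last first.
    by rewrite mulr0n mul0mx scale0r.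
  by rewrite mulr1n -rowE rowK scale1r.
have AG A : A *m G = G *m tau A.
  rewrite [A in LHS]matrix_sum_delta [A in RHS]matrix_sum_delta tau_sum.
  rewrite mulmx_suml mulmx_sumr; apply: eq_bigr => i _.
  rewrite tau_sum mulmx_suml mulmx_sumr; apply: eq_bigr => j _.
  by rewrite tauZ -scalemxAl -scalemxAr unitG.
exists G => //; rewrite -row_free_unit -kermx_eq0.
apply/rowV0P => u /sub_kermxP uG; apply/rowP => j; rewrite mxE.
have : u *m delta_mx j 0 *m G = 0 by rewrite -mulmxA unitG mulmxA uG mul0mx.
have -> : u *m delta_mx j 0 = u 0 j *: delta_mx 0 0 :> 'rV_n.+1.
  apply/rowP => l; rewrite !mxE (bigD1 j)//= big1 => [|h /negPf hj].
    by rewrite !mxE !eqxx addr0.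
  by rewrite mxE hj mulr0.
rewrite -scalemxAl -rowE rowK vf => /eqP; rewrite scaler_eq0 (negPf v0) orbF.
by move/eqP.
Qed.

(** * Elimination of quantifiers *)

(** Functions of two blocks of variables, indexed by [I] and [J], that are given
    by a term in the language of rings. *)
Section PolynomialFunctions.
Context {k : fieldType} {I J : finType}.
Implicit Types (F G : (I -> k) -> (J -> k) -> k) (e : seq k).

Definition environment (z : I -> k) (w : J -> k) e : Prop :=
  (forall i, e`_(enum_rank i) = z i) /\
  (forall j, e`_(#|I| + enum_rank j) = w j).

Definition polyfun F : Prop := exists2 t : GRing.term k, GRing.rterm t &
  forall z w e, environment z w e -> GRing.eval e t = F z w.

Lemma polyfun_ext F G : (forall z w, F z w = G z w) -> polyfun F -> polyfun G.
Proof. by move=> FG [t rt tF]; exists t => // z w e /tF ->. Qed.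

Lemma polyfun_cst c : polyfun (fun _ _ => c).
Proof. by exists (GRing.Const c). Qed.

Lemma polyfun_varl i : polyfun (fun z _ => z i).
Proof. by exists (GRing.Var k (enum_rank i)) => // z w e [ez _]; exact: ez. Qed.

Lemma polyfun_varr j : polyfun (fun _ w => w j).
Proof.
by exists (GRing.Var k (#|I| + enum_rank j)) => // z w e [_ ew]; exact: ew.
Qed.

Lemma polyfunD F G : polyfun F -> polyfun G ->
  polyfun (fun z w => F z w + G z w).
Proof.
move=> [t rt tF] [u ru uG]; exists (GRing.Add t u); first by rewrite /= rt ru.
by move=> z w e ze; rewrite /= (tF z w)// (uG z w).
Qed.

Lemma polyfunM F G : polyfun F -> polyfun G ->
  polyfun (fun z w => F z w * G z w).
Proof.
move=> [t rt tF] [u ru uG]; exists (GRing.Mul t u); first by rewrite /= rt ru.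
by move=> z w e ze; rewrite /= (tF z w)// (uG z w).
Qed.

Lemma polyfunB F G : polyfun F -> polyfun G ->
  polyfun (fun z w => F z w - G z w).
Proof.
move=> pF pG; apply: (polyfun_ext _ (polyfunD pF (polyfunM (polyfun_cst (-1)) pG))).
by move=> z w; rewrite mulN1r.
Qed.

Lemma polyfun_sum (T : Type) (r : seq T) (F : T -> (I -> k) -> (J -> k) -> k) :
  (forall i, polyfun (F i)) -> polyfun (fun z w => \sum_(i <- r) F i z w).
Proof.
move=> pF; elim: r => [|i r IHr].
  by apply: polyfun_ext (polyfun_cst 0) => z w; rewrite big_nil.
by apply: polyfun_ext (polyfunD (pF i) IHr) => z w; rewrite big_cons.
Qed.

Lemma polyfun_prod (T : Type) (r : seq T) (F : T -> (I -> k) -> (J -> k) -> k) :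
  (forall i, polyfun (F i)) -> polyfun (fun z w => \prod_(i <- r) F i z w).
Proof.
move=> pF; elim: r => [|i r IHr].
  by apply: polyfun_ext (polyfun_cst 1) => z w; rewrite big_nil.
by apply: polyfun_ext (polyfunM (pF i) IHr) => z w; rewrite big_cons.
Qed.

Lemma polyfunX F m : polyfun F -> polyfun (fun z w => F z w ^+ m).
Proof.
move=> pF; elim: m => [|m IHm].
  by apply: polyfun_ext (polyfun_cst 1) => z w; rewrite expr0.
by apply: polyfun_ext (polyfunM pF IHm) => z w; rewrite exprS.
Qed.

Lemma polyfun_meval d (p : {mpoly k[d]}) (F : 'I_d -> (I -> k) -> (J -> k) -> k) :
  (forall i, polyfun (F i)) -> polyfun (fun z w => p.@[fun i => F i z w]).
Proof.
move=> pF; apply: (@polyfun_ext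
    (fun z w => \sum_(m <- msupp p) p@_m * \prod_i F i z w ^+ m i)).
  by move=> z w; rewrite mevalE.
apply: polyfun_sum => m; apply/polyfunM; first exact: polyfun_cst.
by apply: polyfun_prod => i; exact: polyfunX.
Qed.

End PolynomialFunctions.

(** The free variables of the formula are the block indexed by [I]; the bound
    ones, indexed by [J], come after them. *)
Lemma quantifier_free_implication (k : closedFieldType) (I J R : finType)
    (F : R -> (I -> k) -> (J -> k) -> k) (G : (I -> k) -> (J -> k) -> k) :
  (forall r, polyfun (F r)) -> polyfun G ->
  exists f : GRing.formula k, [/\ GRing.qf_form f, GRing.rformula f &
    forall z e, (forall i : I, e`_(enum_rank i) = z i) ->
      (GRing.holds e f <-> forall w, (forall r, F r z w = 0) -> G z w = 0)].
Proof.
move=> pF [g rg gG].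
have /choice[t tF] : forall r, exists t : GRing.term k, GRing.rterm t /\
    forall z w e, environment z w e -> GRing.eval e t = F r z w.
  by move=> r; have [t rt tF] := pF r; exists t.
pose hyps (rs : seq R) := foldr (fun r f => GRing.And (GRing.Equal (t r) 0%T) f)
  (GRing.Bool true) rs.
pose body := GRing.Implies (hyps (enum R)) (GRing.Equal g 0%T).
pose f := foldr (@GRing.Forall k) body (iota #|I| #|J|).
have rhyps rs : GRing.rformula (hyps rs).
  by elim: rs => //= r rs ->; have [-> _] := tF r.
have rf : GRing.rformula f.
  rewrite /f; elim: (iota _ _) => [|i s IHs]//=.
  by rewrite rhyps rg.
have hypsP e rs : GRing.holds e (hyps rs) <->
    forall r, r \in rs -> GRing.eval e (t r) = 0.
  elim: rs => [|r rs IHrs]/=; first by [].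
  split=> [[tr /IHrs trs] r'|trs].
    by rewrite inE => /predU1P[->//|/trs].
  split; first by apply: trs; rewrite inE eqxx.
  by apply/IHrs => r' r'rs; apply: trs; rewrite inE r'rs orbT.
have fP z e : (forall i : I, e`_(enum_rank i) = z i) ->
    (GRing.holds e f <-> forall w, (forall r, F r z w = 0) -> G z w = 0).
  move=> ez; rewrite /f; split=> [/GRing.foldForallP fe w Fw|FG].
    pose v l := if (l < #|I|)%N then e`_l else
      if insub (l - #|I|)%N is Some j then w (enum_val (j : 'I_#|J|)) else e`_l.
    pose e' := mkseq v (maxn (size e) (#|I| + #|J|)).
    have e'v l : e'`_l = v l.
      have [ls|sl] := ltnP l (maxn (size e) (#|I| + #|J|)); first exact: nth_mkseq.
      rewrite nth_default ?size_mkseq//.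
      move: sl; rewrite geq_max => /andP[se sIJ].
      rewrite /v ltnNge (leq_trans (leq_addr _ _) sIJ) /=.
      by rewrite insubN ?nth_default// -leqNgt leq_subRL// (leq_trans (leq_addr _ _) sIJ).
    have env : environment z w e'.
      split=> [i|j]; rewrite e'v /v; first by rewrite ltn_ord ez.
      by rewrite ltnNge leq_addr /= addKn (valK (enum_rank j)) enum_rankK.
    have := fe e' _; rewrite /= (gG _ _ _ env); apply.
      move=> l; rewrite !inE mem_iota e'v /v => nl.
      case: (ltnP l #|I|) nl => // Il /=; rewrite -ltn_subLR// => nl.
      by rewrite insubN.
    by apply/hypsP => r _; have [_ /(_ _ _ _ env) ->] := tF r.
  apply/GRing.foldForallP => e' ee'.
  pose w (j : J) := e'`_(#|I| + enum_rank j).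
  have env : environment z w e'.
    split=> // i; rewrite -ee' ?ez// !inE mem_iota leqNgt ltn_ord.
    by [].
  move/hypsP => te'; rewrite /= (gG _ _ _ env); apply: FG => r.
  by have [_ /(_ _ _ _ env) <-] := tF r; apply: te'; rewrite mem_enum.
have wf := @ClosedFieldQE.wf_ex_elim k.
have ok := ClosedFieldQE.holds_ex_elim (@solve_monicpoly k).
exists (GRing.quantifier_elim (@ClosedFieldQE.ex_elim k) f).
have /andP[qf rf'] := GRing.quantifier_elim_wf wf rf.
split=> // z e ez; rewrite -fP//; split.
  by move/(GRing.qf_evalP e qf)/(GRing.quantifier_elim_rformP wf ok e rf).
by move/(GRing.quantifier_elim_rformP wf ok e rf)/(GRing.qf_evalP e qf).
Qed.

(** * Regular functions, morphisms and generic properties *)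

Lemma open_near (X : topologicalType) (V : set X) : (forall x, V x -> \forall y \near x, V y) -> open V.
Proof. by rewrite openE. Qed.

Lemma near_open (X : topologicalType) (V : set X) x : open V -> V x -> \forall y \near x, V y.
Proof. by rewrite openE; apply. Qed.

Section Regularity.
Context {k : fieldType} {X : funSpaceType k}.

Lemma regular_prod (x : X) (I : Type) (r : seq I) (F : I -> X -> k) :
  (forall i, regular_at x (F i)) -> regular_at x (fun y => \prod_(i <- r) F i y).
Proof.
move=> rF; elim: r => [|i r IHr].
  by apply: regular_eq _ (regular_cst x 1); apply: nearW => y; rewrite big_nil.
apply: regular_eq _ (regularM (rF i) IHr).
by apply: nearW => y; rewrite big_cons.
Qed.

Lemma regular_det (x : X) d (F : X -> 'M[k]_d) :
  (forall i j, regular_at x (fun y => F y i j)) ->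
  regular_at x (fun y => \det (F y)).
Proof.
move=> rF; rewrite /determinant; apply: regular_sum => s.
by apply: regularZ; apply: regular_prod.
Qed.

Lemma regular_invmx (x : X) d (F : X -> 'M[k]_d) i j :
  (forall i j, regular_at x (fun y => F y i j)) -> F x \in unitmx ->
  regular_at x (fun y => invmx (F y) i j).
Proof.
move=> rF uF; have dF : \det (F x) != 0 by rewrite -unitfE -unitmxE.
have rdet := regular_det rF.
have radj : regular_at x (fun y => \adj (F y) i j).
  apply: (@regular_eq _ _ _ (fun y => cofactor (F y) j i)).
    by apply: nearW => y; rewrite !mxE.
  rewrite /cofactor; apply/regularZ/regular_det => a b.
  by apply: regular_eq _ (rF _ _); apply: nearW => y; rewrite !mxE.
apply: regular_eq _ (regularM (regularV rdet dF) radj).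
have := regular_neq0 rdet dF; apply: filterS => y dy.
by rewrite /invmx unitmxE unitfE dy !mxE.
Qed.

Lemma regular_neq (x : X) (f g : X -> k) : regular_at x f -> regular_at x g ->
  f x != g x -> \forall y \near x, f y != g y.
Proof.
move=> rf rg fg; have := regularD rf (regularZ (-1) rg).
move=> /regular_neq0; rewrite mulN1r subr_eq0 => /(_ fg).
by apply: filterS => y; rewrite mulN1r subr_eq0.
Qed.

Lemma regular_mxM (x : X) a b c (F : X -> 'M[k]_(a, b)) (G : X -> 'M[k]_(b, c)) :
  (forall i j, regular_at x (fun y => F y i j)) ->
  (forall i j, regular_at x (fun y => G y i j)) ->
  forall i j, regular_at x (fun y => (F y *m G y) i j).
Proof.
move=> rF rG i j; apply: (@regular_eq _ _ _ (fun y => \sum_l F y i l * G y l j)).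
  by apply: nearW => y; rewrite mxE.
by apply: regular_sum => l; exact: regularM.
Qed.

End Regularity.

Section Morphisms.
Context {k : fieldType}.
Implicit Types X Y Z : funSpaceType k.

Lemma morphism_at_comp X Y Z (f : X -> Y) (g : Y -> Z) x :
  morphism_at f x -> morphism_at g (f x) -> morphism_at (g \o f) x.
Proof.
move=> [cf rf] [cg rg]; split; first exact: continuous_comp.
by move=> h /rg/rf.
Qed.

Lemma morphism_at_eq X Y (f g : X -> Y) x :
  (\forall y \near x, f y = g y) -> morphism_at f x -> morphism_at g x.
Proof.
move=> fg [cf rf]; have fgx : f x = g x := nbhs_singleton fg.
split=> [U gU|h]; last rewrite -fgx => /rf.
  by rewrite -fgx in gU; have := cf _ gU; apply: filterS2 fg => y /= ->.
apply: regular_eq.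
by apply: filterS fg => y /= ->.
Qed.

Lemma morphism_at_val X (S : set X) (x : S) : morphism_at (\val : S -> X) x.
Proof.
split; first exact: (@initial_continuous S X set_val x).
by move=> h rh; exists h => //; exact: (nearW (F := nbhs x)).
Qed.

Lemma morphism_at_sub X Y (S : set Y) (f : X -> S) x :
  morphism_at (\val \o f : X -> Y) x -> morphism_at f x.
Proof.
move=> [cf rf]; have cf' : {for x, continuous f}.
  move=> U [V [[W oW WV] fxV VU]]; rewrite -WV in fxV.
  have nW : \forall y \near x, W (\val (f y)) := cf W (near_open oW fxV).
  suff : \forall y \near x, U (f y) by [].
  by apply: filterS nW => y Wy; apply: VU; rewrite -WV.
split=> // g [h rh gh].
apply: regular_eq _ (rf h rh).
have ngh : \forall y \near x, g (f y) = h (\val (f y)) := cf' _ gh.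
by apply: filterS ngh => y /= ->.
Qed.

Lemma morphism_linear (V W : vectType k) (l : V -> W) (v : affine V) :
  (forall a u w, l (a *: u + w) = a *: l u + l w) ->
  morphism_at (l : affine V -> affine W) v.
Proof.
move=> ll; apply: morphism_at_affine => i; apply: regular_linear => a u w.
by rewrite ll linearD linearZ.
Qed.

End Morphisms.

Section GenericLogic.
Context {X : topologicalType}.

Lemma generic_all (I : finType) (P : I -> set X) :
  (forall i, generic (P i)) -> generic [set x | forall i, P i x].
Proof.
move=> gP; have : generic [set x | forall i, i \in enum I -> P i x].
  elim: (enum I) => [|i s IHs]; first by apply: genericT => x i; rewrite in_nil.
  apply: genericS2 (gP i) IHs => x Pi Ps j.
  by rewrite inE => /predU1P[->//|/Ps].
by apply: genericS => x Px i; apply: Px; rewrite mem_enum.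
Qed.

Lemma generic_seq (I : eqType) (s : seq I) (P : I -> set X) :
  (forall i, i \in s -> generic (P i)) ->
  generic [set x | forall i, i \in s -> P i x].
Proof.
elim: s => [|i s IHs] gP; first by apply: genericT => x i; rewrite in_nil.
apply: genericS2 (gP i _) (IHs _) => [x Pi Ps j||j js]; rewrite ?inE ?eqxx//.
  by move=> /predU1P[->//|/Ps].
by apply: gP; rewrite inE js orbT.
Qed.

End GenericLogic.

Section Values.
Context {k : fieldType} {n : nat} {X : irrPGLvariety k n.+1}.
Implicit Types f g h : rmaps X.

Definition rval f (x : X) : 'M[k]_n.+1 := reval f x.

Lemma rvalP f g : f = g <-> generic [set x | rval f x = rval g x].
Proof. exact: ratmapP. Qed.

Lemma rvalD f g : generic [set x | rval (f + g) x = rval f x + rval g x].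
Proof. exact: raddE. Qed.

Lemma rvalM f g : generic [set x | rval (f * g) x = rval f x *m rval g x].
Proof. exact: rmulE. Qed.

Lemma rvalZ c f : generic [set x | rval (c *: f) x = c *: rval f x].
Proof. exact: rscaleE. Qed.

Lemma rval1 : generic [set x | rval 1 x = 1%:M].
Proof. exact: rscalarE. Qed.

Lemma rval0 : generic [set x | rval 0 x = 0].
Proof. by apply: genericS (rvalZ 0 0) => x /=; rewrite !scale0r. Qed.

Lemma rvalC c : generic [set x | rval c%:A x = c%:M].
Proof.
by apply: genericS2 (rvalZ c 1) rval1 => x /= -> ->; rewrite scalemx1.
Qed.

Lemma rvalN f : generic [set x | rval (- f) x = - rval f x].
Proof. by apply: genericS (rvalZ (-1) f) => x /=; rewrite !scaleN1r. Qed.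

Lemma rval_sum (I : Type) (r : seq I) (F : I -> rmaps X) :
  generic [set x | rval (\sum_(i <- r) F i) x = \sum_(i <- r) rval (F i) x].
Proof.
elim: r => [|i r IHr].
  by apply: genericS rval0 => x /=; rewrite !big_nil.
apply: genericS2 (rvalD (F i) (\sum_(j <- r) F j)) IHr => x /=.
by rewrite !big_cons => -> ->.
Qed.

Lemma rval_regular f x i j : rdomain f x -> regular_at x (fun y => rval f y i j).
Proof. by move=> /rfun_morphism/morphism_at_mx. Qed.

Lemma rval_act f (g : PGL k n.+1) x : rdomain f x -> rdomain f (act g x) ->
  rval f (act g x) = PGLconj g (rval f x).
Proof. by move=> fx fgx; rewrite /rval /reval rfun_equivariant. Qed.

Lemma rdomain_open f : open (rdomain f).
Proof. exact: rdom_open. Qed.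

Lemma rdomain_generic f : generic (rdomain f).
Proof. exact: rdom_generic. Qed.

Lemma rmaps_intro (V : set X) (F : X -> 'M[k]_n.+1) : open V -> V !=set0 ->
  (forall x i j, V x -> regular_at x (fun y => F y i j)) ->
  (forall (g : PGL k n.+1) x, V x -> V (act g x) -> F (act g x) = PGLconj g (F x)) ->
  exists f, generic [set x | rval f x = F x].
Proof.
move=> oV V0 rF eF.
have dV : dense V by move=> O O0 oO; exact: (irr_irreducible X).2.
have mF x : V x -> morphism_at (F : X -> mx_space k n.+1) x.
  by move=> Vx; apply/morphism_at_mx => i j; exact: rF.
exists (to_ratmap (@RatRep _ _ X (mx_space k n.+1) V F oV dV mF eF)).
exact: (to_ratmapE (@RatRep _ _ X (mx_space k n.+1) V F oV dV mF eF)).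
Qed.

Lemma generic_meet (P Q : set X) : generic P -> generic Q -> P `&` Q !=set0.
Proof.
by move=> gP gQ; apply: generic_nonempty (irr_irreducible X) (genericI gP gQ).
Qed.

Lemma generic_open (V : set X) : (forall x, V x -> \forall y \near x, V y) ->
  V !=set0 -> generic V.
Proof.
by move=> oV V0; apply: irreducible_generic (irr_irreducible X) _ V0; exact: open_near.
Qed.

(** The values differ on an open set; if it were empty, they would agree on the
    common domain. *)
Lemma rval_neq f g : f != g -> generic [set x | rval f x != rval g x].
Proof.
move=> fg; pose V := [set x | [/\ rdomain f x, rdomain g x & rval f x != rval g x]].
apply: (@genericS _ V) => [x []//|]; apply: generic_open => [x [fx gx nfg]|].
  have [ij nij] : exists ij : 'I_n.+1 * 'I_n.+1, rval f x ij.1 ij.2 != rval g x ij.1 ij.2.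
    apply: contrapT => e; move/eqP: nfg; apply; apply/matrixP => i j.
    by apply: contrapT => /eqP nij; apply: e; exists (i, j).
  have := regular_neq (rval_regular ij.1 ij.2 fx) (rval_regular ij.1 ij.2 gx) nij.
  apply: filterS3 (near_open (rdomain_open f) fx) (near_open (rdomain_open g) gx).
  by move=> y fy gy ne; split=> //; apply: contraNneq ne => ->.
apply: contrapT => V0; move/eqP: fg; apply; apply/rvalP.
apply: genericS2 (rdomain_generic f) (rdomain_generic g) => x fx gx.
by apply: contrapT => /eqP ne; apply: V0; exists x.
Qed.

End Values.

(** * Bases of the matrix algebra and frames *)

Section Conjugation.
Context {k : fieldType} {n : nat}.
Implicit Types (g : PGL k n) (A B : 'M[k]_n).

Lemma PGLconj_linear g c A B :
  PGLconj g (c *: A + B) = c *: PGLconj g A + PGLconj g B.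
Proof. by rewrite /PGLconj mulmxDr mulmxDl -scalemxAr -scalemxAl. Qed.

Lemma PGLconj0 g : PGLconj g 0 = 0.
Proof. by rewrite /PGLconj mulmx0 mul0mx. Qed.

Lemma PGLconjZ g c A : PGLconj g (c *: A) = c *: PGLconj g A.
Proof. by rewrite -[X in PGLconj g X]addr0 PGLconj_linear PGLconj0 addr0. Qed.

Lemma PGLconj_sum g (I : Type) (r : seq I) (F : I -> 'M[k]_n) :
  PGLconj g (\sum_(i <- r) F i) = \sum_(i <- r) PGLconj g (F i).
Proof.
elim: r => [|i r IHr]; first by rewrite !big_nil PGLconj0.
by rewrite !big_cons -[F i in LHS]scale1r PGLconj_linear IHr scale1r.
Qed.

Lemma PGLconj_mul g A B : PGLconj g (A *m B) = PGLconj g A *m PGLconj g B.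
Proof. by rewrite /PGLconj !mulmxA mulmxKV ?PGLmx_unit. Qed.

Lemma PGLconj_scalar g c : PGLconj g c%:M = c%:M.
Proof. by rewrite /PGLconj scalar_mxC -mulmxA mulmxV ?mulmx1// PGLmx_unit. Qed.

Lemma PGLconj_unitmx g A : (PGLconj g A \in unitmx) = (A \in unitmx).
Proof. by rewrite /PGLconj !unitmx_mul unitmx_inv PGLmx_unit andbT. Qed.

Lemma PGLconj_invmx g A : A \in unitmx -> PGLconj g (invmx A) = invmx (PGLconj g A).
Proof.
move=> uA; have ugA : PGLconj g A \in unitmx by rewrite PGLconj_unitmx.
rewrite -[LHS](mulKmx ugA) -PGLconj_mul mulmxV// PGLconj_scalar.
by rewrite mulmx1.
Qed.

End Conjugation.

Section MatrixBasis.
Context {k : fieldType} {n : nat}.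
Local Notation N := (n.+1 * n.+1)%N.
Implicit Types B : 'I_N -> 'M[k]_n.+1.

Definition basis_mx B : 'M[k]_N := \matrix_i mxvec (B i).

Definition basis_coord B (M : 'M[k]_n.+1) (i : 'I_N) : k :=
  (mxvec M *m invmx (basis_mx B)) 0 i.

Lemma mul_basis_mx B (u : 'rV[k]_N) :
  u *m basis_mx B = mxvec (\sum_i u 0 i *: B i).
Proof.
rewrite mulmx_sum_row linear_sum; apply: eq_bigr => i _.
by rewrite rowK linearZ.
Qed.

Lemma basis_coordK B M : basis_mx B \in unitmx ->
  M = \sum_i basis_coord B M i *: B i.
Proof.
move=> uB; apply: (can_inj mxvecK).
by rewrite -mul_basis_mx mulmxKV.
Qed.

Lemma basis_coord_unique B (c : 'I_N -> k) i : basis_mx B \in unitmx ->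
  basis_coord B (\sum_i c i *: B i) i = c i.
Proof.
move=> uB; pose u : 'rV[k]_N := \row_i c i.
have -> : \sum_i c i *: B i = \sum_i u 0 i *: B i.
  by apply: eq_bigr => j _; rewrite mxE.
by rewrite /basis_coord -mul_basis_mx mulmxK// mxE.
Qed.

Lemma basis_free B (c : 'I_N -> k) : basis_mx B \in unitmx ->
  \sum_i c i *: B i = 0 -> forall i, c i = 0.
Proof.
move=> uB c0 i; rewrite -(basis_coord_unique c i uB) c0.
by rewrite /basis_coord linear0 mul0mx mxE.
Qed.

Lemma free_basis B :
  (forall c : 'I_N -> k, \sum_i c i *: B i = 0 -> forall i, c i = 0) ->
  basis_mx B \in unitmx.
Proof.
move=> fB; rewrite -row_free_unit -kermx_eq0.
apply/rowV0P => u /sub_kermxP; rewrite mul_basis_mx => /(canRL mxvecK).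
rewrite linear0 => u0; apply/rowP => i; rewrite mxE.
exact: (fB (u 0)).
Qed.

Lemma comm_basis_scalar B (M : 'M[k]_n.+1) : basis_mx B \in unitmx ->
  (forall i, M *m B i = B i *m M) -> M = (M 0 0)%:M.
Proof.
move=> uB MB; have MA A : M *m A = A *m M.
  rewrite (basis_coordK A uB) mulmx_sumr mulmx_suml; apply: eq_bigr => i _.
  by rewrite -scalemxAr -scalemxAl MB.
apply/matrixP => i j.
have := MA (delta_mx j 0) => /matrixP/(_ i 0).
rewrite !mxE (bigD1 j)//= big1 => [|l /negPf lj]; last first.
  by rewrite mxE lj mulr0.
rewrite mxE !eqxx mulr1 addr0 => ->.
rewrite (bigD1 0)//= big1 => [|l /negPf l0].
  by rewrite !mxE eqxx andbT addr0 mulr_natl.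
by rewrite mxE l0 andbF mul0r.
Qed.

Lemma PGLconj_coord B (g : PGL k n.+1) M i : basis_mx B \in unitmx ->
  basis_mx (PGLconj g \o B) \in unitmx ->
  basis_coord (PGLconj g \o B) (PGLconj g M) i = basis_coord B M i.
Proof.
move=> uB ugB; rewrite {1}(basis_coordK M uB) PGLconj_sum.
under eq_bigr do rewrite PGLconjZ.
exact: (@basis_coord_unique (PGLconj g \o B)).
Qed.

(** If [a] is the entry of [M] at [(i, j)], then
    [delta_mx r i *m M *m delta_mx j r] is [a] times [delta_mx r r]. *)
Lemma simple_mx (M : 'M[k]_n.+1) : M != 0 ->
  exists (u v : 'I_n.+1 -> 'M[k]_n.+1), \sum_i u i *m M *m v i = 1%:M.
Proof.
move=> M0; have [ij Mij] : exists ij : 'I_n.+1 * 'I_n.+1, M ij.1 ij.2 != 0.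
  apply: contrapT => e; move/eqP: M0; apply; apply/matrixP => i j; rewrite mxE.
  by apply: contrapT => /eqP nij; apply: e; exists (i, j).
exists (fun r => (M ij.1 ij.2)^-1 *: delta_mx r ij.1), (fun r => delta_mx ij.2 r).
rewrite mx1_sum_delta; apply: eq_bigr => r _.
rewrite -!scalemxAl; apply/matrixP => a b; rewrite !mxE (bigD1 ij.2)//= big1.
  rewrite !mxE addr0 (bigD1 ij.1)//= big1.
    rewrite !mxE !eqxx andbT addr0 /=.
    case: (a == r); case: (b == r); rewrite ?(mul1r, mulr1, mul0r, mulr0)//.
    exact: mulVf.
  by move=> l /negPf ll; rewrite mxE ll andbF mul0r.
by move=> l /negPf ll; rewrite [X in _ * X]mxE ll mulr0.
Qed.

End MatrixBasis.

Section Frames.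
Context {k : fieldType} {n : nat} {X : irrPGLvariety k n.+1}.
Local Notation A := (rmaps X).
Local Notation N := (n.+1 * n.+1)%N.
Implicit Types (f g h z : A) (b : 'I_N -> A).

(** Meaningful for maps whose values are scalar matrices. *)
Definition scalar_value z : X -> k := fun x => rval z x 0 0.

Definition scalar_valued z : Prop :=
  generic [set x | rval z x = (scalar_value z x)%:M].

(** The values of [b] form a basis of the matrix algebra at a generic point. *)
Definition frame b : Prop :=
  generic [set x | basis_mx (fun i => rval (b i) x) \in unitmx].

Lemma scalar_valued_centre z : scalar_valued z -> centre z.
Proof.
move=> sz f; apply/rvalP; apply: genericS3 (rvalM z f) (rvalM f z) sz.
by move=> x /= -> -> ->; rewrite scalar_mxC.
Qed.

Lemma basis_mx_regular b x i j : (forall i, rdomain (b i) x) ->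
  regular_at x (fun y => basis_mx (fun l => rval (b l) y) i j).
Proof.
move=> bx; case/mxvec_indexP: j => r t.
by apply: regular_eq _ (rval_regular r t (bx i)); apply: nearW => y; rewrite mxE mxvecE.
Qed.

Section WithFrame.
Variable b : 'I_N -> A.
Hypothesis fb : frame b.

Lemma frame_commute_scalar_valued z :
  (forall i, z * b i = b i * z) -> scalar_valued z.
Proof.
move=> cz.
have gzb := generic_all (fun i => rvalM z (b i)).
have gbz := generic_all (fun i => rvalM (b i) z).
apply: genericS3 fb gzb gbz => x ux zb bz.
apply: (comm_basis_scalar ux) => i.
by rewrite -zb -bz cz.
Qed.

Lemma frame_scalar_valued z : centre z -> scalar_valued z.
Proof. by move=> cz; apply: frame_commute_scalar_valued => i; exact: cz. Qed.

Lemma frame_free (c : 'I_N -> A) : (forall i, centre (c i)) ->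
  \sum_i c i * b i = 0 -> forall i, c i = 0.
Proof.
move=> cc c0 i; apply/rvalP.
have gs := generic_all (fun i => frame_scalar_valued (cc i)).
have gm := generic_all (fun i => rvalM (c i) (b i)).
apply: genericS3 (genericI gs gm) (genericI fb (rval_sum (index_enum _) (fun i => c i * b i))) rval0.
move=> x [/= sx mx] [ux]; rewrite /= c0 => + r0; rewrite r0 => e0.
rewrite sx (@basis_free _ _ (fun i => rval (b i) x) (fun i => scalar_value (c i) x))//.
  by rewrite raddf0.
rewrite [RHS]e0; apply: eq_bigr => j _.
by rewrite mx sx mul_scalar_mx.
Qed.

(** The coordinates are regular where the frame is a basis, and invariant
    because conjugation carries the basis at [x] to the basis at [act g x]. *)
Lemma frame_coords f : exists c : 'I_N -> A,
  [/\ forall i, centre (c i), f = \sum_i c i * b i &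
   generic [set x | forall i, rval (c i) x =
     (basis_coord (fun j => rval (b j) x) (rval f x) i)%:M]].
Proof.
have [W [oW dW Wb]] := fb.
have gbd := generic_all (fun i => rdomain_generic (b i)).
have [V [oV dV Vb]] := genericI (genericI fb gbd) (rdomain_generic f).
have V0 : V !=set0.
  by apply: generic_nonempty (irr_irreducible X) _; exists V; split.
pose c i x := (basis_coord (fun j => rval (b j) x) (rval f x) i)%:M : 'M[k]_n.+1.
have /choice[C CE] : forall i, exists h, generic [set x | rval h x = c i x].
  move=> i; apply: (rmaps_intro oV V0) => [x r t /Vb[[ux bx] fx]|a x /Vb[[ux bx] fx] /Vb[[uax bax] fax]].
    apply: (@regular_eq _ _ _ (fun y =>
      basis_coord (fun j => rval (b j) y) (rval f y) i * (r == t)%:R)).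
      by apply: nearW => y; rewrite mxE mulr_natr.
    apply: regularM _ (regular_cst _ _); apply: regular_mxM => u v.
      case/mxvec_indexP: v => v w.
      by apply: regular_eq _ (rval_regular v w fx); apply: nearW => y; rewrite (ord1 u) mxvecE.
    apply: regular_invmx ux => u' v'; exact: basis_mx_regular.
  have eb : (fun j => rval (b j) (act a x)) = PGLconj a \o (fun j => rval (b j) x).
    by apply/funext => j /=; rewrite rval_act.
  rewrite /c PGLconj_scalar; congr (_%:M).
  have uax' := uax; rewrite /= eb in uax'.
  by rewrite eb rval_act// PGLconj_coord.
have sC i : scalar_valued (C i).
  by apply: genericS (CE i) => x; rewrite /scalar_value /c /= => ->; rewrite mxE eqxx.
have gC := generic_all CE.
exists C; split=> [i||//]; first exact: scalar_valued_centre.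
apply/rvalP.
have gm := generic_all (fun i => rvalM (C i) (b i)).
apply: genericS3 (genericI gC gm) fb (rval_sum (index_enum _) (fun i => C i * b i)).
move=> x [/= Cx mx] ux ->; rewrite {1}(basis_coordK (rval f x) ux).
by apply: eq_bigr => i _; rewrite mx Cx mul_scalar_mx.
Qed.

Lemma frame_has_degree : has_degree A n.+1.
Proof.
exists b => a; have [c [cc ac _]] := frame_coords a.
exists [ffun i => c i]; split=> [|c' [cc' ac']].
  split=> [i|]; first by rewrite ffunE.
  by rewrite ac; apply: eq_bigr => i _; rewrite ffunE.
apply/ffunP => i; rewrite ffunE; apply/eqP; rewrite -subr_eq0; apply/eqP.
apply: (@frame_free (fun i => c i - c' i)) => [j x|].
  by rewrite mulrBl mulrBr cc cc'.
under eq_bigr do rewrite mulrBl.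
by rewrite sumrB -ac (_ : \sum_i c' i * b i = a) ?subrr.
Qed.

End WithFrame.

Lemma rmaps_inverse f x : rdomain f x -> rval f x \in unitmx ->
  exists h, f * h = 1 /\ h * f = 1.
Proof.
move=> fx ux; pose V := [set y | rdomain f y /\ rval f y \in unitmx].
have nV y : V y -> \forall z \near y, V z.
  move=> [fy uy]; have rdet := regular_det (fun i j => rval_regular i j fy).
  have := regular_neq0 rdet; rewrite -unitfE -unitmxE => /(_ uy).
  by apply: filterS2 (near_open (rdomain_open f) fy) => z fz; rewrite -unitfE -unitmxE.
have V0 : V !=set0 by exists x.
have [|g y [fy uy] [fgy ugy]|h hE] := @rmaps_intro _ _ X V (fun y => invmx (rval f y)) (open_near nV) V0.
- move=> y i j [fy uy]; apply: regular_invmx uy => r t; exact: rval_regular.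
- by rewrite rval_act// PGLconj_invmx.
have gV := generic_open nV V0.
exists h; split; apply/rvalP.
  apply: genericS3 (rvalM f h) (genericI hE gV) rval1 => y /= -> [-> [_ uy]] ->.
  by rewrite mulmxV.
apply: genericS3 (rvalM h f) (genericI hE gV) rval1 => y /= -> [-> [_ uy]] ->.
by rewrite mulVmx.
Qed.

(** Let [f] be in the ideal, with [f x] nonzero. The identity matrix is
    [\sum_i u i *m f x *m v i]; replacing [u i] and [v i] by the combinations of the frame
    with the same values at [x] gives an element of the ideal with value [1] at
    [x], hence invertible. *)
Lemma frame_simple b : frame b -> simple_algebra A.
Proof.
move=> fb I I0 ID IM.
have [[f [If f0]]|nI] := pselect (exists f, I f /\ f != 0); last first.
  by left=> x Ix; apply: contrapT => /eqP x0; apply: nI; exists x.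
have gb := generic_all (fun i => rdomain_generic (b i)).
right; have [x [[ux bx] [[nfx dfx] x0]]] := generic_meet (genericI fb gb)
  (genericI (genericI (rval_neq f0) (rdomain_generic f)) rval0).
have {}nfx : rval f x != 0 by rewrite -x0.
have [u [v uv1]] := simple_mx nfx.
pose cu i j := basis_coord (fun i => rval (b i) x) (u i) j.
pose cv i j := basis_coord (fun i => rval (b i) x) (v i) j.
pose lc (c : 'I_N -> k) := \sum_j c j *: b j.
pose lcv (c : 'I_N -> k) y := \sum_j c j *: rval (b j) y.
pose h := \sum_i lc (cu i) * f * lc (cv i).
pose s y := \sum_i lcv (cu i) y *m rval f y *m lcv (cv i) y.
have Ih : I h.
  rewrite /h; elim/big_rec: _ => // i y _ Iy; apply: ID => //.
  by apply: (IM _ _ _).2; apply: (IM _ _ _).1.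
have hE : generic [set y | rval h y = s y].
  have glc c : generic [set y | rval (lc c) y = lcv c y].
    apply: genericS2 (rval_sum (index_enum _) (fun j => c j *: b j))
      (generic_all (fun j => rvalZ (c j) (b j))) => y /= -> cb.
    by apply: eq_bigr => j _; rewrite cb.
  apply: genericS2 (genericI
      (rval_sum (index_enum _) (fun i => lc (cu i) * f * lc (cv i)))
      (generic_all (fun i => rvalM (lc (cu i) * f) (lc (cv i)))))
    (genericI (generic_all (fun i => rvalM (lc (cu i)) f))
      (genericI (generic_all (fun i => glc (cu i))) (generic_all (fun i => glc (cv i))))).
  move=> y /= [-> e1] [e2 [e3 e4]]; apply: eq_bigr => i _.
  by rewrite e1 e2 e3 e4.
have sx : s x = 1%:M.
  rewrite -uv1; apply: eq_bigr => i _.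
  by rewrite [u i](basis_coordK _ ux) [v i](basis_coordK _ ux).
have gs : generic [set y | s y \in unitmx].
  pose V := [set y | [/\ forall i, rdomain (b i) y, rdomain f y & s y \in unitmx]].
  apply: (@genericS _ V) => [y []//|]; apply: generic_open; last first.
    by exists x; split=> //; rewrite sx unitmx1.
  move=> y [by_ fy uy].
  have rlc c i j : regular_at y (fun w => lcv c w i j).
    apply: (@regular_eq _ _ _ (fun w => \sum_l c l * rval (b l) w i j)).
      by apply: nearW => w; rewrite summxE; apply: eq_bigr => l _; rewrite mxE.
    by apply: regular_sum => l; apply/regularZ/rval_regular.
  have rs i j : regular_at y (fun w => s w i j).
    apply: (@regular_eq _ _ _ (fun w =>
        \sum_l (lcv (cu l) w *m rval f w *m lcv (cv l) w) i j)).
      by apply: nearW => w; rewrite summxE.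
    apply: regular_sum => l; apply: regular_mxM => // i' j'.
    by apply: regular_mxM => // i'' j''; exact: rval_regular.
  have nb : \forall w \near y, forall i, rdomain (b i) w.
    by apply: filter_forall => i; exact: near_open (rdomain_open (b i)) (by_ i).
  have := regular_neq0 (regular_det rs); rewrite -unitfE -unitmxE => /(_ uy).
  apply: filterS3 nb (near_open (rdomain_open f) fy) => w bw fw dw.
  by split=> //; rewrite unitmxE unitfE.
have [y [[hy sy] dy]] := generic_meet (genericI hE gs) (rdomain_generic h).
have [|g [hg _]] := rmaps_inverse dy; first by rewrite hy.
by move=> t; rewrite -[t]mul1r -hg -mulrA; apply: (IM _ _ _).2.
Qed.

Lemma centre_subfield b : frame b -> central_subfield (@centre k A).
Proof.
move=> fb; split=> // [c x|x y cx cy|z cz z0].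
- by rewrite -scalerAl -scalerAr mul1r mulr1.
- split=> t; first by rewrite mulrBl mulrBr cx cy.
  by rewrite -mulrA cy mulrA cx -mulrA.
have sz := frame_scalar_valued fb cz.
have [x [[zx dz] [sx x0]]] := generic_meet (genericI (rval_neq z0) (rdomain_generic z)) (genericI sz rval0).
have [|h [zh hz]] := rmaps_inverse dz.
  rewrite sx unitmxE det_scalar unitrX// unitfE.
  by apply: contra_neq zx => zx; rewrite sx zx raddf0 x0.
exists h => // t.
by rewrite -[LHS]mulr1 -zh mulrA -(mulrA h t z) -cz (mulrA h) hz mul1r.
Qed.

End Frames.

(** * Generating tuples and rational maps to n-varieties *)

Section Words.
Context {k : fieldType} {m n : nat}.
Local Notation N := (n.+1 * n.+1)%N.
Local Notation tuple := {ffun 'I_m -> 'M[k]_n.+1}.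

Definition word_prod (R : pzRingType) (s : 'I_m -> R) (w : seq 'I_m) : R :=
  \prod_(i <- w) s i.

Definition generates (s : tuple) : Prop := @generating_tuples k m n.+1 s.

(** A linearly independent family of words of maximal length spans a subalgebra
    that contains the generators. *)
Lemma generating_words (s : tuple) : generates s ->
  exists w : 'I_N -> seq 'I_m, basis_mx (fun i => word_prod s (w i)) \in unitmx.
Proof.
move=> gs; pose W ws := [seq (word_prod s w : 'M[k]_n.+1) | w <- ws].
pose P r := `[< exists ws, size ws = r /\ free (W ws) >].
have dimM : \dim {: 'M[k]_n.+1} = N by rewrite dimvf.
have P0 : exists r, P r.
  by exists 0; apply/asboolP; exists [::]; rewrite nil_free.
have Pb r : P r -> (r <= N)%N.
  move=> /asboolP[ws [<- fws]]; rewrite -dimM -(size_map (word_prod s) ws).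
  by move: fws; rewrite /free => /eqP <-; exact/dimvS/subvf.
have [r /asboolP[ws [sws fws]] rmax] := ex_maxnP P0 Pb.
have Wspan w : (word_prod s w : 'M[k]_n.+1) \in <<W ws>>%VS.
  apply: contraT => nw; have : P r.+1.
    by apply/asboolP; exists (w :: ws); rewrite /= sws free_cons nw.
  by move=> /rmax; rewrite ltnn.
have sW : size (W ws) = size ws by rewrite size_map.
have all_span A : A \in <<W ws>>%VS.
  apply: (gs [set A | A \in <<W ws>>%VS]) => /=.
  - by have := Wspan [::]; rewrite /word_prod big_nil.
  - by move=> c B C BW CW; apply: memvD => //; exact: memvZ.
  - move=> B C BW CW; rewrite (coord_span (X := in_tuple _) BW) (coord_span (X := in_tuple _) CW).
    rewrite mulmx_suml; apply: memv_suml => i _; rewrite mulmx_sumr.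
    apply: memv_suml => j _; rewrite -scalemxAl -scalemxAr.
    apply: memvZ; apply: memvZ; rewrite /= !(nth_map [::]) ?size_map//; last first.
    + by rewrite -sW ltn_ord.
    + by rewrite -sW ltn_ord.
    set w1 := nth _ _ _; set w2 := nth _ _ _.
    have -> : word_prod s w1 *m word_prod s w2 = word_prod s (w1 ++ w2).
      by rewrite /word_prod big_cat.
    exact: Wspan.
  - by move=> i; have := Wspan [:: i]; rewrite /word_prod big_seq1.
have szN : size ws = N.
  move: fws; rewrite /free size_map => /eqP <-.
  rewrite -dimM; congr (\dim _); apply/eqP; rewrite eqEsubv subvf.
  by apply/subvP => A _.
exists (fun i => nth [::] ws i); apply: free_basis => c c0 i.
have szW : size (W ws) == N by rewrite sW szN.
move: fws; rewrite -[W ws]/(tval (Tuple szW)) => /freeP; apply.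
rewrite -[RHS]c0; apply: eq_bigr => j _; congr (_ *: _).
by rewrite /= (nth_map [::])// szN.
Qed.

Lemma words_generate (s : tuple) (w : 'I_N -> seq 'I_m) :
  basis_mx (fun i => word_prod s (w i)) \in unitmx -> generates s.
Proof.
move=> uw B B1 BL BM Bs A.
have B0 : B 0 by have := BL (-1) _ _ B1 B1; rewrite scaleN1r addNr.
rewrite (basis_coordK A uw); elim/big_rec: _ => // i C _ BC.
apply: BL => //; elim: (w i) => [|j v IHv]; first by rewrite /word_prod big_nil.
by rewrite /word_prod big_cons; apply: BM.
Qed.

End Words.

Lemma tuple_actE (k : fieldType) m n (g : PGL k n) (s : {ffun 'I_m -> 'M[k]_n}) i :
  (tuple_act g s : {ffun 'I_m -> 'M[k]_n}) i = PGLconj g (s i).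
Proof. exact: ffunE. Qed.

Lemma coord_tuple (k : fieldType) m n
    (l : 'I_(\dim {: {ffun 'I_m -> 'M[k]_n}})) :
  exists e : 'I_m * ('I_n * 'I_n) -> k, forall s : {ffun 'I_m -> 'M[k]_n},
    coord (vbasis fullv) l s = \sum_a e a * s a.1 a.2.1 a.2.2.
Proof.
pose d (a : 'I_m * ('I_n * 'I_n)) : {ffun 'I_m -> 'M[k]_n} :=
  [ffun i => if i == a.1 then delta_mx a.2.1 a.2.2 else 0].
exists (fun a => coord (vbasis fullv) l (d a)) => s.
have {1}-> : s = \sum_a s a.1 a.2.1 a.2.2 *: d a.
  apply/ffunP => i; rewrite sum_ffunE.
  under eq_bigr do rewrite !ffunE.
  rewrite -(pair_bigA _ (fun j b => s j b.1 b.2 *: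
     (if i == j then delta_mx b.1 b.2 else 0))) /=.
  rewrite (bigD1 i)//= [X in _ + X]big1 ?addr0 => [|j /negPf ji]; last first.
    by apply: big1 => b _; rewrite eq_sym ji scaler0.
  rewrite -(pair_bigA _ (fun r t => s i r t *:
     (if i == i then delta_mx r t else 0))) /= eqxx.
  exact: matrix_sum_delta.
by rewrite linear_sum; apply: eq_bigr => a _; rewrite linearZ mulrC.
Qed.

Section Translation.
Context {k : fieldType} {n : nat} (X : irrPGLvariety k n).

(** The action is a morphism on the product with the group, restricted here to
    the slice of [g]. *)
Lemma act_continuous (g : PGL k n) : continuous (act g : X -> X).
Proof.
move=> x; have [_ /(_ (g, x))[cact _]] := irr_variety X.
move=> U gU; have [V [W [h [nV nW th hx hU]]]] := cact U gU.
have /= rh : regular_at x (fun y => h (g, y)).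
  elim: th => [f1 f2 rf1 rf2|s t _ IHs _ IHt] /=; last exact: regularD.
  exact: regularZ.
suff : \forall y \near x, U (act g y) by [].
apply: filterS2 nW (regular_neq0 rh hx) => y Wy hy.
exact: (hU (g, y)) (nbhs_singleton nV) Wy hy.
Qed.

Lemma generic_translate (g : PGL k n) (P : set X) :
  generic P -> generic [set x | P (act g x)].
Proof.
move=> gP; have [x0 _] := generic_nonempty (irr_irreducible X) gP.
have [W [oW dW WP]] := gP.
apply: (@genericS _ [set x | W (act g x)]) => [x /WP //|].
apply: irreducible_generic (irr_irreducible X) _ _.
  by apply: open_near => x Wx; exact: act_continuous (near_open oW Wx).
have [y Wy] : W !=set0 by have [y [_ Wy]] := dW setT (ex_intro _ x0 I) openT; exists y.
by exists (act g^-1%g y); rewrite /= -actM mulgV act1.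
Qed.

End Translation.

Section RationalTuples.
Context {k : fieldType} {n m : nat} {X : irrPGLvariety k n.+1}.
Variable S : nvariety k m n.+1.
Local Notation N := (n.+1 * n.+1)%N.
Local Notation tuple := {ffun 'I_m -> 'M[k]_n.+1}.

Definition coords_of (s : nv_space S) : tuple := \val s.

Lemma coords_of_inj : injective coords_of.
Proof. exact: val_inj. Qed.

Lemma coords_ofP s : nv_set S (coords_of s).
Proof. exact: set_mem (valP s). Qed.

Lemma coords_of_generates s : generates (coords_of s).
Proof. by have [C _ SC] := nv_closed S; have := coords_ofP s; rewrite SC => -[]. Qed.

Lemma coords_of_act g s : coords_of (act g s) = tuple_act g (coords_of s).
Proof. by []. Qed.

Definition rtuple (p : 'I_m -> rmaps X) (x : X) : tuple := [ffun i => rval (p i) x].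

Lemma rtuple_act p (g : PGL k n.+1) x : (forall i, rdomain (p i) x) ->
  (forall i, rdomain (p i) (act g x)) ->
  rtuple p (act g x) = tuple_act g (rtuple p x).
Proof. by move=> px pgx; apply/ffunP => i; rewrite !ffunE rval_act. Qed.

Lemma rtuple_morphism p x : (forall i, rdomain (p i) x) ->
  morphism_at (rtuple p : X -> tuple_space k m n.+1) x.
Proof.
move=> px; apply: morphism_at_affine => l; have [e eE] := coord_tuple l.
apply: (@regular_eq _ _ _ (fun y => \sum_a e a * rval (p a.1) y a.2.1 a.2.2)).
  by apply: nearW => y; rewrite eE; apply: eq_bigr => a _; rewrite ffunE.
by apply: regular_sum => a; apply/regularZ/rval_regular.
Qed.

Lemma ratmap_components (phi : ratmap X (nv_space S)) :
  exists p : 'I_m -> rmaps X,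
    generic [set x | rtuple p x = coords_of (reval phi x)].
Proof.
have V0 : rdomain phi !=set0.
  exact: generic_nonempty (irr_irreducible X) (rdom_generic (of_ratmap phi)).
have oV : open (rdomain phi) by exact: rdom_open.
have /choice[p pE] : forall i, exists f : rmaps X,
    generic [set x | rval f x = coords_of (reval phi x) i].
  move=> i; apply: (rmaps_intro oV V0) => [x r t phix|g x phix phigx].
    pose ev (s : tuple_space k m n.+1) : affine 'M[k]_n.+1 := (s : tuple) i.
    have : morphism_at (ev \o (\val : nv_space S -> tuple_space k m n.+1) \o reval phi) x.
      apply: morphism_at_comp (rfun_morphism phix) _.
      apply: morphism_at_comp (morphism_at_val _) _.
      by apply: morphism_linear => a u w; rewrite /ev !ffunE.
    by move/morphism_at_mx; apply.
  have -> : reval phi (act g x) = act g (reval phi x) by exact: rfun_equivariant.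
  by rewrite coords_of_act tuple_actE.
exists p; apply: genericS (generic_all pE) => x px.
by apply/ffunP => i; rewrite ffunE px.
Qed.

Lemma ratmap_of_tuple (p : 'I_m -> rmaps X) :
  generic [set x | nv_set S (rtuple p x)] ->
  exists phi : ratmap X (nv_space S),
    generic [set x | coords_of (reval phi x) = rtuple p x].
Proof.
move=> gS; have gd := generic_all (fun i => rdomain_generic (p i)).
have [V [oV dV VS]] := genericI gS gd.
have [x0 [S0 _]] := generic_meet gS gd.
pose F x : nv_space S := match pselect (nv_set S (rtuple p x)) with
  | left Sx => exist _ (rtuple p x) (mem_set Sx)
  | right _ => exist _ (rtuple p x0) (mem_set S0)
  end.
have FE x : V x -> coords_of (F x) = rtuple p x.
  by move=> /VS[Sx _]; rewrite /F; case: pselect.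
have mF x : V x -> morphism_at F x.
  move=> Vx; apply: morphism_at_sub; have [_ px] := VS x Vx.
  apply: morphism_at_eq (rtuple_morphism px).
  by apply: filterS (near_open oV Vx) => y /FE.
have eF g x : V x -> V (act g x) -> F (act g x) = act g (F x).
  move=> Vx Vgx; apply: coords_of_inj; rewrite coords_of_act !FE//.
  by apply: rtuple_act; [have [] := VS x Vx|have [] := VS _ Vgx].
exists (to_ratmap (@RatRep _ _ X (nv_space S) V F oV dV mF eF)).
have gV : generic V by exists V; split.
apply: genericS2 (to_ratmapE (@RatRep _ _ X (nv_space S) V F oV dV mF eF)) gV.
by move=> x /= -> /FE.
Qed.

Lemma rval_word (p : 'I_m -> rmaps X) w :
  generic [set x | rval (word_prod p w) x = word_prod (rtuple p x) w].
Proof.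
elim: w => [|i w IHw].
  by apply: genericS rval1 => x /=; rewrite /word_prod !big_nil.
apply: genericS2 (rvalM (p i) (word_prod p w)) IHw => x /=.
by rewrite /word_prod !big_cons ffunE => -> ->.
Qed.

(** Words that give a basis at one point give one in a neighbourhood. *)
Lemma word_frame (p : 'I_m -> rmaps X) x : (forall i, rdomain (p i) x) ->
  generates (rtuple p x) ->
  exists w : 'I_N -> seq 'I_m, frame (fun i => word_prod p (w i)).
Proof.
move=> px /generating_words[w uw]; exists w.
have rp y i j r : (forall i, rdomain (p i) y) ->
    regular_at y (fun z => word_prod (rtuple p z) r i j).
  move=> py; elim: r i j => [|l r IHr] i j.
    apply: regular_eq _ (regular_cst y ((i == j)%:R)).
    by apply: nearW => z; rewrite /word_prod big_nil mxE.
  apply: (@regular_eq _ _ _ (fun z => (rval (p l) z *m word_prod (rtuple p z) r) i j)).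
    by apply: nearW => z; rewrite /word_prod big_cons ffunE.
  by apply: regular_mxM => // i' j'; exact: rval_regular.
pose V := [set y | (forall i, rdomain (p i) y) /\
  basis_mx (fun i => word_prod (rtuple p y) (w i)) \in unitmx].
have gV : generic V.
  apply: generic_open; last by exists x.
  move=> y [py uy].
  have rb i j : regular_at y (fun z => basis_mx (fun i => word_prod (rtuple p z) (w i)) i j).
    case/mxvec_indexP: j => r t; apply: regular_eq _ (rp y r t (w i) py).
    by apply: nearW => z; rewrite mxE mxvecE.
  have np : \forall z \near y, forall i, rdomain (p i) z.
    by apply: filter_forall => i; exact: near_open (rdomain_open (p i)) (py i).
  have := regular_neq0 (regular_det rb); rewrite -unitfE -unitmxE => /(_ uy).
  by apply: filterS2 np => z pz dz; split=> //; rewrite unitmxE unitfE.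
apply: genericS2 gV (generic_all (fun i => rval_word p (w i))) => y [_ uy] wy.
rewrite /=; have -> // : (fun i => rval (word_prod p (w i)) y) =
    (fun i => word_prod (rtuple p y) (w i)).
exact/funext.
Qed.

End RationalTuples.

(** * Birational models and central simplicity *)

Section Dominance.
Context {k : fieldType} {n : nat}.

Lemma dominant_open (X : irrPGLvariety k n) (Y : PGLspace k n) (f : ratmap X Y)
    (O : set Y) : dominant f -> open O -> O !=set0 ->
  generic [set x | rdomain f x /\ O (reval f x)].
Proof.
move=> df oO O0; apply: irreducible_generic (irr_irreducible X) _ _.
  apply: open_near => x [fx Ofx]; have [cf _] := rfun_morphism fx.
  have nO : \forall y \near x, O (reval f y) := cf O (near_open oO Ofx).
  by apply: filterS2 (near_open (rdom_open _) fx) nO.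
by have [z [Oz [x fx xz]]] := df O O0 oO; exists x; split=> //; rewrite xz.
Qed.

Lemma right_inverse_dominant (X Y : PGLspace k n) (f : ratmap X Y) (g : ratmap Y X) :
  generic [set y | [/\ rdomain g y, rdomain f (reval g y) & reval f (reval g y) = y]] ->
  dominant f.
Proof.
move=> [W [oW dW Wfg]] O O0 oO; have [y [Oy /Wfg[_ fgy e]]] := dW O O0 oO.
by exists y; split=> //; exists (reval g y).
Qed.

End Dominance.

(** A birational model of [X] in a space of generating tuples, the
    equivariant rational maps [chart_tuple] that are its components, and words in them
    that form a basis of the matrix algebra at a generic point. *)
Record chart {k : fieldType} {n : nat} (X : irrPGLvariety k n.+1) := Chart {
  chart_dim : nat;
  chart_var : nvariety k chart_dim n.+1;
  chart_map : ratmap X (nv_space chart_var);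
  chart_inv : ratmap (nv_space chart_var) X;
  chart_tuple : 'I_chart_dim -> rmaps X;
  chart_words : 'I_(n.+1 * n.+1) -> seq 'I_chart_dim;
  chart_mapK : generic [set x | [/\ rdomain chart_map x,
    rdomain chart_inv (reval chart_map x) &
    reval chart_inv (reval chart_map x) = x]];
  chart_invK : generic [set s | [/\ rdomain chart_inv s,
    rdomain chart_map (reval chart_inv s) &
    reval chart_map (reval chart_inv s) = s]];
  chart_tupleE : generic [set x |
    rtuple chart_tuple x = coords_of (reval chart_map x)];
  chart_frame : frame (fun i => word_prod chart_tuple (chart_words i))
}.

Arguments chart_map {k n X} c.
Arguments chart_inv {k n X} c.
Arguments chart_tuple {k n X} c.
Arguments chart_words {k n X} c.
Arguments chart_mapK {k n X} c.
Arguments chart_invK {k n X} c.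
Arguments chart_tupleE {k n X} c.
Arguments chart_frame {k n X} c.

Lemma E_chart (k : fieldType) n (X : E_obj k n.+1) : exists c : chart X, True.
Proof.
have [m [S [phi [psi [phiK psiK]]]]] := E_birational X.
have [p pE] := ratmap_components phi.
have gd := generic_all (fun i => rdomain_generic (p i)).
have [x [px dx]] := generic_meet pE gd.
have [|w fw] := word_frame dx.
  by rewrite px; exact: coords_of_generates.
by exists (Chart phiK psiK pE fw).
Qed.

Section ChartTheory.
Context {k : fieldType} {n : nat} {X : irrPGLvariety k n.+1} (c : chart X).
Local Notation A := (rmaps X).
Local Notation tuple := {ffun 'I_(chart_dim c) -> 'M[k]_n.+1}.
Local Notation D := (\dim {: tuple}).
Local Notation tup := (rtuple (chart_tuple c)).

Lemma chart_map_dominant : dominant (chart_map c).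
Proof. exact: right_inverse_dominant (chart_invK c). Qed.

Lemma chart_inv_dominant : dominant (chart_inv c).
Proof. exact: right_inverse_dominant (chart_mapK c). Qed.

(** Regular functions on an open part of the model are quotients of polynomials
    in the coordinates. *)
Lemma rational_expression (f : A) : exists p q : {mpoly k[D]},
  generic [set x | polyval q (tup x) != 0 /\
    scalar_value f x * polyval q (tup x) = polyval p (tup x)].
Proof.
set phi := chart_map c; set psi := chart_inv c.
have [x0 [[phix psix Kx] fx]] := generic_meet (chart_mapK c) (rdomain_generic f).
have : regular_at (reval phi x0) (fun s => scalar_value f (reval psi s)).
  have [_ rpsi] := rfun_morphism psix; apply: (rpsi (scalar_value f)).
  rewrite -/(reval psi _) Kx; exact: rval_regular.
move=> [h [p [q [q0 hE]]] hf]; exists p, q.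
have nO := @morphism_at_val _ _ _ (reval phi x0).
pose O : set (nv_space (chart_var c)) := [set s |
  polyval q (\val s) != 0 /\
  scalar_value f (reval psi s) = polyval p (\val s) / polyval q (\val s)].
have : \forall s \near reval phi x0, O s.
  have hE' : \forall s \near reval phi x0, h (\val s) = polyval p (\val s) / polyval q (\val s).
    exact: nO.1 _ hE.
  have q0' : \forall s \near reval phi x0, polyval q (\val s) != 0.
    exact: nO.1 _ (near_polyval q0).
  by apply: filterS3 hf hE' q0' => s e1 e2 e3; split=> //; rewrite e1.
rewrite /prop_near1 nbhsE => -[U [oU Ux] UO].
have := dominant_open chart_map_dominant oU (ex_intro _ _ Ux).
apply: genericS3 (chart_mapK c) (chart_tupleE c) => x [phx psx e] tx [_ /UO].
rewrite /O /= -/phi -/psi; move: e; rewrite -/phi -/psi => -> [qx fE].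
have tE : tup x = \val (reval phi x) by exact: tx.
by rewrite tE; split=> //; rewrite fE mulfVK.
Qed.

Local Notation coordinate := (fun x (i : 'I_D) => coord (vbasis {: tuple}) i (tup x)).

(** The value at the coordinates of [x] of the polynomial whose coefficients are
    the values at [x] of those of [P]. *)
Definition relation_value (P : {mpoly A[D]}) (x : X) : k :=
  \sum_(m <- msupp P) scalar_value P@_m x * mmap1 (coordinate x) m.

Lemma scalar_value0 : generic [set x : X | scalar_value 0 x = 0].
Proof. by apply: genericS (@rval0 _ _ X) => x; rewrite /scalar_value /= => ->; rewrite mxE. Qed.

(** Values are added termwise over a support common to the polynomials. *)
Lemma relation_value_ext (P : {mpoly A[D]}) (s : seq 'X_{1..D}) x :
  scalar_value (0 : A) x = 0 -> uniq s -> {subset msupp P <= s} ->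
  relation_value P x = \sum_(m <- s) scalar_value P@_m x * mmap1 (coordinate x) m.
Proof.
move=> z0 us Ps; rewrite (bigID (fun m => m \in msupp P))/= [X in _ + X]big1 ?addr0.
  rewrite -big_filter; apply: perm_big; apply: uniq_perm => [||m].
  - exact: msupp_uniq.
  - exact: filter_uniq.
  by rewrite mem_filter; case: (boolP (m \in msupp P)) => // /Ps ->.
by move=> m; rewrite -mcoeff_eq0 => /eqP ->; rewrite z0 mul0r.
Qed.

Lemma relation_valueMX (P : {mpoly A[D]}) m x :
  relation_value (P * 'X_[m]) x = relation_value P x * mmap1 (coordinate x) m.
Proof.
rewrite /relation_value (perm_big _ (msuppMX P m)) big_map mulr_suml.
apply: eq_bigr => j _; rewrite mcoeffMX.
rewrite commr_mmap1_M; last by move=> i y; exact: mulrC.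
by rewrite -mulrA [in RHS](mulrC (mmap1 _ j)).
Qed.

Lemma relation_valueD (P Q : {mpoly A[D]}) (z : A) : scalar_valued z ->
  generic [set x | relation_value (P + z *: Q) x =
    relation_value P x + scalar_value z x * relation_value Q x].
Proof.
move=> sz; pose s := undup (msupp P ++ msupp Q).
have gs := generic_seq (s := s) (fun m _ => rvalD P@_m (z * Q@_m)).
have gm := generic_seq (s := s) (fun m _ => rvalM z Q@_m).
apply: genericS3 (genericI gs gm) sz scalar_value0 => x [/= ex mx] zx z0.
rewrite !(@relation_value_ext _ s x z0) ?undup_uniq//.
- rewrite mulr_sumr -big_split /= !big_seq; apply: eq_bigr => m ms.
  rewrite mcoeffD mcoeffZ mulrA -mulrDl; congr (_ * _).
  by rewrite /scalar_value ex// mxE mx// zx mul_scalar_mx !mxE eqxx.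
- by move=> m mQ; rewrite mem_undup mem_cat mQ orbT.
- by move=> m mP; rewrite mem_undup mem_cat mP.
move=> m /msuppD_le; rewrite mem_undup !mem_cat => /orP[->//|/msuppZ_le ->].
by rewrite orbT.
Qed.

Lemma relation_value_lift (p : {mpoly k[D]}) : exists P : {mpoly A[D]},
  coefs_in (range (fun a : k => a%:A)) P /\
  generic [set x | relation_value P x = polyval p (tup x)].
Proof.
exists (map_mpoly (in_alg A) p); split.
  by move=> m; rewrite mcoeff_map_mpoly; exists p@_m.
have gc := generic_seq (s := msupp p) (fun m _ => @rvalC _ _ X p@_m).
apply: genericS gc => x /= cx.
rewrite /relation_value (perm_big _ (msupp_map_mpoly _ (fmorph_inj _))) /polyval mevalE.
rewrite !big_seq; apply: eq_bigr => m mp.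
by rewrite mcoeff_map_mpoly /scalar_value /= cx// mxE eqxx.
Qed.

(** Take for [J] the relations between the coordinates of the generic point of the
    model: an element of the centre is a quotient [p / q] in these coordinates,
    with [p] and [q] over [k]. *)
Lemma chart_fg_centre : fg_centre A.
Proof.
have fb := chart_frame c; have cA := centre_subfield fb.
pose J : set {mpoly A[D]} := [set P | generic [set x | relation_value P x = 0]].
apply: (@fg_centre_groebner _ _ _ J) => //.
- by apply: genericT => x; rewrite /= /relation_value (eqP (_ : msupp 0 == [::])) ?msupp_eq0 ?big_nil.
- move=> P Q z m JP JQ cz.
  have := relation_valueD P (Q * 'X_[m]) (frame_scalar_valued fb cz).
  apply: genericS3 JP JQ => x /= Px Qx ->.
  by rewrite relation_valueMX Px Qx mul0r mulr0 addr0.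
move=> f cf; have [p [q pq]] := rational_expression f.
have [P [kP PE]] := relation_value_lift p.
have [Q [kQ QE]] := relation_value_lift q.
exists P, Q; split=> // [|JQ].
  have cNf : centre (- f) by move=> y; rewrite mulNr mulrN cf.
  have gD := relation_valueD P Q (frame_scalar_valued fb cNf).
  rewrite /J /= -scaleNr; apply: genericS3 (genericI gD (rvalN f)) (genericI PE QE) pq.
  move=> x [/= -> fx] [/= -> ->] [_ <-].
  by rewrite /scalar_value fx mxE mulNr subrr.
have [x [[[qx _] eq] q0]] := generic_meet (genericI pq QE) JQ.
by move: qx; rewrite -eq q0 eqxx.
Qed.

Lemma chart_is_CS : is_CS A n.+1.
Proof.
have fb := chart_frame c.
by split; [exact: frame_simple fb|exact: frame_has_degree fb|exact: chart_fg_centre].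
Qed.

End ChartTheory.

Arguments chart_map_dominant {k n X} c.
Arguments chart_inv_dominant {k n X} c.

(** * Homomorphisms between algebras of rational maps *)

Lemma simple_hom_injective (k : fieldType) (A B : algType k)
    (alpha : {lrmorphism A -> B}) : simple_algebra A -> injective alpha.
Proof.
move=> sA; have ker0 a : alpha a = 0 -> a = 0.
  have [|x y|x y /= y0|K0|K1] := sA [set a | alpha a = 0].
  - exact: rmorph0.
  - by move=> /= x0 y0; rewrite rmorphD /= x0 y0 addr0.
  - by rewrite !rmorphM /= y0 mulr0 mul0r.
  - exact: K0.
  by have /eqP := K1 1; rewrite rmorph1 oner_eq0.
move=> a b ab; apply/eqP; rewrite -subr_eq0; apply/eqP/ker0.
by rewrite rmorphB /= ab subrr.
Qed.

Section Homomorphisms.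
Context {k : fieldType} {n : nat} {X Y : irrPGLvariety k n.+1}.
Variable alpha : {lrmorphism rmaps Y -> rmaps X}.
Local Notation N := (n.+1 * n.+1)%N.
Variable b : 'I_N -> rmaps Y.
Hypothesis fb : frame b.

(** The density lemma gives operators [sum_j u_j * _ * v_j] dual to [b]. Their
    images under [alpha], evaluated at a generic point [x], are dual to the values
    of [alpha (b i)], which are thus linearly independent. *)
Lemma hom_frame : frame (fun i => alpha (b i)).
Proof.
pose a l := oapp b 0 (insub l : option 'I_N).
have aE (i : 'I_N) : a i = b i by rewrite /a valK.
have fa : centre_free N a.
  move=> c cc c0 i iN; apply: (frame_free fb (c := c) _ _ (Ordinal iN)) => //.
  by rewrite -[RHS]c0; apply: eq_bigr => j _; rewrite aE.
have [T [oT Ta]] := simple_density (frame_simple fb) fa.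
have /choice[s sT] : forall l : 'I_N, exists s, forall x, T l x = bimul s x.
  by move=> l; exact: oT.
have dual (l i : 'I_N) : bimul (s l) (b i) = (i == l)%:R.
  by rewrite -sT -aE Ta.
pose as_ l := [seq (alpha p.1, alpha p.2) | p <- s l].
have gdual (l i : 'I_N) : generic [set x |
    \sum_(p <- as_ l) rval p.1 x *m rval (alpha (b i)) x *m rval p.2 x =
    ((i == l)%:R : k)%:M].
  have e : \sum_(p <- as_ l) p.1 * alpha (b i) * p.2 = ((i == l)%:R : k)%:A.
    rewrite big_map scaler_nat -(rmorph_nat alpha) -dual /bimul rmorph_sum.
    by apply: eq_bigr => p _; rewrite !rmorphM.
  have gm := generic_seq (s := as_ l) (fun p _ => genericI
    (rvalM (p.1 * alpha (b i)) p.2) (rvalM p.1 (alpha (b i)))).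
  apply: genericS3 gm (rval_sum (as_ l) (fun p => p.1 * alpha (b i) * p.2)) (rvalC (i == l)%:R).
  move=> x /= mx; rewrite e => -> <-; rewrite !big_seq; apply: eq_bigr => p pl.
  by have [-> ->] := mx p pl.
apply: genericS (generic_all (fun l => generic_all (gdual l))) => x dx.
apply: free_basis => c c0 l.
have : \sum_(p <- as_ l) rval p.1 x *m (\sum_i c i *: rval (alpha (b i)) x) *m rval p.2 x = (c l)%:M.
  have dualc i : \sum_(p <- as_ l) rval p.1 x *m (c i *: rval (alpha (b i)) x) *m rval p.2 x =
      (c i * (i == l)%:R)%:M.
    rewrite -scale_scalar_mx -dx scaler_sumr; apply: eq_bigr => p _.
    by rewrite -scalemxAr -scalemxAl.
  under eq_bigr do rewrite mulmx_sumr mulmx_suml.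
  rewrite exchange_big /= (bigD1 l)//= [X in _ + X]big1 => [|i /negPf il].
    by rewrite dualc eqxx mulr1 addr0.
  by rewrite dualc il mulr0 raddf0.
rewrite c0 big1 => [|p _]; last by rewrite mulmx0 mul0mx.
by move=> /matrixP/(_ 0 0); rewrite !mxE eqxx.
Qed.

Lemma hom_scalar_valued z : centre z -> scalar_valued (alpha z).
Proof.
move=> cz; apply: (frame_commute_scalar_valued hom_frame) => i.
by rewrite -!rmorphM /= cz.
Qed.

End Homomorphisms.

Section TermValues.
Context {k : fieldType}.

(** The value at inverses is a default: only terms without inverses occur. *)
Fixpoint term_value (A : algType k) (zs : seq A) (t : GRing.term k) : A :=
  match t with
  | GRing.Var i => zs`_i
  | GRing.Const c => c%:A
  | GRing.NatConst l => l%:R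
  | GRing.Add t u => term_value zs t + term_value zs u
  | GRing.Opp t => - term_value zs t
  | GRing.NatMul t l => term_value zs t *+ l
  | GRing.Mul t u => term_value zs t * term_value zs u
  | GRing.Inv t => 0
  | GRing.Exp t l => term_value zs t ^+ l
  end.

Lemma term_value_morph (A B : algType k) (alpha : {lrmorphism A -> B}) zs t :
  alpha (term_value zs t) = term_value (map alpha zs) t.
Proof.
elim: t => /= [i|c|l|t IHt u IHu|t IHt|t IHt l|t IHt u IHu|t IHt|t IHt l].
- have [iz|zi] := ltnP i (size zs); first by rewrite (nth_map 0).
  by rewrite !nth_default ?size_map// rmorph0.
- by rewrite linearZ /= rmorph1.
- by rewrite rmorph_nat.
- by rewrite rmorphD /= IHt IHu.
- by rewrite rmorphN /= IHt.
- by rewrite rmorphMn /= IHt.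
- by rewrite rmorphM /= IHt IHu.
- by rewrite rmorph0.
- by rewrite rmorphXn /= IHt.
Qed.

Lemma rval_term n (X : irrPGLvariety k n.+1) (zs : seq (rmaps X)) t :
  (forall z, z \in zs -> scalar_valued z) -> GRing.rterm t ->
  generic [set x | rval (term_value zs t) x =
    (GRing.eval [seq scalar_value z x | z <- zs] t)%:M].
Proof.
move=> szs; elim: t => //= [i|c|l|t IHt u IHu|t IHt|t IHt l|t IHt u IHu|t IHt l] rt.
- have [iz|zi] := ltnP i (size zs); last first.
    by apply: genericS (@rval0 _ _ X) => x /= r0; rewrite !nth_default ?size_map// raddf0.
  by apply: genericS (szs _ (mem_nth 0 iz)) => x /= ->; rewrite (nth_map 0).
- exact: rvalC.
- by apply: genericS (@rvalC _ _ X l%:R) => x /=; rewrite scaler_nat.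
- have /andP[rt1 rt2] := rt.
  apply: genericS3 (rvalD (term_value zs t) (term_value zs u)) (IHt rt1) (IHu rt2).
  by move=> x /= -> -> ->; rewrite raddfD.
- by apply: genericS2 (rvalN (term_value zs t)) (IHt rt) => x /= -> ->; rewrite raddfN.
- apply: genericS3 (rvalZ l%:R (term_value zs t)) (IHt rt) (IHt rt) => x /=.
  by rewrite scaler_nat => -> -> _; rewrite scale_scalar_mx mulr_natl.
- have /andP[rt1 rt2] := rt.
  apply: genericS3 (rvalM (term_value zs t) (term_value zs u)) (IHt rt1) (IHu rt2).
  by move=> x /= -> -> ->; rewrite -scalar_mxM.
elim: l => [|l IHl].
  by apply: genericS (@rval1 _ _ X) => x /= r1; rewrite !expr0.
apply: genericS3 (rvalM (term_value zs t) (term_value zs t ^+ l)) (IHt rt) IHl.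
by move=> x /=; rewrite !exprS => -> -> ->; rewrite -scalar_mxM.
Qed.

End TermValues.

(** A polynomial relation holds generically between the elements of [zs] if and
    only if it holds between their images, since [alpha] is injective; otherwise it
    fails generically for both. This passes to Boolean combinations. *)
Lemma quantifier_free_transfer (k : fieldType) n (X Y : irrPGLvariety k n.+1)
    (alpha : {lrmorphism rmaps Y -> rmaps X}) (zs : seq (rmaps Y)) f :
  injective alpha -> (forall z, z \in zs -> scalar_valued z) ->
  (forall z, z \in zs -> scalar_valued (alpha z)) ->
  GRing.qf_form f -> GRing.rformula f ->
  let holdsY y := GRing.holds [seq scalar_value z y | z <- zs] f in
  let holdsX x := GRing.holds [seq scalar_value (alpha z) x | z <- zs] f in
  generic holdsY /\ generic holdsX \/
  generic (~` holdsY) /\ generic (~` holdsX).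
Proof.
move=> ia szs saz.
have saz' z : z \in map alpha zs -> scalar_valued z.
  by move=> /mapP[z' z's ->]; exact: saz.
elim: f => //=.
- by move=> [] _ _; [left|right]; split; apply: genericT.
- move=> t u _ /andP[rt ru]; pose d := term_value zs t - term_value zs u.
  have gY := genericI (rval_term szs rt) (rval_term szs ru).
  have gX := genericI (rval_term saz' rt) (rval_term saz' ru).
  have ad : alpha (term_value zs t) = term_value (map alpha zs) t by exact: term_value_morph.
  have ae : alpha (term_value zs u) = term_value (map alpha zs) u by exact: term_value_morph.
  have scalar_mxI (a b : k) : (a%:M = b%:M :> 'M_n.+1) -> a = b.
    by move=> /matrixP/(_ 0 0); rewrite !mxE eqxx.
  have [tu|tu] := eqVneq (term_value zs t) (term_value zs u); [left|right]; split.
  + by apply: genericS gY => y [/= + e]; rewrite tu e => /scalar_mxI.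
  + apply: genericS gX => x [/=]; rewrite -!map_comp -ad -ae tu => -> /scalar_mxI.
    by [].
  + apply: genericS2 gY (rval_neq tu) => y [/= -> ->]; apply: contra_neq_not.
    by move=> ->.
  + have atu : alpha (term_value zs t) != alpha (term_value zs u).
      by apply: contra_neq tu => /ia.
    apply: genericS2 gX (rval_neq atu) => x [/=]; rewrite ad ae -!map_comp => -> ->.
    by apply: contra_neq_not => ->.
- move=> f IHf g IHg /andP[qf qg] /andP[rf rg].
  have [[f1 f2]|[f1 f2]] := IHf qf rf; last first.
    by right; split; [apply: genericS f1|apply: genericS f2] => y nf [].
  have [[g1 g2]|[g1 g2]] := IHg qg rg; [left|right]; split.
  + exact: genericI.
  + exact: genericI.
  + by apply: genericS g1 => y ng [].
  + by apply: genericS g2 => y ng [].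
- move=> f IHf g IHg /andP[qf qg] /andP[rf rg].
  have [[f1 f2]|[f1 f2]] := IHf qf rf.
    by left; split; [apply: genericS f1|apply: genericS f2] => y; left.
  have [[g1 g2]|[g1 g2]] := IHg qg rg; [left|right]; split.
  + by apply: genericS g1 => y; right.
  + by apply: genericS g2 => y; right.
  + by apply: genericS2 f1 g1 => y nf ng [].
  + by apply: genericS2 f2 g2 => y nf ng [].
- move=> f IHf g IHg /andP[qf qg] /andP[rf rg].
  have [[g1 g2]|[g1 g2]] := IHg qg rg.
    by left; split; [apply: genericS g1|apply: genericS g2] => y gy _.
  have [[f1 f2]|[f1 f2]] := IHf qf rf; [right|left]; split.
  + by apply: genericS2 f1 g1 => y fy ng /(_ fy).
  + by apply: genericS2 f2 g2 => y fy ng /(_ fy).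
  + by apply: genericS f1 => y nf /nf.
  + by apply: genericS f2 => y nf /nf.
- move=> f IHf qf rf; have [[f1 f2]|[f1 f2]] := IHf qf rf; [right|left]; split.
  + by apply: genericS f1 => y fy /(_ fy).
  + by apply: genericS f2 => y fy /(_ fy).
  + by apply: genericS f1.
  + by apply: genericS f2.
Qed.

(** * Structure constants and conjugation *)

Section StructureConstants.
Context {k : closedFieldType} {m n : nat}.
Local Notation N := (n.+1 * n.+1)%N.
Local Notation tuple := {ffun 'I_m -> 'M[k]_n.+1}.
Local Notation D := (\dim {: tuple}).
Implicit Types (B : 'I_N -> 'M[k]_n.+1) (s : tuple).

(** Indices of the data: a scalar, the structure constants of a basis of the matrix
    algebra, and the coordinates of the identity and of the entries of a tuple. *)
Definition parameter : finType :=
  (unit + ('I_N * 'I_N * 'I_N) + 'I_N + ('I_m * 'I_N))%type.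
Definition entry : finType := ('I_N * ('I_n.+1 * 'I_n.+1))%type.
Definition relation : finType :=
  (('I_N * 'I_N * ('I_n.+1 * 'I_n.+1)) + ('I_n.+1 * 'I_n.+1))%type.

Section ParameterBlocks.
Variables (T : Type) (z : parameter -> T).
Definition par_scalar : T := z (inl (inl (inl tt))).
Definition par_mul (i j l : 'I_N) : T := z (inl (inl (inr (i, j, l)))).
Definition par_one (l : 'I_N) : T := z (inl (inr l)).
Definition par_tuple (i : 'I_m) (l : 'I_N) : T := z (inr (i, l)).
End ParameterBlocks.

Implicit Types (z : parameter -> k) (w : entry -> k).

Definition structure_constants z B : Prop :=
  (forall i j, B i *m B j = \sum_l par_mul z i j l *: B l) /\
  \sum_l par_one z l *: B l = 1%:M.

Definition tuple_of z B : tuple := [ffun i => \sum_l par_tuple z i l *: B l].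

Definition matrices w (l : 'I_N) : 'M[k]_n.+1 := \matrix_(r, t) w (l, (r, t)).

Definition relation_poly (r : relation) z w : k :=
  match r with
  | inl (i, j, rt) =>
    (matrices w i *m matrices w j - \sum_l par_mul z i j l *: matrices w l) rt.1 rt.2
  | inr rt => (\sum_l par_one z l *: matrices w l - 1%:M) rt.1 rt.2
  end.

Lemma relation_polyP z w :
  (forall r, relation_poly r z w = 0) <-> structure_constants z (matrices w).
Proof.
split=> [rw|[wM w1] [[[i j] rt]|rt] /=]; last 2 first.
- by rewrite wM subrr mxE.
- by rewrite w1 subrr mxE.
split=> [i j|]; apply/eqP; rewrite -subr_eq0; apply/eqP/matrixP => r t; rewrite [RHS]mxE.
  exact: (rw (inl (i, j, (r, t)))).
exact: (rw (inr (r, t))).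
Qed.

(** The linear map that sends [B] to [B'] is a unital endomorphism of the matrix
    algebra, hence a conjugation. *)
Lemma structure_constants_conj z B B' : basis_mx B \in unitmx ->
  structure_constants z B -> structure_constants z B' ->
  exists g : PGL k n.+1, forall l, B' l = PGLconj g (B l).
Proof.
move=> uB [BM B1] [BM' B1'].
pose tau M := \sum_l basis_coord B M l *: B' l.
have tauL c M M' : tau (c *: M + M') = c *: tau M + tau M'.
  rewrite /tau scaler_sumr -big_split; apply: eq_bigr => l _ /=.
  rewrite /basis_coord linearP /= mulmxDl -scalemxAl mxE [X in (X + _) *: _]mxE.
  by rewrite scalerDl scalerA.
have tau_comb (c : 'I_N -> k) : tau (\sum_l c l *: B l) = \sum_l c l *: B' l.
  by apply: eq_bigr => l _; rewrite basis_coord_unique.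
have tau1 : tau 1%:M = 1%:M by rewrite -[in LHS]B1 tau_comb B1'.
have tau0 : tau 0 = 0.
  by have := tauL (-1) 0 0; rewrite scaler0 addr0 scaleN1r addNr.
have tau_sum (c : 'I_N -> k) (F : 'I_N -> 'M[k]_n.+1) :
    tau (\sum_i c i *: F i) = \sum_i c i *: tau (F i).
  by elim/big_rec2: _ => [|i M M' _ <-]; rewrite ?tau0// tauL.
have tauM M M' : tau (M *m M') = tau M *m tau M'.
  rewrite (basis_coordK M uB) (basis_coordK M' uB) !tau_comb.
  set d := basis_coord B M; set d' := basis_coord B M'.
  have distr (F G : 'I_N -> 'M[k]_n.+1) :
      (\sum_i d i *: F i) *m (\sum_j d' j *: G j) =
      \sum_i d i *: \sum_j d' j *: (F i *m G j).
    rewrite mulmx_suml; apply: eq_bigr => i _; rewrite -scalemxAl mulmx_sumr.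
    by congr (_ *: _); apply: eq_bigr => j _; rewrite -scalemxAr.
  rewrite !distr tau_sum; apply: eq_bigr => i _; congr (_ *: _).
  rewrite tau_sum; apply: eq_bigr => j _; congr (_ *: _).
  by rewrite BM BM' tau_comb.
have [G uG Gtau] := skolem_noether tauL tauM tau1.
have uG' : invmx G \in unitmx by rewrite unitmx_inv.
exists (toPGL (mkGL uG')) => l; have [c c0 gE] := PGLmxP (mkGL uG').
rewrite (PGLconj_scale _ c0 uG' gE) invmxK -mulmxA Gtau mulKmx//.
rewrite /tau (bigD1 l)//= big1 => [|j /negPf jl].
  have -> : B l = \sum_i (i == l)%:R *: B i.
    by rewrite (bigD1 l)//= big1 ?eqxx ?scale1r ?addr0// => i /negPf ->; rewrite scale0r.
  by rewrite basis_coord_unique// eqxx scale1r addr0.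
have -> : B l = \sum_i (i == l)%:R *: B i.
  by rewrite (bigD1 l)//= big1 ?eqxx ?scale1r ?addr0// => i /negPf ->; rewrite scale0r.
by rewrite basis_coord_unique// jl scale0r.
Qed.

Variables p q : {mpoly k[D]}.

Definition conclusion_poly z w : k :=
  let s := tuple_of z (matrices w) in polyval p s - par_scalar z * polyval q s.

Lemma tuple_of_act g z B :
  tuple_act g (tuple_of z B) = tuple_of z (fun l => PGLconj g (B l)).
Proof.
apply/ffunP => i; rewrite tuple_actE !ffunE PGLconj_sum.
by apply: eq_bigr => l _; rewrite PGLconjZ.
Qed.

(** The solutions [w] of the relations are the conjugates of [B]. *)
Lemma conclusion_conj z B : basis_mx B \in unitmx -> structure_constants z B ->
  (forall w, (forall r, relation_poly r z w = 0) -> conclusion_poly z w = 0) <->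
  forall g : PGL k n.+1, polyval p (tuple_act g (tuple_of z B)) =
    par_scalar z * polyval q (tuple_act g (tuple_of z B)).
Proof.
move=> uB sB; split=> [concl g|conj w /relation_polyP sw].
  pose w (e : entry) := PGLconj g (B e.1) e.2.1 e.2.2.
  have wE : matrices w = fun l => PGLconj g (B l).
    by apply/funext => l; apply/matrixP => r t; rewrite mxE.
  have /concl : forall r, relation_poly r z w = 0.
    apply/relation_polyP; rewrite wE; have [BM B1] := sB; split=> [i j|].
      by rewrite -PGLconj_mul BM PGLconj_sum; apply: eq_bigr => l _; rewrite PGLconjZ.
    rewrite -[RHS](PGLconj_scalar g) -B1 PGLconj_sum.
    by apply: eq_bigr => l _; rewrite PGLconjZ.
  by rewrite /conclusion_poly wE -tuple_of_act => /eqP; rewrite subr_eq0 => /eqP.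
have [g gE] := structure_constants_conj uB sB sw.
have -> : conclusion_poly z w = polyval p (tuple_act g (tuple_of z B)) -
    par_scalar z * polyval q (tuple_act g (tuple_of z B)).
  by rewrite tuple_of_act -(_ : matrices w = fun l => PGLconj g (B l))//; apply/funext.
by rewrite conj subrr.
Qed.

Lemma polyfun_entries (F : (parameter -> k) -> (entry -> k) -> 'M[k]_n.+1)
    (c : 'I_N -> parameter) (r t : 'I_n.+1) :
  (forall z w, F z w = \sum_l z (c l) *: matrices w l) ->
  polyfun (fun z w => F z w r t).
Proof.
move=> FE; apply: (@polyfun_ext _ _ _ (fun z w => \sum_l z (c l) * w (l, (r, t)))).
  by move=> z w; rewrite FE summxE; apply: eq_bigr => l _; rewrite !mxE.
apply: polyfun_sum => l.
exact: polyfunM (polyfun_varl (c l)) (polyfun_varr (l, (r, t))).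
Qed.

Lemma polyfun_relation r : polyfun (relation_poly r).
Proof.
case: r => [[[i j] [r t]]|[r t]].
  apply: (@polyfun_ext _ _ _ (fun z w => (\sum_h w (i, (r, h)) * w (j, (h, t))) -
      (\sum_l par_mul z i j l *: matrices w l) r t)).
    move=> z w /=; rewrite !mxE; congr (_ - _).
    by apply: eq_bigr => h _; rewrite !mxE.
  apply: polyfunB; last exact: (polyfun_entries (c := fun l => inl (inl (inr (i, j, l))))).
  by apply: polyfun_sum => h; exact: polyfunM (polyfun_varr _) (polyfun_varr _).
apply: (@polyfun_ext _ _ _ (fun z w =>
    (\sum_l par_one z l *: matrices w l) r t - (r == t)%:R)).
  by move=> z w /=; rewrite !mxE.
apply: polyfunB (polyfun_cst _).
exact: (polyfun_entries (c := fun l => inl (inr l))).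
Qed.

Lemma polyfun_polyval (f : {mpoly k[D]}) :
  polyfun (fun z w => polyval f (tuple_of z (matrices w))).
Proof.
apply: polyfun_meval => l; have [e eE] := coord_tuple l.
apply: (@polyfun_ext _ _ _ (fun z w =>
    \sum_a e a * (tuple_of z (matrices w)) a.1 a.2.1 a.2.2)).
  by move=> z w; rewrite eE.
apply: polyfun_sum => a; apply: polyfunM (polyfun_cst _) _.
apply: (polyfun_entries (c := fun l => inr (a.1, l))) => z w.
by rewrite ffunE.
Qed.

Lemma polyfun_conclusion : polyfun conclusion_poly.
Proof.
apply: polyfunB (polyfun_polyval p) _.
exact: polyfunM (polyfun_varl (inl (inl (inl tt)) : parameter)) (polyfun_polyval q).
Qed.

End StructureConstants.

(** The condition says that every system of matrices with the structure
    constants of a frame gives a tuple on which [p = zeta q], which is a first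
    order condition on the constants. These are elements of the centre, so that
    the condition passes from [Y] to [X] and back by elimination of quantifiers. *)
Lemma conj_transfer (k : closedFieldType) m n (X Y : irrPGLvariety k n.+1)
    (alpha : {lrmorphism rmaps Y -> rmaps X}) (b : 'I_(n.+1 * n.+1) -> rmaps Y)
    (f : 'I_m -> rmaps Y) (zeta : rmaps Y)
    (p q : {mpoly k[\dim {: {ffun 'I_m -> 'M[k]_n.+1}}]}) :
  frame b -> centre zeta ->
  generic [set y | forall g : PGL k n.+1, polyval p (tuple_act g (rtuple f y)) =
    scalar_value zeta y * polyval q (tuple_act g (rtuple f y))] <->
  generic [set x | forall g : PGL k n.+1,
    polyval p (tuple_act g (rtuple (alpha \o f) x)) =
    scalar_value (alpha zeta) x * polyval q (tuple_act g (rtuple (alpha \o f) x))].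
Proof.
move=> fb cz.
have /choice[cM cME] : forall ij : 'I_(n.+1 * n.+1) * 'I_(n.+1 * n.+1),
    exists c : 'I_(n.+1 * n.+1) -> rmaps Y,
    (forall l, centre (c l)) /\ b ij.1 * b ij.2 = \sum_l c l * b l.
  by move=> ij; have [c [cc cE _]] := frame_coords fb (b ij.1 * b ij.2); exists c.
have [c1 [cc1 c1E _]] := frame_coords fb 1.
have /choice[cf cfE] : forall i, exists c : 'I_(n.+1 * n.+1) -> rmaps Y,
    (forall l, centre (c l)) /\ f i = \sum_l c l * b l.
  by move=> i; have [c [cc cE _]] := frame_coords fb (f i); exists c.
pose zp (i : parameter) : rmaps Y := match i with
  | inl (inl (inl _)) => zeta
  | inl (inl (inr ijl)) => cM ijl.1 ijl.2
  | inl (inr l) => c1 l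
  | inr il => cf il.1 il.2
  end.
have czp i : centre (zp i).
  by case: i => [[[_|[ij l]]|l]|[i l]] //=; [apply: (cME ij).1|apply: (cfE i).1].
have [F [qF rF FP]] := quantifier_free_implication
  (@polyfun_relation k m n) (@polyfun_conclusion k m n p q).
pose zs := [seq zp i | i <- enum parameter].
have fa : frame (fun i => alpha (b i)) := hom_frame alpha fb.
pose good (V : irrPGLvariety k n.+1) (h : rmaps Y -> rmaps V) :=
  generic [set v | forall g : PGL k n.+1,
    polyval p (tuple_act g (rtuple (h \o f) v)) =
    scalar_value (h zeta) v * polyval q (tuple_act g (rtuple (h \o f) v))].
have goodE (V : irrPGLvariety k n.+1) (h : {lrmorphism rmaps Y -> rmaps V}) :
    frame (fun i => h (b i)) -> (forall z, centre z -> scalar_valued (h z)) ->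
    generic [set v |
      GRing.holds [seq scalar_value (h z) v | z <- zs] F <->
      forall g : PGL k n.+1, polyval p (tuple_act g (rtuple (h \o f) v)) =
      scalar_value (h zeta) v * polyval q (tuple_act g (rtuple (h \o f) v))].
  move=> fhb sh.
  have comb_value (c : 'I_(n.+1 * n.+1) -> rmaps Y) y :
      (forall l, centre (c l)) -> y = \sum_l c l * b l ->
      generic [set v | rval (h y) v =
        \sum_l scalar_value (h (c l)) v *: rval (h (b l)) v].
    move=> cc ->; rewrite rmorph_sum /=.
    apply: genericS3 (rval_sum (index_enum _) (fun l => h (c l * b l)))
      (generic_all (fun l => rvalM (h (c l)) (h (b l))))
      (generic_all (fun l => sh _ (cc l))) => v /= -> hM hs.
    apply: eq_bigr => l _; rewrite rmorphM hM hs.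
    by rewrite mul_scalar_mx; congr (_ *: _); rewrite /scalar_value mxE eqxx.
  have gM := generic_all (fun ij => comb_value _ _ (cME ij).1 (cME ij).2).
  have gMM := generic_all (fun ij : 'I_(n.+1 * n.+1) * 'I_(n.+1 * n.+1) =>
    rvalM (h (b ij.1)) (h (b ij.2))).
  have g1 := comb_value _ _ cc1 c1E.
  have gf := generic_all (fun i => comb_value _ _ (cfE i).1 (cfE i).2).
  apply: genericS3 (genericI gM gMM) (genericI g1 (@rval1 _ _ V)) (genericI gf fhb).
  move=> v [/= vM vMM] [v1 vone] [/= vf uv].
  pose B l := rval (h (b l)) v; pose z i := scalar_value (h (zp i)) v.
  have sB : structure_constants z B.
    split=> [i j|]; last by rewrite -vone -(rmorph1 h) v1.
    by have /= := vM (i, j); rewrite rmorphM /= (vMM (i, j)).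
  have tB : rtuple (h \o f) v = tuple_of z B.
    by apply/ffunP => i; rewrite !ffunE /= vf.
  rewrite tB -(conclusion_conj p q uv sB).
  apply: FP => i; rewrite /zs -map_comp (nth_map i) /= ?nth_enum_rank//.
  by rewrite -cardE ltn_ord.
have gX := goodE X alpha fa (fun z cz => hom_scalar_valued alpha fb cz).
have gY := goodE Y (idfun : {lrmorphism rmaps Y -> rmaps Y}) fb
  (fun z cz => frame_scalar_valued fb cz).
have zsP z : z \in zs -> centre z by move=> /mapP[i _ ->].
have tr := quantifier_free_transfer (simple_hom_injective (frame_simple fb))
  (fun z zz => frame_scalar_valued fb (zsP z zz))
  (fun z zz => hom_scalar_valued alpha fb (zsP z zz)) qF rF.
case: tr => -[tY tX]; split=> H.
- by apply: genericS2 gX tX => x /= [].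
- by apply: genericS2 gY tY => y /= [].
- have [y [[e ny] hy]] := generic_meet (genericI gY tY) H.
  by case: ny; apply/e.
have [x [[e nx] hx]] := generic_meet (genericI gX tX) H.
by case: nx; apply/e.
Qed.

(** * Pullback along a dominant rational map *)

Section Pullback.
Context {k : fieldType} {n : nat} {X Y : irrPGLvariety k n.+1}.
Variables (f : ratmap X Y) (df : dominant f).

Definition pullback_map (g : rmaps Y) : rmaps X :=
  ratcomp (irr_irreducible X) g df.

Lemma pullback_mapE g :
  generic [set x | rval (pullback_map g) x = rval g (reval f x)].
Proof. exact: (ratcompE (irr_irreducible X) g df). Qed.

Lemma generic_pullback (P : set Y) : generic P -> generic [set x | P (reval f x)].
Proof. exact: dominant_generic (irr_irreducible X) df. Qed.

Let pullback_linear : linear pullback_map.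
Proof.
move=> a g h; apply/rvalP.
apply: genericS3 (genericI (pullback_mapE (a *: g + h)) (genericI (pullback_mapE g) (pullback_mapE h)))
  (generic_pullback (genericI (rvalD (a *: g) h) (rvalZ a g)))
  (genericI (rvalD (a *: pullback_map g) (pullback_map h)) (rvalZ a (pullback_map g))).
by move=> x /= [-> [e1 e2]] [-> ->] [-> ->]; rewrite e1 e2.
Qed.

Let pullback_monoid : monoid_morphism pullback_map.
Proof.
split=> [|g h]; apply/rvalP.
  apply: genericS3 (pullback_mapE 1) (generic_pullback (@rval1 _ _ Y)) (@rval1 _ _ X).
  by move=> x /= -> -> ->.
apply: genericS3 (genericI (pullback_mapE (g * h)) (genericI (pullback_mapE g) (pullback_mapE h)))
  (generic_pullback (rvalM g h)) (rvalM (pullback_map g) (pullback_map h)).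
by move=> x /= [-> [e1 e2]] -> ->; rewrite e1 e2.
Qed.

HB.instance Definition _ := GRing.isLinear.Build k (rmaps Y) (rmaps X) _
  pullback_map pullback_linear.
HB.instance Definition _ := GRing.isMonoidMorphism.Build (rmaps Y) (rmaps X)
  pullback_map pullback_monoid.

Definition pullback_hom : {lrmorphism rmaps Y -> rmaps X} := pullback_map.

End Pullback.

(** The components of a birational model of [Y] are recovered from the
    pullback. *)
Lemma pullback_faithful (k : fieldType) n (X Y : irrPGLvariety k n.+1)
    (f f' : ratmap X Y) (df : dominant f) (df' : dominant f') : chart Y ->
  pullback_map df =1 pullback_map df' -> f = f'.
Proof.
move=> c ff'; apply/ratmapP.
have ge : generic [set x | forall i, rval (chart_tuple c i) (reval f x) =
    rval (chart_tuple c i) (reval f' x)].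
  apply: generic_all => i.
  apply: genericS2 (pullback_mapE df (chart_tuple c i)) (pullback_mapE df' (chart_tuple c i)).
  by move=> x /= <- <-; rewrite ff'.
apply: genericS3 ge
  (genericI (generic_pullback df (chart_tupleE c)) (generic_pullback df' (chart_tupleE c)))
  (genericI (generic_pullback df (chart_mapK c)) (generic_pullback df' (chart_mapK c))).
move=> x /= ex [tx t'x] [[_ _ <-] [_ _ <-]]; congr (reval _ _).
apply: coords_of_inj; rewrite -tx -t'x.
by apply/ffunP => i; rewrite !ffunE.
Qed.

(** * Fullness *)

Section ZariskiTopology.
Context {k : fieldType} {V : vectType k}.

Lemma regular_polyval (v : affine V) p : regular_at v (polyval p : affine V -> k).
Proof.
exists p, 1; rewrite /polyval meval1 oner_eq0; split=> //.
by apply: (nearW (F := nbhs v)) => w; rewrite meval1 divr1.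
Qed.

Lemma open_polyval (O : set (affine V)) v : open O -> O v ->
  exists2 p, polyval p v != 0 & forall w, polyval p w != 0 -> O w.
Proof.
move=> [P ->] /existsNP[p /not_implyP[Pp /eqP pv]].
by exists p => // w /eqP pw; apply/existsNP; exists p => /(_ Pp).
Qed.

End ZariskiTopology.

Section TupleRegularity.
Context {k : fieldType} {m n : nat}.
Local Notation tuple := {ffun 'I_m -> 'M[k]_n.+1}.

Lemma tuple_act_morphism (g : PGL k n.+1) (s : tuple_space k m n.+1) :
  morphism_at (tuple_act g : tuple_space k m n.+1 -> tuple_space k m n.+1) s.
Proof.
apply: (@morphism_linear _ tuple tuple (fun s => tuple_act g s)) => a u w.
by apply/ffunP => i; rewrite !(tuple_actE, ffunE) PGLconj_linear.
Qed.

Lemma regular_polyval_act (X : funSpaceType k) (F : X -> tuple_space k m n.+1) x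
    (g : PGL k n.+1) p :
  morphism_at F x -> regular_at x (fun y => polyval p (tuple_act g (F y))).
Proof.
move=> mF; have [_ r] := morphism_at_comp mF (tuple_act_morphism g (F x)).
exact: r (polyval p) (regular_polyval _ _).
Qed.

Lemma tuple_act1 (s : tuple) : tuple_act 1%g s = s.
Proof. exact: (@act1 _ _ (tuple_space k m n.+1)). Qed.

End TupleRegularity.

Section Fullness.
Context {k : closedFieldType} {n : nat} {X Y : irrPGLvariety k n.+1}.
Variables (c : chart Y) (alpha : {lrmorphism rmaps Y -> rmaps X}).
Local Notation tuple := {ffun 'I_(chart_dim c) -> 'M[k]_n.+1}.
Local Notation D := (\dim {: tuple}).
Local Notation S := (chart_var c).
Local Notation tup := (rtuple (chart_tuple c)).
Local Notation theta := (rtuple (alpha \o chart_tuple c)).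
Implicit Types p q : {mpoly k[D]}.

Let fb := chart_frame c.

(** The case [zeta = 0] and [q = 0] of the transfer. *)
Lemma conj_transfer0 p :
  generic [set y | forall g : PGL k n.+1, polyval p (tuple_act g (tup y)) = 0] <->
  generic [set x | forall g : PGL k n.+1, polyval p (tuple_act g (theta x)) = 0].
Proof.
have c0 : centre (0 : rmaps Y) by move=> y; rewrite mul0r mulr0.
have q0 s : polyval (0 : {mpoly k[D]}) s = 0 by rewrite /polyval meval0.
have tr := conj_transfer alpha (chart_tuple c) p 0 fb c0.
split=> H.
  have /tr : generic [set y | forall g : PGL k n.+1, polyval p (tuple_act g (tup y)) =
      scalar_value (0 : rmaps Y) y * polyval 0 (tuple_act g (tup y))].
    by apply: genericS H => y H g; rewrite H q0 mulr0.
  by apply: genericS => x H' g; rewrite H' q0 mulr0.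
have /tr : generic [set x | forall g : PGL k n.+1, polyval p (tuple_act g (theta x)) =
    scalar_value (alpha 0) x * polyval 0 (tuple_act g (theta x))].
  by apply: genericS H => x H g; rewrite H q0 mulr0.
by apply: genericS => y H' g; rewrite H' q0 mulr0.
Qed.

Lemma theta_generic_neq0 p (g : PGL k n.+1) x :
  (forall i, rdomain (alpha (chart_tuple c i)) x) ->
  polyval p (tuple_act g (theta x)) != 0 ->
  generic [set x | polyval p (tuple_act g (theta x)) != 0].
Proof.
move=> dx px; pose V := [set x | (forall i, rdomain (alpha (chart_tuple c i)) x) /\
  polyval p (tuple_act g (theta x)) != 0].
apply: (@genericS _ V) => [y []//|]; apply: generic_open; last by exists x.
move=> y [dy py].
have nd : \forall z \near y, forall i, rdomain (alpha (chart_tuple c i)) z.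
  by apply: filter_forall => i; exact: near_open (rdomain_open _) (dy i).
have rp := regular_polyval_act g p (rtuple_morphism (p := alpha \o chart_tuple c) dy).
by apply: filterS2 nd (regular_neq0 rp py) => z.
Qed.

(** The tuple of the images of the coordinates generates the matrix algebra
    since words in it form a frame, and it satisfies the equations of the model,
    since those hold on a stable set. *)
Lemma theta_in_model : generic [set x | nv_set S (theta x)].
Proof.
have gd := generic_all (fun i => rdomain_generic (alpha (chart_tuple c i))).
have ggen : generic [set x | generates (theta x)].
  have ge := generic_all (fun i => rval_word (alpha \o chart_tuple c) (chart_words c i)).
  apply: genericS2 (hom_frame alpha fb) ge => x ux wx.
  apply: (words_generate (w := chart_words c)).
  rewrite -(_ : (fun i => rval (alpha (word_prod (chart_tuple c) (chart_words c i))) x) =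
    (fun i => word_prod (theta x) (chart_words c i)))//.
  by apply/funext => i; rewrite -wx /word_prod rmorph_prod.
have [C clC SC] := nv_closed S.
apply: genericS2 ggen gd => x0 gx0 dx0; rewrite SC; split=> //.
apply: contrapT => nC.
have [p px0 pC] := open_polyval (closed_openC clC) nC.
have pS s : nv_set S s -> polyval p s = 0.
  by rewrite SC => -[_ Cs]; apply: contrapT => /eqP/pC.
have : generic [set y | forall g : PGL k n.+1, polyval p (tuple_act g (tup y)) = 0].
  apply: genericS (chart_tupleE c) => y ty g; apply: pS; rewrite ty.
  exact: (nv_stable g) (coords_ofP _).
move=> /conj_transfer0 pX.
have [|x [/= px /(_ 1%g) px']] := generic_meet (theta_generic_neq0 (g := 1%g) (p := p) dx0 _) pX.
  by rewrite tuple_act1.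
by move: px; rewrite px' eqxx.
Qed.

(** The map is the inverse of the model composed with [theta]. *)
Lemma fullness : exists (f : ratmap X Y) (df : dominant f),
  forall g, pullback_map df g = alpha g.
Proof.
have gd := generic_all (fun i => rdomain_generic (alpha (chart_tuple c i))).
have [t tE] := ratmap_of_tuple theta_in_model.
(* A nonempty open set of the model that is missed by [t] yields a polynomial
   that vanishes on all conjugates of [theta x], hence on the whole model. *)
have dt : dominant t.
  move=> O [s1 Os1] oO; apply: contrapT => /set0P/negP; rewrite negbK => /eqP nO.
  have {}nO x : rdomain t x -> ~ O (reval t x).
    by move=> tx Otx; suff : set0 (reval t x) by []; rewrite -nO; split=> //; exists x.
  have [U oU UO] := oO; rewrite -UO in Os1.
  have [p p1 pU] := open_polyval oU Os1.
  have : generic [set x | forall g : PGL k n.+1, polyval p (tuple_act g (theta x)) = 0].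
    apply: genericS gd => x dx g; apply: contrapT => /eqP pgx.
    have [y [[py [dy dgy]] ty]] := generic_meet (genericI (theta_generic_neq0 dx pgx)
      (genericI (rdom_generic (of_ratmap t)) (generic_translate g (rdom_generic (of_ratmap t))))) tE.
    apply: (nO (act g y)) => //.
    have -> : reval t (act g y) = act g (reval t y) by exact: rfun_equivariant.
    by rewrite -UO; apply: pU; move: py; rewrite /= -ty.
  move=> /conj_transfer0 pY.
  pose O1 := [set s : nv_space S | polyval p (coords_of s) != 0].
  have oO1 : open O1.
    apply: open_near => s ps; have [cv _] := morphism_at_val s.
    exact: cv _ (near_polyval ps).
  have [y [[/= py /(_ 1%g) ty] [_ Oy]]] := generic_meet (genericI (chart_tupleE c) pY)
    (dominant_open (chart_map_dominant c) oO1 (ex_intro _ s1 p1)).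
  by move: Oy; rewrite /O1 /= -py -[rtuple _ _]tuple_act1 ty eqxx.
have dpsi := chart_inv_dominant c.
have df := ratcomp_dominant (irr_irreducible X) dt dpsi.
exists (ratcomp (irr_irreducible X) (chart_inv c) dt), df.
have fE : generic [set x | tup (reval (ratcomp (irr_irreducible X) (chart_inv c) dt) x) = theta x].
  apply: genericS3 (genericI (generic_pullback df (chart_tupleE c)) tE)
    (ratcompE (irr_irreducible X) (chart_inv c) dt)
    (dominant_generic (irr_irreducible X) dt (chart_invK c)).
  by move=> x [/= -> <-] /= -> [_ _ ->].
pose beta := pullback_hom df.
have tuple_ab i : beta (chart_tuple c i) = alpha (chart_tuple c i).
  apply/rvalP; apply: genericS2 (pullback_mapE df (chart_tuple c i)) fE.
  by move=> x /= -> /ffunP/(_ i); rewrite !ffunE.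
have frame_ab i : beta (word_prod (chart_tuple c) (chart_words c i)) =
    alpha (word_prod (chart_tuple c) (chart_words c i)).
  by rewrite /word_prod !rmorph_prod; apply: eq_bigr => j _; exact: tuple_ab.
have centre_ab z : centre z -> beta z = alpha z.
  move=> cz; have sz := frame_scalar_valued fb cz.
  have [p [q pq]] := rational_expression c z.
  (* The invariance of [z] in terms of [p] and [q]; both sides are regular on
     the model, so that it is enough to compare them on a dense set. *)
  have invariant (g : PGL k n.+1) (s : nv_space S) :
      polyval p (tuple_act g (coords_of s)) * polyval q (coords_of s) =
      polyval q (tuple_act g (coords_of s)) * polyval p (coords_of s).
    apply: contrapT => /eqP ne.
    pose O := [set s : nv_space S |
      polyval p (tuple_act g (coords_of s)) * polyval q (coords_of s) !=
      polyval q (tuple_act g (coords_of s)) * polyval p (coords_of s)].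
    have oO : open O.
      apply: open_near => u ou; apply: regular_neq ou.
        apply: regularM; first exact: regular_polyval_act (morphism_at_val u).
        exact: (morphism_at_val u).2 _ (regular_polyval _ _).
      apply: regularM; first exact: regular_polyval_act (morphism_at_val u).
      exact: (morphism_at_val u).2 _ (regular_polyval _ _).
    have gO := dominant_open (chart_map_dominant c) oO (ex_intro _ s ne).
    have gdom := genericI (rdomain_generic z) (generic_all (fun i => rdomain_generic (chart_tuple c i))).
    have [y [[[[_ Oy] ty] [pqy pqgy]] [[[zy dy] [zgy dgy]] szy]]] :=
      generic_meet (genericI (genericI gO (chart_tupleE c)) (genericI pq (generic_translate g pq)))
       (genericI (genericI gdom (generic_translate g gdom)) sz).
    move: Oy; rewrite /O /= -ty => /eqP; apply.
    have [_ <-] := pqy; have [_] := pqgy.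
    have -> : scalar_value z (act g y) = scalar_value z y.
      by rewrite {1}/scalar_value rval_act// szy PGLconj_scalar mxE eqxx.
    by rewrite (rtuple_act dy dgy) => <-; rewrite mulrCA mulrA.
  have /(conj_transfer alpha (chart_tuple c) p q fb cz) tr : generic [set y |
      forall g : PGL k n.+1, polyval p (tuple_act g (tup y)) =
      scalar_value z y * polyval q (tuple_act g (tup y))].
    apply: genericS2 (chart_tupleE c) pq => y ty [qy zy] g.
    apply: (mulIf qy); rewrite ty invariant -ty -zy.
    by rewrite mulrCA mulrA.
  apply/rvalP.
  have gz := genericI (hom_scalar_valued alpha fb cz) (generic_pullback df sz).
  apply: genericS3 (genericI (pullback_mapE df z) gz) (genericI fE tr) (generic_pullback df pq).
  move=> x [/= -> [-> ->]] [/= fx /(_ 1%g)]; rewrite fx tuple_act1 => px [qx zx].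
  by congr (_%:M); apply: (mulIf qx); rewrite zx px.
move=> g; have [d [cd -> _]] := frame_coords fb g.
rewrite -/(beta _) !rmorph_sum; apply: eq_bigr => i _.
by rewrite !rmorphM /= -frame_ab -centre_ab.
Qed.

End Fullness.

(** * The functor *)

Lemma precomp_id (k : fieldType) n (X : E_obj k n.+1) (g : rmaps X) :
  precomp (E_id X) g = g.
Proof.
apply/rvalP; apply: genericS2 (pullback_mapE (ratid_dominant X) g) (ratidE X).
by move=> x /= -> ->.
Qed.

Lemma precomp_comp (k : fieldType) n (X Y Z : E_obj k n.+1)
    (g : E_hom Y Z) (f : E_hom X Y) (h : rmaps Z) :
  precomp (E_comp g f) h = precomp f (precomp g h).
Proof.
pose df := proj2_sig f.
apply/rvalP; apply: genericS3 (pullback_mapE (proj2_sig (E_comp g f)) h)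
  (genericI (pullback_mapE df (precomp g h))
     (ratcompE (irr_irreducible X) (proj1_sig g) df))
  (generic_pullback df (pullback_mapE (proj2_sig g) h)).
by move=> x /= -> [-> ->] ->.
Qed.


Theorem mainTheorem3 (k : closedFieldType) (n : nat) :
  exists (RMaps_CS : forall X : E_obj k n.+1, is_CS (rmaps X) n.+1)
         (pullback : forall X Y : E_obj k n.+1,
            E_hom X Y -> {lrmorphism rmaps Y -> rmaps X}),
    let RMaps (X : E_cat k n.+1) : CS_cat k n.+1 := CSObj (RMaps_CS X) in
    [/\ forall (X Y : E_obj k n.+1) (f : E_hom X Y) (g : rmaps Y),
          pullback X Y f g = precomp f g,
        forall (X Y : E_obj k n.+1) (f : E_hom X Y), injective (pullback X Y f),
        @contravariant_functor (E_cat k n.+1) (CS_cat k n.+1) RMaps pullback,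
        @full (E_cat k n.+1) (CS_cat k n.+1) RMaps pullback
      & @faithful (E_cat k n.+1) (CS_cat k n.+1) RMaps pullback].
Proof.
have RMaps_CS (X : E_obj k n.+1) : is_CS (rmaps X) n.+1.
  by have [c _] := E_chart X; exact: chart_is_CS c.
pose pullback (X Y : E_obj k n.+1) (f : E_hom X Y) : {lrmorphism rmaps Y -> rmaps X} :=
  pullback_hom (proj2_sig f).
exists RMaps_CS, pullback => RMaps; split=> //.
- by move=> X Y f; apply: simple_hom_injective; have [] := RMaps_CS Y.
- split=> [X|X Y Z g f]; apply: lrmorphism_eq => h; first exact: precomp_id.
  exact: precomp_comp.
- move=> X Y a; have [c _] := E_chart Y.
  have [f [df fa]] := fullness c a.
  by exists (exist _ f df); apply: lrmorphism_eq.
move=> X Y f f' ff'; have [c _] := E_chart Y.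
apply/E_homP/ratmapP; apply: (pullback_faithful (df := proj2_sig f) (df' := proj2_sig f') c) => g.
exact: (congr1 (fun h : {lrmorphism rmaps Y -> rmaps X} => h g) ff').
Qed.
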